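(* Let $1\le p<\infty$ and $\mathbf{T}=(T_1,\dots,T_d)\in\mathfrak{C}_p^d(\mathcal{H})$. Then for any $t\in[0,1]$, $$\|\widetilde{\mathbf{T}}\|_{s,p}\le\|\widehat{\mathbf{T}}(t)\|_{s,p}\le\frac12\left(\|\mathbf{T}^D\|_{s,p}^t\|\mathbf{T}\|_{s,p}^{1-t}+\|\mathbf{T}^D\|_{s,p}^{1-t}\|\mathbf{T}\|_{s,p}^t\right)\le\frac{d^{\frac{t}{p}}+d^{\frac{1-t}{p}}}{2}\|\mathbf{T}\|_{s,p}.$$ In particular, $$\|\widetilde{\mathbf{T}}\|_{s,p}\le\|\widehat{\mathbf{T}}(t)\|_{s,p}\le\frac12\left(\|\mathbf{T}^D\|_{s,p}+\|\mathbf{T}\|_{s,p}\right)\le\frac{1+\sqrt[p]{d}}{2}\|\mathbf{T}\|_{s,p}.$$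
   Context: $\mathcal{H}$ is a separable complex Hilbert space, $\mathfrak{B}(\mathcal{H})$ the bounded linear operators on $\mathcal{H}$, and $d\in\mathbb{N}$. For $\mathbf{T}=(T_1,\dots,T_d)\in\mathfrak{B}(\mathcal{H})^d$ put $P=\sqrt{T_1^*T_1+\cdots+T_d^*T_d}$. For $1\le p<\infty$, $\mathbf{T}\in\mathfrak{C}_p^d(\mathcal{H})$ means $\mathrm{tr}(P^p)<\infty$ (equivalently, the column operator $\mathcal{H}\to\mathcal{H}^d$ with entries $T_1,\dots,T_d$ is in the Schatten $p$-class), and the spherical Schatten $p$-norm is $\|\mathbf{T}\|_{s,p}=[\mathrm{tr}(P^p)]^{1/p}$. Canonical spherical polar decomposition: $\mathbf{T}=\mathbf{V}P=(V_1P,\dots,V_dP)$, where $\mathbf{V}=(V_1,\dots,V_d)$, viewed as a column operator $\mathcal{H}\to\mathcal{H}^d$, is the partial isometry with initial space $\mathcal{N}(P)^\perp$; that is, $T_i=V_iP$ for all $i$ and $\sum_{i=1}^dV_i^*V_i$ is the orthogonal projection onto $\mathcal{N}(P)^\perp$. The conventions $P^0=I$ and $a^0=1$ for real $a\ge0$ are used. For $t\in[0,1]$: the generalized spherical Aluthge transform is $\widetilde{\mathbf{T}}(t)=(P^tV_1P^{1-t},\dots,P^tV_dP^{1-t})$; the spherical Aluthge transform is $\widetilde{\mathbf{T}}=\widetilde{\mathbf{T}}(1/2)$; the spherical Duggal transform is $\mathbf{T}^D=(PV_1,\dots,PV_d)$; the spherical Heinz transform is $\widehat{\mathbf{T}}(t)=\frac12(\widetilde{\mathbf{T}}(t)+\widetilde{\mathbf{T}}(1-t))$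 (coordinatewise operations). *)

(* Defs.v *)
From HB Require Import structures.
From mathcomp Require Import all_boot all_order all_algebra.
From mathcomp Require Import all_classical all_reals all_analysis.
From mathcomp Require Export complex.
Import Order.TTheory GRing.Theory Num.Theory Num.Def.
Import numFieldNormedType.Exports.

Set Implicit Arguments.
Unset Strict Implicit.
Unset Printing Implicit Defensive.

Local Open Scope classical_set_scope.
Local Open Scope ring_scope.
Local Open Scope complex_scope.

Definition separable (X : topologicalType) : Prop :=
  exists2 D : set X, countable D & dense D.

Section Operators.
Context (R : realType) (H : completeNormedModType R[i]).
(* [ip] is linear in its first argument and conjugate-linear in its second. *)
Variable ip : {dot H for @conjC R[i]}.
Implicit Types (A B : H -> H) (f : R -> R) (M : R).

Definition op_bound A M : Prop := forall x, `|A x| <= M%:C * `|x|.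

Definition op_poly (q : {poly R}) A : H -> H :=
  fun x => \sum_(k < size q) (q`_k)%:C *: iter k A x.

(* Unique when it exists: the Hilbert space adjoint. *)
Definition adjoint A : H -> H :=
  xget (fun=> 0) [set B | forall x y, ip (A x) y = ip x (B y)].

(* Continuous functional calculus of a bounded positive operator [A]: when
   [M] bounds [A] its spectrum lies in [0, M], and f(A) is the operator-norm
   limit of q_n(A) for polynomials q_n converging to [f] uniformly on [0, M];
   the limit depends neither on [M] nor on the q_n. *)
Definition is_fun_calc A f B : Prop :=
  exists (M : R) (q : nat -> {poly R}),
    [/\ 0 <= M, op_bound A M,
        {uniform `[0, M], (fun n => horner (q n)) @ \oo --> f} &
        forall e : R, 0 < e ->
          \forall n \near \oo, op_bound (op_poly (q n) A \- B) e].

(* [A] is meant to be positive and [s] nonnegative. Since [powR 0 0 = 1],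
   [op_pow A 0] is the identity, also when [A] is not injective. *)
Definition op_pow A (s : R) : H -> H :=
  xget (fun=> 0) (is_fun_calc A (fun x => x `^ s)).

(* A maximal orthonormal set. *)
Definition is_onb (E : set H) : Prop :=
  (forall u v, E u -> E v -> ip u v = (u == v)%:R) /\
  (forall x, (forall e, E e -> ip x e = 0) -> x = 0).

Definition onb : set H := xget set0 is_onb.

(* Meaningful for positive [A], where it does not depend on the basis. *)
Definition op_trace A : \bar R := \esum_(e in onb) (complex.Re (ip (A e) e))%:E.

Definition orthocomp (S : set H) : set H :=
  [set x | forall y, S y -> ip x y = 0].

Definition is_orthoproj A (S : set H) : Prop :=
  forall x, S (A x) /\ orthocomp S (x - A x).

Section Tuples.
Variable d : nat.
Implicit Types T V : 'I_d -> H -> H.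

Definition sum_adj_self T : H -> H :=
  fun x => \sum_(i < d) adjoint (T i) (T i x).

Definition sph_abs T : H -> H := op_pow (sum_adj_self T) 2^-1.

Definition schatten_class (p : R) T : Prop :=
  (op_trace (op_pow (sph_abs T) p) < +oo)%E.

Definition sph_norm (p : R) T : \bar R :=
  (op_trace (op_pow (sph_abs T) p) `^ p^-1)%E.

Definition is_polar_part T V : Prop :=
  (forall i, T i = V i \o sph_abs T) /\
  is_orthoproj (sum_adj_self V) (orthocomp [set x | sph_abs T x = 0]).

(* In the transforms below [V] is the partial isometry of the polar
   decomposition of [T]. *)
Definition gen_aluthge T V (t : R) : 'I_d -> H -> H :=
  fun i => op_pow (sph_abs T) t \o V i \o op_pow (sph_abs T) (1 - t).

Definition aluthge T V : 'I_d -> H -> H := gen_aluthge T V 2^-1.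

Definition duggal T V : 'I_d -> H -> H := fun i => sph_abs T \o V i.

Definition heinz T V (t : R) : 'I_d -> H -> H :=
  fun i x => 2^-1 *: (gen_aluthge T V t i x + gen_aluthge T V (1 - t) i x).

End Tuples.
End Operators.

(* Main.v *)
Require Import Defs.
From mathcomp Require Import all_boot all_order all_algebra.
From mathcomp Require Import all_classical all_reals all_analysis.
From mathcomp Require Import complex.
From mathcomp Require Import ring lra.
Import Order.TTheory GRing.Theory Num.Theory Num.Def.
Import numFieldNormedType.Exports.

(** Write [X t] for the generalized Aluthge transform [(P^t V_i P^(1-t))_i]. Then
    [X 0] is [T], [X 1] is the Duggal transform, [X (1/2)] is the Aluthge
    transform, and the Heinz transform at [t] is the mean of [X t] and
    [X (1 - t)]. The theorem rests on three facts about the spherical norm.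

    - Arithmetic-geometric mean ([operator_amgm]):
      [|| A Y B || <= || (A^2 Y + Y B^2) / 2 ||] for positive [A] and [B]. With
      [A = B = P^(1/2 - t)] and [Y = P^t V P^t] this is the first inequality. With
      weights it gives [|| X ((s + t) / 2) ||^2 <= || X s || * || X t ||], whence
      log-convexity [|| X t || <= || X 1 ||^t * || X 0 ||^(1 - t)] by dyadic
      subdivision and a limit ([family_interpolation_pos]).
    - The triangle inequality ([sph_norm_triangle]), which with log-convexity
      bounds the Heinz transform.
    - The Duggal bound ([duggal_bound]): on [d] copies of the space [P] has its
      eigenvalues repeated [d] times, and [V] is a contraction.

    The spherical norm is handled through its variational form ([sph_normP]): it
    is the supremum of [(sum_k |<X e_k, f_k>|^p)^(1/p)] over finite orthonormal
    families [e] in the space and [f] in its [d]-fold sum. If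
    [X = sum_j s_j w_j <., h_j>] is a singular value decomposition, then
    [|<X e_k, f_k>| <= sum_j D_kj s_j], where [D_kj] is the mean of
    [|<e_k, h_j>|^2] and [|<w_j, f_k>|^2]. Bessel's inequality makes [D] doubly
    substochastic, and such kernels contract the l^p norm
    ([powR_substochastic]). The same computation shows that a Schur multiplier
    with a Gram kernel of unit diagonal is a contraction ([svd_lower]); the
    arithmetic-geometric mean inequality is the case of the kernel
    [2 a b / (a^2 + b^2)], whose Gram decomposition is a geometric series in the
    Cayley transforms of [a^2] and [b^2] ([cayley_series]). The Duggal bound and
    the triangle inequality also come from the variational form.

    To reach singular values one must know that [P] is compact. The functional
    calculus of a bounded positive operator [A] is controlled by compressing [A]
    to Krylov subspaces, where polynomials in [A] become polynomials in a compact
    diagonalizable operator ([poly_reduce]). This gives the existence of [P^p] and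
    the positivity of the calculus, and finiteness of the trace of [P^p] then
    forces [P] to be compact ([finite_trace_cpt]). After that every operator in
    sight is diagonal in an eigenbasis of [P], or has an eigenbasis of its own. *)

Set Implicit Arguments.
Unset Strict Implicit.
Unset Printing Implicit Defensive.

Local Open Scope classical_set_scope.
Local Open Scope ring_scope.
Local Open Scope complex_scope.

(** * Inequalities for real powers and l^p sums *)

Section PowerInequalities.
Context {R : realType}.
Implicit Types (p u c M S e dl : R).

(** Convexity of the power [p] in the form of its tangent line at [c], obtained
    from Young's inequality for the conjugate exponents [p] and [p / (p - 1)]. *)
Lemma powR_tangent p u c : 1 <= p -> 0 <= u -> 0 <= c ->
  p * (u * c `^ (p - 1)) <= u `^ p + (p - 1) * c `^ p.
Proof.
move=> p1 u0 c0.
have p0 : 0 < p by apply: lt_le_trans p1.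
have [p1E|pn1] := eqVneq p 1.
  by rewrite p1E subrr powRr0 mulr1 mul1r mul0r addr0 powRr1.
have pm0 : 0 < p - 1 by rewrite subr_gt0 lt_neqAle eq_sym pn1.
pose q := p / (p - 1).
have q0 : 0 < q by rewrite divr_gt0.
have pq : p^-1 + q^-1 = 1 by rewrite /q; field; rewrite !gt_eqF.
have /= := conjugate_powR u0 (powR_ge0 c (p - 1)) p0 q0 pq.
rewrite -powRrM.
have -> : (p - 1) * q = p by rewrite /q; field; rewrite gt_eqF.
move=> /(ler_wpM2l (ltW p0)) /le_trans; apply.
by rewrite le_eqVlt; apply/orP; left; apply/eqP; rewrite /q; field; rewrite !gt_eqF.
Qed.

Lemma ler_sum_seq (I : eqType) (s : seq I) (F G : I -> R) :
  (forall i, i \in s -> F i <= G i) -> \sum_(i <- s) F i <= \sum_(i <- s) G i.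
Proof.
by move=> h; rewrite big_seq [leRHS]big_seq; apply: ler_sum => i; apply: h.
Qed.

Lemma sumr_ge0_seq (I : eqType) (s : seq I) (F : I -> R) :
  (forall i, i \in s -> 0 <= F i) -> 0 <= \sum_(i <- s) F i.
Proof. by move=> h; rewrite big_seq; apply: sumr_ge0 => i; apply: h. Qed.

(** The total weight may be less than one: the missing mass sits at the value
    zero, whose power is zero. *)
Lemma powR_jensen (J : eqType) p (G : seq J) (w a : J -> R) : 1 <= p ->
  (forall j, j \in G -> 0 <= w j) -> (forall j, j \in G -> 0 <= a j) ->
  \sum_(j <- G) w j <= 1 ->
  (\sum_(j <- G) w j * a j) `^ p <= \sum_(j <- G) w j * a j `^ p.
Proof.
move=> p1 w0 a0 w1.
have p0 : 0 < p by apply: lt_le_trans p1.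
set c := \sum_(j <- G) w j * a j; set W := \sum_(j <- G) w j.
have c0 : 0 <= c by apply: sumr_ge0_seq => j jG; rewrite mulr_ge0 ?w0 ?a0.
(* the tangent inequality at c, averaged against the weights *)
have h : \sum_(j <- G) w j * (p * (a j * c `^ (p - 1)) - (p - 1) * c `^ p)
    <= \sum_(j <- G) w j * a j `^ p.
  apply: ler_sum_seq => j jG; apply: ler_wpM2l; first exact: w0.
  by rewrite lerBlDr powR_tangent ?a0.
apply: le_trans h.
have -> : \sum_(j <- G) w j * (p * (a j * c `^ (p - 1)) - (p - 1) * c `^ p)
    = p * c `^ (p - 1) * c - W * ((p - 1) * c `^ p).
  rewrite /W mulr_suml /c mulr_sumr -sumrB; apply: eq_bigr => j _; ring.
rewrite -mulrA (mulrC _ c).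
have -> : c * c `^ (p - 1) = c `^ p by rewrite mulr_powRB1.
have pm : 0 <= p - 1 by rewrite subr_ge0.
have := ler_wpM2r (mulr_ge0 pm (powR_ge0 c p)) w1.
rewrite -/W; set T := c `^ p => hW; nra.
Qed.

(** Doubly substochastic kernels contract the l^p norm: Jensen's inequality in
    each row, then the column sums. Every norm inequality below is an instance,
    the kernel being built from squared moduli of inner products. *)
Lemma powR_substochastic (I J : eqType) p (s : seq I) (G : seq J)
    (D : I -> J -> R) (a : J -> R) (x : I -> R) : 1 <= p ->
  (forall i j, i \in s -> j \in G -> 0 <= D i j) ->
  (forall j, j \in G -> 0 <= a j) ->
  (forall i, i \in s -> \sum_(j <- G) D i j <= 1) ->
  (forall j, j \in G -> \sum_(i <- s) D i j <= 1) ->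
  (forall i, i \in s -> 0 <= x i <= \sum_(j <- G) D i j * a j) ->
  \sum_(i <- s) x i `^ p <= \sum_(j <- G) a j `^ p.
Proof.
move=> p1 D0 a0 Dr Dc xD.
have p0 : 0 <= p by apply: le_trans p1.
apply: (@le_trans _ _ (\sum_(i <- s) \sum_(j <- G) D i j * a j `^ p)).
  apply: ler_sum_seq => i si; have /andP[x0 xs] := xD i si.
  apply: le_trans (powR_jensen p1 _ a0 (Dr i si)); last by move=> j; apply: D0.
  by rewrite ge0_ler_powR ?nnegrE// (le_trans x0).
rewrite exchange_big /=; apply: ler_sum_seq => j jG; rewrite -mulr_suml.
by rewrite -[leRHS]mul1r ler_wpM2r ?powR_ge0 ?Dc.
Qed.

Lemma powRD_ge0 (x r s : R) : 0 <= r -> 0 <= s -> x `^ (r + s) = x `^ r * x `^ s.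
Proof.
move=> r0 s0; have [->|xn0] := eqVneq x 0; last by rewrite powRD// xn0 implybT.
have [->|rn0] := eqVneq r 0; first by rewrite add0r powRr0 mul1r.
have rs : r + s != 0 by rewrite gt_eqF// ltr_wpDr// lt_neqAle eq_sym rn0.
by rewrite (powR0 rs) (powR0 rn0) mul0r.
Qed.

Lemma powRV_le p (x : R) S : 0 < p -> 0 <= x -> 0 <= S ->
  (x <= S `^ p^-1) = (x `^ p <= S).
Proof.
move=> p0 x0 S0.
have -> : (x `^ p <= S) = (x `^ p <= (S `^ p^-1) `^ p).
  by rewrite -powRrM mulVf ?gt_eqF// powRr1.
apply/idP/idP => h.
  by rewrite ge0_ler_powR ?nnegrE ?(ltW p0) ?powR_ge0.
rewrite leNgt; apply/negP => h2; move: h; rewrite leNgt => /negP; apply.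
by rewrite gt0_ltr_powR ?nnegrE ?powR_ge0.
Qed.

Lemma powR_le_powR p (x y : R) : 0 < p -> 0 <= x -> 0 <= y ->
  (x `^ p <= y `^ p) = (x <= y).
Proof.
move=> p0 x0 y0; rewrite -powRV_le ?powR_ge0//.
by rewrite -powRrM divff ?gt_eqF// powRr1.
Qed.

Lemma powR_minkowski (I : eqType) p (s : seq I) (x y : I -> R) (a b : R) : 1 <= p ->
  0 <= a -> 0 <= b ->
  (forall i, i \in s -> 0 <= x i) -> (forall i, i \in s -> 0 <= y i) ->
  \sum_(i <- s) x i `^ p <= a `^ p -> \sum_(i <- s) y i `^ p <= b `^ p ->
  \sum_(i <- s) (x i + y i) `^ p <= (a + b) `^ p.
Proof.
move=> p1 a0 b0 x0 y0 xa yb; have p0 : 0 < p by apply: lt_le_trans p1.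
have zero (z : I -> R) : (forall i, i \in s -> 0 <= z i) ->
    \sum_(i <- s) z i `^ p <= 0 -> forall i, i \in s -> z i = 0.
  move=> z0 zs i si; apply/eqP; rewrite eq_le z0// andbT.
  rewrite -(powR_le_powR p0)//; last exact: z0.
  rewrite (powR0 (lt0r_neq0 p0)); apply: le_trans zs.
  rewrite (perm_big _ (perm_to_rem si)) big_cons lerDl.
  by apply: sumr_ge0 => j _; apply: powR_ge0.
move: a0; rewrite le_eqVlt => /predU1P[aE|a0].
  rewrite -aE add0r; rewrite -aE (powR0 (lt0r_neq0 p0)) in xa.
  rewrite big_seq (eq_bigr (fun i => y i `^ p)) -?big_seq// => i si.
  by rewrite (zero x) ?add0r.
move: b0; rewrite le_eqVlt => /predU1P[bE|b0].
  rewrite -bE addr0; rewrite -bE (powR0 (lt0r_neq0 p0)) in yb.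
  rewrite big_seq (eq_bigr (fun i => x i `^ p)) -?big_seq// => i si.
  by rewrite (zero y) ?addr0.
have ab : 0 < a + b by rewrite addr_gt0.
(* convexity at the point (a / (a+b)) (x/a) + (b / (a+b)) (y/b) *)
have key i : i \in s -> (x i + y i) `^ p <=
   (a + b) `^ p * (a / (a + b) * (x i `^ p / a `^ p)
                   + b / (a + b) * (y i `^ p / b `^ p)).
  move=> si.
  pose w (t : bool) := if t then a / (a + b) else b / (a + b).
  pose v (t : bool) := if t then x i / a else y i / b.
  have J := @powR_jensen bool p [:: true; false] w v p1.
  rewrite !big_cons !big_nil !addr0 /w /v /= in J.
  have -> : x i + y i = (a + b) * (a / (a + b) * (x i / a) + b / (a + b) * (y i / b)).
    by field; rewrite !gt_eqF.
  rewrite powRM ?(ltW ab)//; last first.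
    by rewrite addr_ge0// !mulr_ge0 ?invr_ge0 ?x0 ?y0// ltW.
  rewrite ler_wpM2l ?powR_ge0//.
  have dE (u z : R) : 0 <= u -> 0 < z -> u `^ p / z `^ p = (u / z) `^ p.
    move=> u0 z0; rewrite powRM// ?invr_ge0 ?(ltW z0)//; congr (_ * _).
    by rewrite -(powR_inv1 (ltW z0)) -powRrM mulN1r powRN.
  rewrite !dE ?x0 ?y0//; apply: J.
  - by case=> _; rewrite divr_ge0// ltW.
  - by case=> _; rewrite divr_ge0 ?x0 ?y0// ltW.
  - by rewrite -mulrDl divff// gt_eqF.
apply: le_trans (ler_sum_seq key) _.
rewrite -mulr_sumr -[leRHS]mulr1 ler_wpM2l ?powR_ge0//.
rewrite big_split /= -!mulr_sumr -!mulr_suml.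
have -> : 1 = a / (a + b) * 1 + b / (a + b) * 1 :> R.
  by rewrite !mulr1 -mulrDl divff// gt_eqF.
by rewrite lerD// (ler_wpM2l (divr_ge0 (ltW _) (ltW ab)))//
  ler_pdivrMr ?powR_gt0// mul1r.
Qed.

(** Concavity gives the modulus [h `^ s] when [s <= 1], and the tangent line
    gives a Lipschitz bound when [s >= 1]. *)
Lemma powR_modulus (s : R) M : 0 <= s -> 0 <= M -> forall e : R, 0 < e ->
  exists2 dl : R, 0 < dl & forall x y : R, 0 <= x <= M -> 0 <= y <= M ->
    `|x - y| <= dl -> `|x `^ s - y `^ s| <= e.
Proof.
move=> s0 M0 e e0.
suff [dl dl0 h] : exists2 dl : R, 0 < dl & forall x y : R, 0 <= x -> x <= y -> y <= M ->
    y - x <= dl -> y `^ s - x `^ s <= e.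
  exists dl => // x y /andP[x0 xM] /andP[y0 yM].
  wlog xy : x y x0 xM y0 yM / x <= y.
    move=> W; have [xy|/ltW yx] := leP x y; first exact: W.
    by rewrite distrC [X in _ -> X <= _]distrC; apply: W.
  rewrite distrC ger0_norm ?subr_ge0// => d.
  rewrite distrC ger0_norm ?subr_ge0 ?ge0_ler_powR ?nnegrE//.
  exact: h.
have [->|sn0] := eqVneq s 0.
  by exists 1 => // x y _ _ _ _; rewrite !powRr0 subrr ltW.
have {sn0 s0}s0 : 0 < s by rewrite lt_neqAle eq_sym sn0.
have [s1|s1] := leP s 1.
  exists (e `^ s^-1); first exact: powR_gt0.
  move=> x y x0 xy yM d.
  have : y `^ s - x `^ s <= (y - x) `^ s.
    have [->|yn0] := eqVneq y 0.
      by rewrite powR0 ?gt_eqF// lerBlDl addr_ge0 ?powR_ge0.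
    have y0 : 0 < y by rewrite lt_neqAle eq_sym yn0 (le_trans x0).
    have f z : 0 <= z <= y -> z / y * y `^ s <= z `^ s.
      case/andP=> z0 zy; have [->|zn0] := eqVneq z 0.
        by rewrite !mul0r powR_ge0.
      rewrite -[in leRHS](divfK yn0 z) powRM ?divr_ge0 ?(ltW y0)//.
      rewrite ler_wpM2r ?powR_ge0// ger1_powR//.
      have zgt0 : 0 < z by rewrite lt_neqAle eq_sym zn0.
      by rewrite divr_gt0//= ler_pdivrMr// mul1r.
    have h1 := f x; rewrite x0 xy in h1.
    have h2 := f (y - x); rewrite subr_ge0 xy /= lerBlDr lerDl x0 in h2.
    rewrite lerBlDl; apply: le_trans (lerD (h1 isT) (h2 isT)).
    by rewrite -!mulrDl [x + _]addrC subrK divff// mul1r.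
  move=> /le_trans; apply.
  rewrite -powRV_le// ?subr_ge0//; exact: ltW.
exists (e / (s * M `^ (s - 1) + 1)).
  by rewrite divr_gt0// ltr_wpDl// mulr_ge0 ?powR_ge0 ?ltW.
move=> x y x0 xy yM.
have K0 : 0 < s * M `^ (s - 1) + 1 by rewrite ltr_wpDl// mulr_ge0 ?powR_ge0 ?ltW.
rewrite ler_pdivlMr// => d; apply: le_trans d.
have y0 := le_trans x0 xy.
have T := powR_tangent (ltW s1) x0 y0.
have YE : y * y `^ (s - 1) = y `^ s by rewrite mulr_powRB1.
apply: (@le_trans _ _ (s * (y - x) * y `^ (s - 1))).
  by rewrite -YE in T *; move: T; lra.
rewrite [leRHS]mulrC -[s * _ * _]mulrA [(y - x) * _]mulrC mulrA.
rewrite ler_wpM2r ?subr_ge0// ler_wpDr// ler_wpM2l ?(ltW s0)//.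
by rewrite ge0_ler_powR ?nnegrE ?subr_ge0 ?(ltW s1).
Qed.

Lemma powR_cont (s x : R) : 0 <= s -> 0 <= x -> forall e : R, 0 < e ->
  exists2 dl : R, 0 < dl & forall y : R, 0 <= y -> `|x - y| <= dl -> `|x `^ s - y `^ s| <= e.
Proof.
move=> s0 x0 e e0.
have [|dl dl0 h] := powR_modulus s0 (_ : 0 <= x + 1) e0; first by rewrite addr_ge0.
exists (Num.min dl 1); first by rewrite lt_min dl0 ltr01.
move=> y y0; rewrite le_min => /andP[d d1]; apply: h => //.
  by rewrite x0 lerDl ler01.
by rewrite y0 /= -lerBlDl (le_trans _ d1)// distrC ler_norm.
Qed.

Lemma harmonic_le e : 0 < e ->
  exists N, forall n, (N <= n)%N -> n.+1%:R^-1 <= e.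
Proof.
move=> e0; have ei : 0 <= e^-1 by rewrite invr_ge0 ltW.
exists (Num.truncn (e^-1)) => n Nn.
rewrite -[leRHS]invrK lef_pV2 ?posrE ?ltr0n ?invr_gt0//.
have /andP[_ /ltW /le_trans] := truncn_itv ei; apply.
by rewrite ler_nat ltnS.
Qed.

(** By Minkowski's inequality the l^p norm of [x] exceeds that of [y] by at most
    the norm of the constant [e]; then [e] tends to zero. *)
Lemma powR_sum_closure (I : eqType) p (s : seq I) (x : I -> R) S : 1 <= p ->
  0 <= S -> (forall i, i \in s -> 0 <= x i) ->
  (forall e : R, 0 < e -> exists y : I -> R,
    [/\ forall i, i \in s -> 0 <= y i, forall i, i \in s -> x i <= e + y i
      & \sum_(i <- s) y i `^ p <= S]) ->
  \sum_(i <- s) x i `^ p <= S.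
Proof.
move=> p1 S0 x0 h; have p0 : 0 < p by apply: lt_le_trans p1.
pose N := S `^ p^-1.
have NE : N `^ p = S by rewrite -powRrM mulVf ?gt_eqF// powRr1.
pose n := (size s)%:R : R; have n0 : 0 <= n by rewrite ler0n.
pose c := n `^ p^-1.
have cE : c `^ p = n by rewrite -powRrM mulVf ?gt_eqF// powRr1.
apply/ler_addgt0Pl => e e0.
have [dl dl0 hd] := powR_cont (ltW p0) (powR_ge0 S p^-1) e0.
have c1 : 0 < c + 1 by rewrite ltr_wpDl ?powR_ge0.
pose eta := dl / (c + 1).
have eta0 : 0 < eta by rewrite divr_gt0.
have [y [y0 xy ys]] := h _ eta0.
have yN : \sum_(i <- s) y i `^ p <= N `^ p by rewrite NE.
have Me : \sum_(i <- s) eta `^ p <= (c * eta) `^ p.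
  rewrite powRM ?powR_ge0 ?(ltW eta0)// cE big_const_seq count_predT.
  by rewrite iter_addr_0 -mulr_natl.
have := @powR_minkowski I p s (fun=> eta) y (c * eta) N p1.
move=> /(_ _ (powR_ge0 _ _) _ y0 Me yN).
rewrite mulr_ge0 ?powR_ge0 ?(ltW eta0)// => /(_ isT (fun _ _ => isT)) K.
apply: (@le_trans _ _ ((c * eta + N) `^ p)).
  apply: le_trans K; apply: ler_sum_seq => i si.
  by rewrite ge0_ler_powR ?nnegrE ?xy ?x0 ?(ltW p0)// addr_ge0 ?y0 ?ltW.
have ce : 0 <= c * eta by rewrite mulr_ge0 ?powR_ge0 ?(ltW eta0).
have := hd (c * eta + N); rewrite addr_ge0 ?powR_ge0// => /(_ isT).
rewrite opprD addrCA subrr addr0 normrN ger0_norm// => /(_ _) K2.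
have /K2 : c * eta <= dl.
  by rewrite /eta mulrCA -[leRHS]mulr1 ler_pM2l// ler_pdivrMr// mul1r lerDl.
by rewrite NE distrC => /(le_trans (ler_norm _)); rewrite lerBlDr.
Qed.

End PowerInequalities.

(** * Polynomial approximation of real powers *)

Section PolynomialApproximation.
Context {R : realType}.
Implicit Types (x y c e dl K M D a : R) (g : nat -> R).

(** The expectation of [g] under the binomial law, written through the recursion
    on the first coin toss. No binomial coefficient appears, and every estimate
    is an induction on [n]. *)
Fixpoint bernstein n g : {poly R} :=
  if n is m.+1 then 'X * bernstein m (g \o S) + (1 - 'X) * bernstein m g
  else (g 0%N)%:P.

(** A bound by a parabola in [k] integrates to the same parabola evaluated at
    the mean of the binomial law, plus its variance. *)
Lemma bernstein_near n g x c e D a : 0 <= x <= 1 ->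
  (forall k, (k <= n)%N -> `|g k - c| <= e + D * (k%:R - a) ^+ 2) ->
  `|(bernstein n g).[x] - c| <= e + D * (n%:R * x * (1 - x) + (n%:R * x - a) ^+ 2).
Proof.
move=> /andP[x0 x1]; elim: n g a => [|n IH] g a h.
  by have := h 0%N isT; rewrite !mulr0n /= hornerC !mul0r !add0r.
rewrite /= !hornerE.
have h1 := IH (g \o S) (a - 1).
have h2 := IH g a (fun k kn => h k (leqW kn)).
have {}h1 : `|(bernstein n (g \o S)).[x] - c|
    <= e + D * (n%:R * x * (1 - x) + (n%:R * x - (a - 1)) ^+ 2).
  apply: h1 => k kn /=; apply: le_trans (h k.+1 kn) _.
  by rewrite -natr1 opprB addrA -addrA [1 - a]addrC addrA.
set A := (bernstein n (g \o S)).[x] in h1 *; set B := (bernstein n g).[x] in h2 *.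
have -> : x * A + (1 - x) * B - c = x * (A - c) + (1 - x) * (B - c) by ring.
apply: le_trans (ler_normD _ _) _.
have x1' : 0 <= 1 - x by rewrite subr_ge0.
rewrite !normrM (ger0_norm x0) (ger0_norm x1').
apply: le_trans (lerD (ler_wpM2l x0 h1) (ler_wpM2l x1' h2)) _.
by rewrite le_eqVlt -natr1; apply/orP; left; apply/eqP; ring.
Qed.

(** Chebyshev's inequality for the binomial law with parameters [n] and [x]:
    the variance of [k / n] is at most [1 / n]. *)
Lemma bernstein_approx (f : R -> R) K e dl : 0 < e -> 0 < dl -> 0 <= K ->
  (forall x y, 0 <= x <= 1 -> 0 <= y <= 1 -> `|x - y| <= dl -> `|f x - f y| <= e) ->
  (forall x y, 0 <= x <= 1 -> 0 <= y <= 1 -> `|f x - f y| <= K) ->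
  exists q : {poly R}, forall x, 0 <= x <= 1 -> `|q.[x] - f x| <= e + e.
Proof.
move=> e0 dl0 K0 fu fK.
have [n nK] : exists n, K / (e * dl ^+ 2) < n.+1%:R.
  have q0 : 0 <= K / (e * dl ^+ 2) by rewrite divr_ge0// mulr_ge0 ?sqr_ge0// ltW.
  exists (Num.truncn (K / (e * dl ^+ 2))).
  by have /andP[] := truncn_itv q0.
set N := n.+1%:R in nK; have N0 : 0 < N by rewrite ltr0n.
exists (bernstein n.+1 (fun k => f (k%:R / N))) => x x01.
have xx : x * (1 - x) <= 1 by have := x01; nra.
have := @bernstein_near n.+1 (fun k => f (k%:R / N)) x (f x) e
  (K / (N * dl) ^+ 2) (N * x) x01.
rewrite -/N subrr expr0n addr0.
have Nd : 0 < N * dl by rewrite mulr_gt0.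
have main k : (k <= n.+1)%N -> `|f (k%:R / N) - f x|
    <= e + K / (N * dl) ^+ 2 * (k%:R - N * x) ^+ 2.
  move=> kn.
  have kN : 0 <= k%:R / N <= 1.
    by rewrite divr_ge0 ?ler0n ?(ltW N0)//= ler_pdivrMr// mul1r ler_nat.
  have D0 : 0 <= K / (N * dl) ^+ 2 * (k%:R - N * x) ^+ 2.
    by rewrite mulr_ge0 ?sqr_ge0// divr_ge0 ?sqr_ge0.
  have [kd|kd] := leP `|k%:R / N - x| dl.
    by rewrite (le_trans (fu _ _ kN x01 kd))// lerDl.
  rewrite (le_trans (fK _ _ kN x01))// ler_wpDl ?(ltW e0)//.
  rewrite -[leLHS]mulr1 -mulrA ler_wpM2l//.
  rewrite mulrC ler_pdivlMr ?exprn_gt0// mul1r.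
  have -> : k%:R - N * x = N * (k%:R / N - x) by field; rewrite gt_eqF.
  rewrite !exprMn ler_wpM2l ?sqr_ge0//.
  by rewrite -[leRHS]real_normK ?num_real// lerXn2r ?nnegrE ?(ltW dl0)// ltW.
move=> /(_ main) /le_trans; apply; rewrite lerD2l.
have -> : K / (N * dl) ^+ 2 * (N * x * (1 - x)) = K / (N * dl ^+ 2) * (x * (1 - x)).
  by field; rewrite !gt_eqF.
apply: (@le_trans _ _ (K / (N * dl ^+ 2) * 1)).
  by rewrite ler_wpM2l// divr_ge0// mulr_ge0 ?sqr_ge0// ltW.
rewrite mulr1 ler_pdivrMr ?mulr_gt0 ?exprn_gt0//.
have := nK; rewrite ltr_pdivrMr ?mulr_gt0 ?exprn_gt0// => /ltW /le_trans; apply.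
by rewrite mulrCA.
Qed.

Lemma powR_approx (s M : R) : 0 <= s -> 0 < M -> forall e, 0 < e ->
  exists q : {poly R}, forall x, 0 <= x <= M -> `|q.[x] - x `^ s| <= e.
Proof.
move=> s0 M0 e e0; have e2 : 0 < e / 2 by rewrite divr_gt0.
have [dl dl0 hd] := powR_modulus s0 (ltW M0) e2.
have Mx x : 0 <= x <= 1 -> 0 <= M * x <= M.
  by case/andP=> x0 x1; rewrite mulr_ge0 ?(ltW M0)//= ler_piMr ?(ltW M0).
have [||x y x01 y01|x y x01 y01|q hq] :=
    @bernstein_approx (fun x => (M * x) `^ s) (M `^ s) (e / 2) (dl / M) e2.
- by rewrite divr_gt0.
- exact: powR_ge0.
- rewrite ler_pdivlMr// => h; apply: hd; rewrite ?Mx//.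
  by rewrite -mulrBr normrM (gtr0_norm M0) mulrC.
- have b z : 0 <= z <= 1 -> 0 <= (M * z) `^ s <= M `^ s.
    by move=> z01; have /andP[? ?] := Mx z z01;
      rewrite powR_ge0/= ge0_ler_powR ?nnegrE ?(ltW M0).
  have := b x x01; have := b y y01; case/andP=> ? ? /andP[? ?].
  by rewrite ler_norml; apply/andP; split; lra.
exists (q \Po (M^-1 *: 'X)) => x /andP[x0 xM].
have := hq (M^-1 * x); rewrite mulrA mulfV ?gt_eqF// mul1r -splitr.
rewrite horner_comp hornerZ hornerX; apply.
by rewrite mulr_ge0 ?invr_ge0 ?(ltW M0)//= mulrC ler_pdivrMr// mul1r.
Qed.

End PolynomialApproximation.

(** * Complex moduli and semi-inner products *)

Section ComplexModulus.
Context {R : realType}.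
Local Notation C := R[i].
Implicit Types z w : C.

Definition md z : R := Normc.normc z.

Lemma normE z : `|z| = (md z)%:C. Proof. by case: z => a b; rewrite normc_def. Qed.
Lemma md_sqr z : md z ^+ 2 = complex.Re z ^+ 2 + complex.Im z ^+ 2.
Proof. by case: z => a b; rewrite /md /= sqr_sqrtr// addr_ge0 ?sqr_ge0. Qed.
Lemma md_ge0 z : 0 <= md z.
Proof. by case: z => a b; apply: sqrtr_ge0. Qed.
Lemma mdM z w : md (z * w) = md z * md w. Proof. exact: Normc.normcM. Qed.
Lemma mdD z w : md (z + w) <= md z + md w. Proof. exact: le_normcD. Qed.
Lemma mdN z : md (- z) = md z. Proof. exact: normcN. Qed.
Lemma md0 : md 0 = 0. Proof. exact: Normc.normc0. Qed.
Lemma md0_eq0 z : md z = 0 -> z = 0. Proof. exact: Normc.eq0_normc. Qed.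
Lemma md_conj z : md (conjc z) = md z.
Proof. by case: z => a b; rewrite /md /= sqrrN. Qed.
Lemma md_real (a : R) : md a%:C = `|a|.
Proof. by rewrite /md /= expr0n /= addr0 sqrtr_sqr. Qed.
Lemma Re_md z : complex.Re z <= md z.
Proof.
apply: le_trans (ler_norm _) _; rewrite -sqrtr_sqr; case: z => a b /=.
by rewrite ler_wsqrtr// lerDl sqr_ge0.
Qed.
Lemma mulJ z : z * conjc z = (md z ^+ 2)%:C.
Proof.
rewrite md_sqr; case: z => a b; apply/eqP; rewrite eq_complex /=.
by apply/andP; split; apply/eqP; ring.
Qed.
Lemma ReD z w : complex.Re (z + w) = complex.Re z + complex.Re w.
Proof. by case: z w => [? ?] [? ?]. Qed.
Lemma ReN z : complex.Re (- z) = - complex.Re z.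
Proof. by case: z. Qed.
Lemma ReB z w : complex.Re (z - w) = complex.Re z - complex.Re w.
Proof. by rewrite ReD ReN. Qed.
Lemma Re_conj z : complex.Re (conjc z) = complex.Re z.
Proof. by case: z. Qed.
Lemma ReZ (a : R) z : complex.Re (a%:C * z) = a * complex.Re z.
Proof. by case: z => ? ? /=; rewrite mul0r subr0. Qed.
Lemma Re_sum (I : Type) (s : seq I) (F : I -> C) :
  complex.Re (\sum_(i <- s) F i) = \sum_(i <- s) complex.Re (F i).
Proof. by elim/big_rec2: _ => // i ? ? _ <-; rewrite ReD. Qed.
Lemma md_sum (I : Type) (s : seq I) (F : I -> C) :
  md (\sum_(i <- s) F i) <= \sum_(i <- s) md (F i).
Proof.
elim/big_rec2: _ => [|i y x _ h]; first by rewrite md0.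
by apply: le_trans (mdD _ _) _; rewrite lerD2l.
Qed.
Lemma conjM z w : conjc (z * w) = conjc z * conjc w. Proof. exact: rmorphM. Qed.
Lemma conjD z w : conjc (z + w) = conjc z + conjc w. Proof. exact: rmorphD. Qed.
Lemma conjN z : conjc (- z) = - conjc z. Proof. exact: rmorphN. Qed.
Lemma md_eq (a : R) z : z = a%:C -> 0 <= a -> md z = a.
Proof. by move=> -> a0; rewrite md_real ger0_norm. Qed.

Lemma md_small_eq0 z : (forall e : R, 0 < e -> md z <= e) -> z = 0.
Proof.
move=> h; apply: md0_eq0; apply/eqP; rewrite eq_le md_ge0 andbT.
by apply/ler_addgt0Pl => e e0; rewrite addr0 h.
Qed.

End ComplexModulus.

Section SemiInnerProduct.
Context {R : realType} (L : lmodType R[i]).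

Record sip (b : L -> L -> R[i]) : Prop := Sip {
  sip_lin : forall a x y z, b (a *: x + y) z = a * b x z + b y z;
  sip_sym : forall x y, b y x = conjc (b x y);
  sip_ge0 : forall x, 0 <= complex.Re (b x x) }.

Variables (b : L -> L -> R[i]) (bP : sip b).
Implicit Types (x y z : L) (a : R[i]).

Lemma sipDl x y z : b (x + y) z = b x z + b y z.
Proof. by have := sip_lin bP 1 x y z; rewrite scale1r mul1r. Qed.
Lemma sip0l z : b 0 z = 0.
Proof. by have := sipDl 0 0 z; rewrite addr0 => /eqP; rewrite -subr_eq0 opprD addNKr oppr_eq0 => /eqP. Qed.
Lemma sipZl a x z : b (a *: x) z = a * b x z.
Proof. by have := sip_lin bP a x 0 z; rewrite addr0 sip0l addr0. Qed.
Lemma sipNl x z : b (- x) z = - b x z.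
Proof. by rewrite -scaleN1r sipZl mulN1r. Qed.
Lemma sipBl x y z : b (x - y) z = b x z - b y z.
Proof. by rewrite sipDl sipNl. Qed.
Lemma sipDr x y z : b z (x + y) = b z x + b z y.
Proof. by rewrite sip_sym// sipDl conjD -!(sip_sym bP). Qed.
Lemma sipZr a x z : b z (a *: x) = conjc a * b z x.
Proof. by rewrite sip_sym// sipZl conjM -(sip_sym bP). Qed.
Lemma sipNr x z : b z (- x) = - b z x.
Proof. by rewrite sip_sym// sipNl conjN -(sip_sym bP). Qed.
Lemma sipBr x y z : b z (x - y) = b z x - b z y.
Proof. by rewrite sipDr sipNr. Qed.
Lemma sip0r z : b z 0 = 0.
Proof. by rewrite sip_sym// sip0l conjc0. Qed.
Lemma sip_suml (I : Type) (s : seq I) (F : I -> L) z :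
  b (\sum_(i <- s) F i) z = \sum_(i <- s) b (F i) z.
Proof. by elim/big_rec2: _ => [|i ? ? _ <-]; rewrite ?sip0l// sipDl. Qed.
Lemma sip_sumr (I : Type) (s : seq I) (F : I -> L) z :
  b z (\sum_(i <- s) F i) = \sum_(i <- s) b z (F i).
Proof. by elim/big_rec2: _ => [|i ? ? _ <-]; rewrite ?sip0r// sipDr. Qed.

Definition sq x : R := complex.Re (b x x).

Lemma sipxx x : b x x = (sq x)%:C.
Proof.
have := sip_sym bP x x; rewrite /sq; case: (b x x) => u v [] /eqP.
by rewrite -subr_eq0 opprK -mulr2n mulrn_eq0 /= => /eqP ->.
Qed.

Lemma sqB x y : sq (x - y) = sq x - 2 * complex.Re (b x y) + sq y.
Proof.
rewrite /sq sipBl !sipBr !ReB (sip_sym bP x y) Re_conj; ring.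
Qed.

Lemma sqZ a x : sq (a *: x) = md a ^+ 2 * sq x.
Proof. by rewrite /sq sipZl sipZr mulrA mulJ ReZ. Qed.

Lemma md_sip_sym x y : md (b x y) = md (b y x).
Proof. by rewrite (sip_sym bP y x) md_conj. Qed.

Lemma sip_proj x y : sq (x - b x y *: y) = sq x - md (b x y) ^+ 2 * (2 - sq y).
Proof. rewrite sqB sqZ sipZr [conjc _ * _]mulrC mulJ /=; ring. Qed.

Lemma sip_CS x y : md (b x y) ^+ 2 <= sq x * sq y.
Proof.
set c := b x y.
have h (t : R) : 0 <= sq x - 2 * t * md c ^+ 2 + t ^+ 2 * md c ^+ 2 * sq y.
  have := sip_ge0 bP (x - (t%:C * c) *: y).
  rewrite -/(sq _) sqB sqZ sipZr conjM conjc_real -/c mulrAC -mulrA mulJ.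
  by rewrite mdM md_real exprMn real_normK ?num_real// ReZ /= mulrA.
have m0 : 0 <= md c ^+ 2 by rewrite sqr_ge0.
have x0 : 0 <= sq x := sip_ge0 bP x.
have [y0|y0] := eqVneq (sq y) 0.
  rewrite y0 mulr0; rewrite leNgt; apply/negP => mc.
  have := h ((sq x + 1) / md c ^+ 2); rewrite y0 mulr0 addr0.
  by rewrite -mulrA divfK ?gt_eqF//; lra.
have {y0}y0 : 0 < sq y by rewrite lt_neqAle eq_sym y0 sip_ge0.
have := h (sq y)^-1.
have -> : sq x - 2 * (sq y)^-1 * md c ^+ 2 + (sq y)^-1 ^+ 2 * md c ^+ 2 * sq y
  = sq x - md c ^+ 2 / sq y by field; rewrite gt_eqF.
by rewrite subr_ge0 ler_pdivrMr.
Qed.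

Lemma sip_CS_sqrt x y : md (b x y) <= Num.sqrt (sq x) * Num.sqrt (sq y).
Proof.
rewrite -sqrtrM ?sip_ge0// -[leLHS](ger0_norm (md_ge0 _)) -sqrtr_sqr.
by rewrite ler_wsqrtr// sip_CS.
Qed.

(** Bessel's inequality. Vectors of norm less than one are admitted so that it
    applies to the normalized values of an operator, some of which vanish. *)
Lemma bessel (I : eqType) (s : seq I) (e : I -> L) x : uniq s ->
  (forall k l, k \in s -> l \in s -> k != l -> b (e k) (e l) = 0) ->
  (forall k, k \in s -> sq (e k) <= 1) ->
  \sum_(k <- s) md (b x (e k)) ^+ 2 <= sq x.
Proof.
elim: s x => [|k s IH] x; first by rewrite big_nil => _ _ _; exact: sip_ge0.
move=> /= /andP[ks us] ort nrm; rewrite big_cons.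
have ek : sq (e k) <= 1 by apply: nrm; rewrite mem_head.
have := IH (x - b x (e k) *: e k) us.
have sub i : i \in s -> i \in k :: s by rewrite inE orbC => ->.
move=> /(_ _ _) h.
have {}h := h (fun i j si sj => ort i j (sub i si) (sub j sj)) (fun i si => nrm i (sub i si)).
rewrite sip_proj in h.
have m0 : 0 <= md (b x (e k)) ^+ 2 by rewrite sqr_ge0.
rewrite addrC -lerBrDr; apply: le_trans (le_trans h _).
  rewrite le_eqVlt; apply/orP; left; apply/eqP.
  rewrite big_seq [RHS]big_seq; apply: eq_bigr => i si.
  rewrite sipBl sipZl ort ?mem_head ?sub// ?mulr0 ?subr0//.
  by apply: contraNneq ks => ->.
by rewrite lerD2l lerN2 ler_peMr//; lra.
Qed.

End SemiInnerProduct.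

(** * Bounded operators on the Hilbert space *)

Section HilbertSpace.
Context {R : realType} {H : completeNormedModType R[i]}.
Implicit Types (x y z u v : H) (a : R[i]) (e M : R) (s t : seq H).

(** The norm of [H] takes values in the complex numbers; this is its value in [R]. *)
Definition nm x : R := complex.Re `|x|.

Lemma norm_nm x : `|x| = (nm x)%:C.
Proof. by rewrite /nm RRe_real// normr_real. Qed.
Lemma nm_ge0 x : 0 <= nm x.
Proof. by rewrite -ler0c -norm_nm. Qed.
Lemma nmD x y : nm (x + y) <= nm x + nm y.
Proof. by rewrite -lecR rmorphD /= -!norm_nm ler_normD. Qed.
Lemma nmZ a x : nm (a *: x) = md a * nm x.
Proof. by apply: complexI; rewrite rmorphM /= -!norm_nm -normE normrZ. Qed.
Lemma nm0 : nm (0 : H) = 0.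
Proof. by rewrite /nm normr0. Qed.
Lemma nmN x : nm (- x) = nm x.
Proof. by rewrite /nm normrN. Qed.
Lemma nmC x y : nm (x - y) = nm (y - x).
Proof. by rewrite /nm distrC. Qed.
Lemma nm0_eq0 x : nm x = 0 -> x = 0.
Proof. by move=> x0; apply/eqP; rewrite -normr_eq0 norm_nm x0. Qed.
Lemma nm_normalize x : nm x != 0 -> nm ((nm x)^-1%:C *: x) = 1.
Proof.
by move=> x0; rewrite nmZ md_real ger0_norm ?invr_ge0 ?nm_ge0// mulVf.
Qed.
Lemma nm_tri z x y : nm (x - y) <= nm (x - z) + nm (z - y).
Proof. by rewrite -{1}(subrK z x) -addrA nmD. Qed.
Lemma nm_sum (I : Type) (r : seq I) (F : I -> H) :
  nm (\sum_(i <- r) F i) <= \sum_(i <- r) nm (F i).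
Proof.
elim/big_rec2: _ => [|i y x _ h]; first by rewrite nm0.
by apply: le_trans (nmD _ _) _; rewrite lerD2l.
Qed.

Lemma op_boundE (A : H -> H) M : op_bound A M <-> forall x, nm (A x) <= M * nm x.
Proof.
by split=> h x; have := h x; rewrite !norm_nm -rmorphM /= lecR.
Qed.

(** Completeness is used along ultrafilters as well as along sequences. *)
Lemma complete_filter (T : Type) (F : set_system T) (FF : ProperFilter F) (u : T -> H) :
  (forall e, 0 < e -> exists2 A, F A & forall i j, A i -> A j -> nm (u i - u j) <= e) ->
  exists l, forall e, 0 < e -> F [set i | nm (u i - l) <= e].
Proof.
move=> h.
have cF : cauchy_ex (u @ F).
  move=> eps eps0.
  have re : (complex.Re eps)%:C = eps by rewrite RRe_real// gtr0_real.
  have e0 : 0 < complex.Re eps by rewrite -ltcR re.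
  have [A FA hA] := h _ (divr_gt0 e0 (ltr0n _ 2)).
  have [i Ai] := filter_ex FA.
  exists (u i); suff : F (u @^-1` ball (u i) eps) by [].
  apply: filterS FA => j Aj.
  have : nm (u i - u j) < complex.Re eps.
    by apply: le_lt_trans (hA _ _ Ai Aj) _; rewrite ltr_pdivrMr// ltr_pMr// ltr1n.
  by rewrite -ball_normE /ball_ /= -ltcR re -norm_nm.
have /cauchy_cvg : cauchy (u @ F) by apply: cauchy_exP.
set l := lim _ => ul; exists l => e e0.
have ee : 0 < e%:C :> R[i] by rewrite ltcR.
have hl : F [set i | `|l - u i| <= e%:C] :=
  pseudometric_normed_Zmodule.cvgr_dist_le _ _ ul _ ee.
by apply: filterS (hl _) => i /=; rewrite norm_nm lecR nmC.
Qed.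

Lemma complete_seq (u : nat -> H) :
  (forall e, 0 < e -> exists N, forall i j, (N <= i)%N -> (N <= j)%N -> nm (u i - u j) <= e) ->
  exists l, forall e, 0 < e -> exists N, forall i, (N <= i)%N -> nm (u i - l) <= e.
Proof.
move=> h; have [e e0|l hl] := @complete_filter nat \oo _ u.
  by have [N hN] := h e e0; exists [set i | (N <= i)%N] => //; apply: nbhs_infty_ge.
by exists l => e e0; have [N _ hN] := hl e e0; exists N => i /hN.
Qed.

Record bounded_op (A : H -> H) : Prop := BoundedOp {
  bop_lin : forall a x y, A (a *: x + y) = a *: A x + A y;
  bop_bd : exists2 M, 0 <= M & forall x, nm (A x) <= M * nm x }.

Section BoundedOperators.
Variables (A : H -> H) (AP : bounded_op A).
Lemma bopD x y : A (x + y) = A x + A y.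
Proof. by have := bop_lin AP 1 x y; rewrite !scale1r. Qed.
Lemma bop0 : A 0 = 0.
Proof.
have := bopD 0 0; rewrite addr0 => /eqP.
by rewrite -subr_eq0 opprD addNKr oppr_eq0 => /eqP.
Qed.
Lemma bopZ a x : A (a *: x) = a *: A x.
Proof. by have := bop_lin AP a x 0; rewrite bop0 !addr0. Qed.
Lemma bopN x : A (- x) = - A x.
Proof. by rewrite -scaleN1r bopZ scaleN1r. Qed.
Lemma bopB x y : A (x - y) = A x - A y.
Proof. by rewrite bopD bopN. Qed.
Lemma bop_sum (I : Type) (r : seq I) (F : I -> H) :
  A (\sum_(i <- r) F i) = \sum_(i <- r) A (F i).
Proof. by elim/big_rec2: _ => [|i ? ? _ <-]; rewrite ?bop0// bopD. Qed.
End BoundedOperators.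

Lemma bop_comp A B : bounded_op A -> bounded_op B -> bounded_op (A \o B).
Proof.
move=> [Al [MA MA0 Ab]] [Bl [MB MB0 Bb]]; split=> [a x y|] /=.
  by rewrite Bl Al.
exists (MA * MB) => [|x]; first exact: mulr_ge0.
by apply: le_trans (Ab _) _; rewrite -mulrA ler_wpM2l.
Qed.

Lemma bop_id : bounded_op id.
Proof. by split=> //; exists 1 => // x; rewrite mul1r. Qed.

Lemma bop_cst0 : bounded_op (fun=> 0).
Proof.
by split=> [a x y|]; [rewrite scaler0 addr0|exists 0 => // x; rewrite nm0 mul0r].
Qed.

Lemma bop_add A B : bounded_op A -> bounded_op B -> bounded_op (fun x => A x + B x).
Proof.
move=> [Al [MA MA0 Ab]] [Bl [MB MB0 Bb]]; split=> [a x y|].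
  by rewrite Al Bl scalerDr addrACA.
exists (MA + MB) => [|x]; first exact: addr_ge0.
by rewrite mulrDl (le_trans (nmD _ _))// lerD.
Qed.

Lemma bop_scale a A : bounded_op A -> bounded_op (fun x => a *: A x).
Proof.
move=> [Al [MA MA0 Ab]]; split=> [b x y|].
  by rewrite Al scalerDr !scalerA mulrC.
exists (md a * MA) => [|x]; first by rewrite mulr_ge0 ?md_ge0.
by rewrite nmZ -mulrA ler_wpM2l ?md_ge0.
Qed.

Lemma bop_sub A B : bounded_op A -> bounded_op B -> bounded_op (fun x => A x - B x).
Proof.
move=> Ab Bb; have := bop_add Ab (bop_scale (-1) Bb).
by under eq_fun do rewrite scaleN1r.
Qed.

Lemma bop_bigsum (I : Type) (r : seq I) (A : I -> H -> H) :
  (forall i, bounded_op (A i)) -> bounded_op (fun x => \sum_(i <- r) A i x).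
Proof.
move=> Ab; elim: r => [|i r IH].
  by under eq_fun do rewrite big_nil; exact: bop_cst0.
by under eq_fun do rewrite big_cons; exact: bop_add.
Qed.

Lemma continuous_bop (A : {linear H -> H}) : continuous A -> bounded_op A.
Proof.
move=> Ac; split=> [a x y|]; first by rewrite linearP.
have /linear_boundedP/pinfty_ex_gt0[r r0 hr] := @continuous_linear_bounded _ _ _ 0 A (Ac 0).
have re : (complex.Re r)%:C = r by rewrite RRe_real// gtr0_real.
exists (complex.Re r) => [|x]; first by rewrite -ler0c re ltW.
by rewrite -lecR rmorphM /= re -!norm_nm.
Qed.

End HilbertSpace.

(** * Orthogonal projection, the Riesz theorem and adjoints *)

Section HilbertGeometry.
Context {R : realType} {H : completeNormedModType R[i]}.
Variable ip : {dot H for @conjC R[i]}.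
Hypothesis ip_norm : forall x : H, ip x x = `|x| ^+ 2.
Implicit Types (x y z u v : H) (a : R[i]) (e M : R) (s t : seq H).

Lemma ip_sip : sip ip.
Proof.
split=> [a x y z|x y|x]; first by rewrite linearDl linearZl_LR.
  by rewrite hermC expr0 mul1r.
by rewrite ip_norm norm_nm -rmorphXn /= sqr_ge0.
Qed.
Local Notation ipP := ip_sip.

Lemma sq_nm x : sq ip x = nm x ^+ 2.
Proof. by rewrite /sq ip_norm norm_nm -rmorphXn. Qed.

Lemma ip_CS x y : md (ip x y) <= nm x * nm y.
Proof.
have := sip_CS_sqrt ipP x y.
by rewrite !sq_nm !sqrtr_sqr !ger0_norm ?nm_ge0.
Qed.

Lemma ip_eq0 x : (forall y, ip x y = 0) -> x = 0.
Proof.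
by move=> h; apply: nm0_eq0; apply/eqP; rewrite -sqrf_eq0 -sq_nm /sq h.
Qed.

Lemma ip_inj x y : (forall z, ip x z = ip y z) -> x = y.
Proof.
by move=> h; apply/eqP; rewrite -subr_eq0; apply/eqP/ip_eq0 => z; rewrite (sipBl ipP) h subrr.
Qed.

Lemma parallelogram x y :
  nm (x - y) ^+ 2 = 2 * nm x ^+ 2 + 2 * nm y ^+ 2 - nm (x + y) ^+ 2.
Proof.
rewrite -!sq_nm -[in sq _ (x + y)](opprK y) !(sqB ipP) (sipNr ipP) ReN.
by rewrite /sq (sipNr ipP) (sipNl ipP) opprK; ring.
Qed.

(** The hypothesis at [t = 1 / (q + 1)]. *)
Lemma quad_bound (c q d : R) : 0 <= q ->
  (forall t : R, 2 * t * c - t ^+ 2 * c * q <= d) -> 0 <= c -> c <= d * (q + 1).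
Proof.
move=> q0 h c0; have q1 : 0 < q + 1 by rewrite ltr_wpDl.
have := h (q + 1)^-1.
have -> : 2 * (q + 1)^-1 * c - (q + 1)^-1 ^+ 2 * c * q =
   c / (q + 1) + c * (q + 1)^-1 ^+ 2 by field; rewrite gt_eqF.
rewrite -ler_pdivrMr//; apply: le_trans.
by rewrite lerDl mulr_ge0 ?sqr_ge0.
Qed.

(** The parallelogram law makes a minimizing sequence for the distance from
    [x] to [S] converge; its limit [z] lies in the closure of [S], and first
    variation of the distance gives the orthogonality. *)
Lemma projection_theorem (S : H -> Prop) x : S 0 ->
  (forall a y z, S y -> S z -> S (a *: y + z)) ->
  exists z, (forall y, S y -> ip (x - z) y = 0) /\
            (forall e, 0 < e -> exists2 y, S y & nm (z - y) <= e).
Proof.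
move=> S0 SL.
pose D : set R := [set r | exists2 y, S y & r = nm (x - y) ^+ 2].
have D0 : nonempty D by exists (nm (x - 0) ^+ 2); exists 0.
have Dlb : has_lbound D by exists 0 => _ [y _ ->]; rewrite sqr_ge0.
pose dl := inf D.
have dlP y : S y -> dl <= nm (x - y) ^+ 2 by move=> Sy; apply: ge_inf => //; exists y.
have [y yP] : exists y : nat -> H, forall n, S (y n) /\ nm (x - y n) ^+ 2 <= dl + n.+1%:R^-1.
  suff hy : forall n, exists y, S y /\ nm (x - y) ^+ 2 <= dl + n.+1%:R^-1.
    by have [y yP] := choice hy; exists y.
  move=> n; have [||r [y Sy ->] h] := @inf_adherent _ D n.+1%:R^-1.
  - by rewrite invr_gt0 ltr0n.
  - by split.
  - by exists y; split => //; apply: ltW.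
have close m n : nm (y m - y n) ^+ 2 <= 2 * m.+1%:R^-1 + 2 * n.+1%:R^-1.
  have [Sm hm] := yP m; have [Sn hn] := yP n.
  have := parallelogram (x - y n) (x - y m).
  have -> : x - y n - (x - y m) = y m - y n by rewrite opprB addrC addrA subrK.
  have -> : x - y n + (x - y m) = 2 *: (x - (2^-1 *: y m + 2^-1 *: y n)).
    rewrite scalerBr scalerDr !scalerA divff ?pnatr_eq0// !scale1r.
    by rewrite scaler_nat mulr2n addrACA opprD [- y n - _]addrC.
  have SS : S (2^-1 *: y m + 2^-1 *: y n).
    by apply: (SL) => //; rewrite -[_ *: _]addr0; apply: (SL).
  have := dlP _ SS; rewrite nmZ exprMn.
  have -> : md (2 : R[i]) = 2 by apply: md_eq => //; rewrite -[2 in RHS]/(2%:R) rmorph_nat.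
  move=> h ->; move: hm hn h; set a := _^-1; set b := _^-1; set c := nm (x - (_ + _)) ^+ 2.
  by lra.
have [|z zP] := @complete_seq _ _ y.
  move=> e e0.
  have [N hN] := harmonic_le (divr_gt0 (exprn_gt0 2 e0) (ltr0n _ 4)).
  exists N => m n Nm Nn.
  rewrite -(@ler_pXn2r _ 2)// ?nnegrE ?nm_ge0 ?(ltW e0)//.
  apply: le_trans (close m n) _.
  have := hN m Nm; have := hN n Nn.
  by move: (m.+1%:R^-1 : R) (n.+1%:R^-1 : R) => b c; lra.
exists z; split; last first.
  move=> e e0; have [N hN] := zP e e0; exists (y N); first by have [] := yP N.
  by rewrite nmC hN.
move=> w Sw; apply: md_small_eq0 => e e0.
have W0 : 0 < nm w + 1 by rewrite ltr_wpDl ?nm_ge0.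
have [N hN] := zP (e / 2 / (nm w + 1)) (divr_gt0 (divr_gt0 e0 (ltr0n _ 2)) W0).
have W2 : 0 < nm w ^+ 2 + 1 by rewrite ltr_wpDl ?sqr_ge0.
have [m hm] := harmonic_le (divr_gt0 (exprn_gt0 2 (divr_gt0 e0 (ltr0n _ 2))) W2).
pose n := maxn N m.
have [Sn hn] := yP n.
have c2 : md (ip (x - y n) w) ^+ 2 <= n.+1%:R^-1 * (nm w ^+ 2 + 1).
  rewrite -sq_nm; apply: quad_bound; rewrite ?sqr_ge0//; first exact: sip_ge0 ipP w.
  move=> t; set c := ip (x - y n) w.
  have := dlP _ (SL (t%:C * c) w (y n) Sw Sn).
  have -> : x - ((t%:C * c) *: w + y n) = x - y n - (t%:C * c) *: w.
    by rewrite opprD addrA addrAC.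
  rewrite -sq_nm (sqB ipP) (sqZ ipP) (sipZr ipP) conjM conjc_real -/c mulrAC -mulrA mulJ.
  rewrite mdM md_real exprMn real_normK ?num_real// ReZ /= !sq_nm; move: hn.
  by move: (n.+1%:R^-1 : R) => b; lra.
rewrite -(subrK (y n) x) -addrA (sipDl ipP); apply: le_trans (mdD _ _) _.
rewrite [leRHS]splitr lerD//.
  rewrite -(@ler_pXn2r _ 2)// ?nnegrE ?md_ge0 ?divr_ge0 ?(ltW e0)//.
  by apply: le_trans c2 _; rewrite -ler_pdivlMr// hm// leq_maxr.
apply: le_trans (ip_CS _ _) _.
apply: le_trans (ler_wpM2r (nm_ge0 _) (hN n (leq_maxl _ _))) _.
by rewrite mulrAC ler_pdivrMr// ler_wpM2l ?divr_ge0 ?(ltW e0)// lerDl.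
Qed.

(** The representing vector is a multiple of the component of any [x0] outside
    the kernel of [f] that is orthogonal to this kernel. *)
Lemma riesz (f : H -> R[i]) M : (forall a x y, f (a *: x + y) = a * f x + f y) ->
  (forall x, md (f x) <= M * nm x) -> exists z, forall x, f x = ip x z.
Proof.
move=> fl fb.
have f0 : f 0 = 0.
  have := fl 1 0 0; rewrite scale1r addr0 mul1r => /eqP.
  by rewrite -subr_eq0 opprD addNKr oppr_eq0 => /eqP.
have fZ a x : f (a *: x) = a * f x by have := fl a x 0; rewrite addr0 f0 addr0.
have fB x y : f (x - y) = f x - f y.
  by rewrite -scaleN1r addrC fl mulN1r addrC.
have [fz|/existsNP[x0 fx0]] := pselect (forall x, f x = 0).
  by exists 0 => x; rewrite fz (sip0r ipP).
have [|z [zo zc]] := @projection_theorem (fun y => f y = 0) x0 f0.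
  by move=> a y z fy fz; rewrite fl fy fz mulr0 addr0.
have fz : f z = 0.
  apply: md_small_eq0 => e e0.
  have M1 : 0 < `|M| + 1 by rewrite ltr_wpDl.
  have [y fy zy] := zc _ (divr_gt0 e0 M1).
  rewrite -[f z]subr0 -fy -fB; apply: le_trans (fb _) _.
  apply: (@le_trans _ _ ((`|M| + 1) * nm (z - y))).
    by rewrite ler_wpM2r ?nm_ge0// (le_trans (ler_norm M))// lerDl.
  by rewrite mulrC -ler_pdivlMr.
pose w := x0 - z.
have fw : f w = f x0 by rewrite fB fz subr0.
have w0 : ip w w != 0.
  apply/eqP => ww; apply: fx0; rewrite -fw.
  have : w = 0 by apply: nm0_eq0; apply/eqP; rewrite -sqrf_eq0 -sq_nm /sq ww.
  by move=> ->.
exists (conjc (f w / ip w w) *: w) => x.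
rewrite (sipZr ipP) conjcK.
have : ip w (x - (f x / f w) *: w) = 0.
  by apply: zo; rewrite fB fZ divfK ?subrr// fw; apply/eqP.
rewrite (sip_sym ipP) => /(congr1 conjc); rewrite conjcK conjc0 (sipBl ipP) (sipZl ipP).
move=> /eqP; rewrite subr_eq0 => /eqP ->.
have fw0 : f w != 0 by rewrite fw; apply/eqP.
by field; rewrite fw0 w0.
Qed.

Lemma adjoint_spec A : bounded_op A ->
  bounded_op (adjoint ip A) /\ forall x y, ip (A x) y = ip x (adjoint ip A y).
Proof.
move=> AP; have [_ [M M0 AM]] := AP.
have adj : forall x y, ip (A x) y = ip x (adjoint ip A y).
  rewrite /adjoint; case: xgetP => [B _ //|nB].
  have /choice[B hB] : forall y, exists z, forall x, ip (A x) y = ip x z.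
    move=> y; apply: (@riesz (fun x => ip (A x) y) (M * nm y)) => [a x z|x].
      by rewrite (bop_lin AP) (sip_lin ipP).
    apply: le_trans (ip_CS _ _) _; rewrite mulrAC ler_wpM2r ?nm_ge0//.
  by case: (nB B) => x y; rewrite hB.
split=> //; split=> [a x y|].
  apply: ip_inj => z; rewrite (sip_sym ipP) -adj (sipDr ipP) (sipZr ipP) !adj.
  by rewrite conjD conjM conjcK -!(sip_sym ipP) (sip_lin ipP).
exists M => // y; have [->|y0] := eqVneq (nm (adjoint ip A y)) 0.
  by rewrite mulr_ge0 ?nm_ge0.
have {}y0 : 0 < nm (adjoint ip A y) by rewrite lt_neqAle eq_sym y0 nm_ge0.
rewrite -(ler_pM2l y0) -expr2 -sq_nm /sq -adj.
apply: le_trans (Re_md _) _; apply: le_trans (ip_CS _ _) _.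
by rewrite mulrA [_ * M]mulrC ler_wpM2r ?nm_ge0.
Qed.

Lemma adjoint_bop A : bounded_op A -> bounded_op (adjoint ip A).
Proof. by case/adjoint_spec. Qed.
Lemma adjointE A x y : bounded_op A -> ip (A x) y = ip x (adjoint ip A y).
Proof. by case/adjoint_spec. Qed.
Lemma adjointEr A x y : bounded_op A -> ip x (A y) = ip (adjoint ip A x) y.
Proof. by move=> AP; rewrite (sip_sym ipP) adjointE// -(sip_sym ipP). Qed.

End HilbertGeometry.

(** * Orthonormal bases *)

Section EsumSeq.
Context {R : realType} {T : choiceType}.
Implicit Types (I : set T) (a : T -> R) (s t : seq T).

Lemma esum_le_seq I a (M : \bar R) :
  (forall s, uniq s -> (forall i, i \in s -> I i) -> ((\sum_(i <- s) a i)%:E <= M)%E) ->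
  (\esum_(i in I) (a i)%:E <= M)%E.
Proof.
move=> h; apply: ge_ereal_sup => _ [F [Ff FI] <-].
rewrite fsbig_finite//= sumEFin; apply: h; first exact: finmap.fset_uniq.
by move=> i; rewrite in_fset_set// inE => /FI.
Qed.

Lemma esum_ge_seq I a s : uniq s -> (forall i, i \in s -> I i) ->
  ((\sum_(i <- s) a i)%:E <= \esum_(i in I) (a i)%:E)%E.
Proof.
move=> us sI; apply: ereal_sup_ubound; exists [set` s].
  by split=> // i /= /sI.
by rewrite -fsbig_seq// sumEFin.
Qed.

Lemma ler_sum_subset a s t : uniq s -> uniq t -> {subset s <= t} ->
  (forall i, 0 <= a i) -> \sum_(i <- s) a i <= \sum_(i <- t) a i.
Proof.
move=> us ut st a0; rewrite [leRHS](bigID (mem s)) /=.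
rewrite -[X in X + _]big_filter.
have -> : \sum_(i <- [seq i <- t | i \in s]) a i = \sum_(i <- s) a i.
  apply/perm_big/uniq_perm; rewrite ?filter_uniq// => i.
  by rewrite mem_filter; case si: (i \in s) => //=; rewrite st.
by rewrite lerDl sumr_ge0.
Qed.

End EsumSeq.

Section OrthonormalSets.
Context {R : realType} {H : completeNormedModType R[i]}.
Variable ip : {dot H for @conjC R[i]}.
Hypothesis ip_norm : forall x : H, ip x x = `|x| ^+ 2.
Implicit Types (x y z u v : H) (a : R[i]) (e M : R) (s t : seq H) (E : set H).
Local Notation ipP := (ip_sip ip_norm).

Definition orthonormal_set E := forall u v, E u -> E v -> ip u v = (u == v)%:R.
Definition orthonormal s := uniq s /\ orthonormal_set [set` s].
Definition prj s x : H := \sum_(u <- s) ip x u *: u.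

Lemma onset_nm E u : orthonormal_set E -> E u -> nm u = 1.
Proof.
move=> EE Eu; apply/eqP; rewrite -(@eqrXn2 _ 2)// ?nm_ge0// expr1n -(sq_nm ip_norm).
by rewrite /sq (EE u u Eu Eu) (eqxx u).
Qed.

Lemma onset_ons E s : orthonormal_set E -> uniq s -> (forall u, u \in s -> E u) -> orthonormal s.
Proof. by move=> EE us sE; split=> // u v /sE ? /sE ?; apply: EE. Qed.

Lemma ip_prj s x u : orthonormal s -> u \in s -> ip (prj s x) u = ip x u.
Proof.
move=> [us so] su; rewrite /prj (sip_suml ipP) (bigD1_seq u)//= (sipZl ipP).
rewrite (so u u)//= eqxx mulr1 big_seq_cond big1 ?addr0// => v /andP[sv vu].
by rewrite (sipZl ipP) (so v u)//= (negbTE vu) mulr0.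
Qed.

Lemma prj_lin s a x y : prj s (a *: x + y) = a *: prj s x + prj s y.
Proof.
rewrite /prj scaler_sumr -big_split /=; apply: eq_bigr => u _.
by rewrite (sip_lin ipP) scalerDl scalerA.
Qed.

Lemma prjB s x y : prj s (x - y) = prj s x - prj s y.
Proof. by rewrite addrC -scaleN1r prj_lin scaleN1r addrC. Qed.

Lemma sq_prj_res s x : orthonormal s ->
  nm (x - prj s x) ^+ 2 = nm x ^+ 2 - \sum_(u <- s) md (ip x u) ^+ 2.
Proof.
move=> so; rewrite -!(sq_nm ip_norm) /sq (sipBl ipP) ReB.
have -> : ip (prj s x) (x - prj s x) = 0.
  rewrite {1}/prj (sip_suml ipP) big_seq big1// => u su.
  by rewrite (sipZl ipP) (sip_sym ipP (_ - _)) (sipBl ipP) ip_prj// subrr conjc0 mulr0.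
rewrite subr0 (sipBr ipP) ReB; congr (_ - _).
rewrite /prj (sip_sumr ipP) Re_sum; apply: eq_bigr => u _.
by rewrite (sipZr ipP) mulrC mulJ.
Qed.

Lemma nm_prj_res s x : orthonormal s -> nm (x - prj s x) <= nm x.
Proof.
move=> so; rewrite -(@ler_pXn2r _ 2)// ?nnegrE ?nm_ge0//.
by rewrite sq_prj_res// lerBlDr lerDl sumr_ge0// => u _; rewrite sqr_ge0.
Qed.

Lemma nm_prj_res_subset s t x : orthonormal s -> orthonormal t -> {subset s <= t} ->
  nm (x - prj t x) <= nm (x - prj s x).
Proof.
move=> so to st; rewrite -(@ler_pXn2r _ 2)// ?nnegrE ?nm_ge0//.
rewrite !sq_prj_res// lerD2l lerN2; apply: ler_sum_subset => //.
- by case: so.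
- by case: to.
- by move=> u; rewrite sqr_ge0.
Qed.

Lemma bessel_ons s x : orthonormal s -> \sum_(u <- s) md (ip x u) ^+ 2 <= nm x ^+ 2.
Proof. by move=> so; rewrite -subr_ge0 -sq_prj_res// sqr_ge0. Qed.

Lemma prj_bop A s x : bounded_op A -> A (prj s x) = \sum_(u <- s) ip x u *: A u.
Proof. by move=> AP; rewrite (bop_sum AP); apply: eq_bigr => u _; rewrite (bopZ AP). Qed.

Definition approx E s x e :=
  [/\ orthonormal s, (forall u, u \in s -> E u) & nm (x - prj s x) <= e].

Lemma ons_union E s t : orthonormal_set E -> (forall u, u \in s -> E u) ->
  (forall u, u \in t -> E u) ->
  orthonormal (undup (s ++ t)) /\ (forall u, u \in undup (s ++ t) -> E u).
Proof.
move=> EE sE tE.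
have h u : u \in undup (s ++ t) -> E u.
  by rewrite mem_undup mem_cat => /orP[/sE|/tE].
by split=> //; apply: (onset_ons EE) => //; apply: undup_uniq.
Qed.

(** A maximal orthonormal set is total: the vectors approximated by their
    finite expansions form a closed subspace containing [E]. *)
Lemma onb_approx1 E x e : is_onb ip E -> 0 < e -> exists s, approx E s x e.
Proof.
move=> [EE Emax] e0.
pose S y := forall e, 0 < e -> exists s, approx E s y e.
have SL a y z : S y -> S z -> S (a *: y + z).
  move=> Sy Sz r r0.
  have a1 : 0 < md a + 1 by rewrite ltr_wpDl ?md_ge0.
  have [s [so sE sy]] := Sy _ (divr_gt0 (divr_gt0 r0 (ltr0n _ 2)) a1).
  have [t [to tE tz]] := Sz _ (divr_gt0 r0 (ltr0n _ 2)).
  have [wo wE] := ons_union EE sE tE.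
  exists (undup (s ++ t)); split=> //.
  rewrite prj_lin opprD addrACA -scalerBr; apply: le_trans (nmD _ _) _.
  rewrite [leRHS]splitr lerD//.
    rewrite nmZ; apply: (@le_trans _ _ (md a * (r / 2 / (md a + 1)))).
      rewrite ler_wpM2l ?md_ge0//; apply: le_trans sy; apply: nm_prj_res_subset => //.
      by move=> u su; rewrite mem_undup mem_cat su.
    by rewrite mulrC mulrAC ler_pdivrMr// ler_wpM2l ?divr_ge0 ?(ltW r0)// lerDl.
  apply: le_trans tz; apply: nm_prj_res_subset => //.
  by move=> u su; rewrite mem_undup mem_cat su orbT.
have S0 : S 0.
  move=> r r0; exists [::]; split=> //.
  by rewrite /prj big_nil subr0 nm0; exact: ltW.
have [z [zo zc]] := projection_theorem ip_norm x S0 SL.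
have xz : x = z.
  apply/eqP; rewrite -subr_eq0; apply/eqP/Emax => u Eu; apply: zo => r r0.
  exists [:: u]; split.
  - by split=> // v w /=; rewrite !inE => /eqP -> /eqP ->; apply: EE.
  - by move=> v; rewrite inE => /eqP ->.
  - by rewrite /prj big_seq1 (EE u u)// eqxx scale1r subrr nm0; exact: ltW.
rewrite xz; have e2 : 0 < e / 2 by rewrite divr_gt0.
have [y Sy zy] := zc _ e2; have [s [so sE sy]] := Sy _ e2.
exists s; split=> //.
have -> : z - prj s z = (z - y) - prj s (z - y) + (y - prj s y).
  by rewrite prjB opprB addrACA subrK [X in _ = _ + X]addrAC subrr add0r.
apply: le_trans (nmD _ _) _; rewrite [leRHS]splitr lerD//.
by apply: le_trans zy; apply: nm_prj_res.
Qed.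

Lemma onb_approx E (xs : seq H) e : is_onb ip E -> 0 < e ->
  exists s, [/\ orthonormal s, (forall u, u \in s -> E u) &
    forall x, x \in xs -> nm (x - prj s x) <= e].
Proof.
move=> EP e0; elim: xs => [|x xs [s [so sE sx]]].
  by exists [::]; split.
have [t [to tE tx]] := onb_approx1 x EP e0.
have [wo wE] := ons_union EP.1 sE tE.
exists (undup (s ++ t)); split=> // y; rewrite inE => /predU1P[->|yxs].
  apply: le_trans tx; apply: nm_prj_res_subset => // u su.
  by rewrite mem_undup mem_cat su orbT.
apply: le_trans (sx _ yxs); apply: nm_prj_res_subset => // u su.
by rewrite mem_undup mem_cat su.
Qed.

(** Bessel's inequality bounds the sum from above; totality of [E] supplies
    finite expansions whose square norm is as close to [nm x ^+ 2] as desired. *)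
Lemma parseval E x : is_onb ip E ->
  (\esum_(u in E) (md (ip x u) ^+ 2)%:E = (nm x ^+ 2)%:E)%E.
Proof.
move=> EP; apply/eqP; rewrite eq_le; apply/andP; split.
  apply: esum_le_seq => s us sE; rewrite lee_fin bessel_ons//.
  exact: onset_ons EP.1 us sE.
apply/lee_addgt0Pr => e e0.
have se0 : 0 < Num.sqrt e by rewrite sqrtr_gt0.
have [s [so sE sx]] := onb_approx1 x EP se0.
apply: (@le_trans _ _ ((\sum_(u <- s) md (ip x u) ^+ 2)%:E + e%:E)%E); last first.
  by rewrite leeD2r// esum_ge_seq//; case: so.
rewrite -EFinD lee_fin -lerBlDl -sq_prj_res//.
by rewrite -[leRHS](sqr_sqrtr (ltW e0)) ler_pXn2r ?nnegrE ?nm_ge0 ?sqrtr_ge0.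
Qed.

Lemma nm_closure x (K : R) : 0 <= K ->
  (forall e, 0 < e -> nm x <= K * e) -> x = 0.
Proof.
move=> K0 h; apply: nm0_eq0; apply/eqP; rewrite eq_le nm_ge0 andbT.
apply/ler_addgt0Pl => e e0; rewrite addr0.
have K1 : 0 < K + 1 by rewrite ltr_wpDl.
apply: le_trans (h _ (divr_gt0 e0 K1)) _.
by rewrite mulrCA ler_piMr ?(ltW e0)// ler_pdivrMr// mul1r lerDl.
Qed.

Lemma bop_ext E A B : is_onb ip E -> bounded_op A -> bounded_op B ->
  (forall u, E u -> A u = B u) -> forall x, A x = B x.
Proof.
move=> EP AP BP AB x; apply/eqP; rewrite -subr_eq0; apply/eqP.
have DP := bop_sub AP BP; have [M M0 DM] := bop_bd DP.
apply: (nm_closure M0) => e e0.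
have [s [so sE sx]] := onb_approx1 x EP e0.
have -> : A x - B x = A (x - prj s x) - B (x - prj s x).
  have W : \sum_(u <- s) ip x u *: A u = \sum_(u <- s) ip x u *: B u.
    by rewrite big_seq [RHS]big_seq; apply: eq_bigr => u su; rewrite (AB u (sE u su)).
  by rewrite (bopB AP) (bopB BP) !prj_bop// W opprB addrA subrK.
by apply: le_trans (DM _) _; rewrite ler_wpM2l.
Qed.

(** Zorn's lemma. With all vectors allowed it yields an orthonormal basis, with
    the eigenvectors of an operator it yields the spectral theorem. *)
Lemma maximal_onset (Q : set H) : exists E, [/\ orthonormal_set E, E `<=` Q &
  forall x, Q x -> nm x = 1 -> (forall u, E u -> ip x u = 0) -> False].
Proof.
pose P (E : set H) := orthonormal_set E /\ E `<=` Q.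
have [|E [[EE EQ] Emax]] := @Zorn_bigcup H P.
  move=> F FP tot; split; last by move=> u [A FA Au]; exact: (FP A FA).2.
  move=> u v [A FA Au] [B FB Bv].
  by case: (tot A B FA FB) => AB; [apply: (FP B FB).1|apply: (FP A FA).1] => //; apply: AB.
exists E; split=> // x Qx nx xE.
apply: (Emax (E `|` [set x])).
  split=> [u Eu|sub]; first by left.
  have Ex : E x by apply: sub; right.
  have := xE x Ex; rewrite (sipxx ipP) (sq_nm ip_norm) nx expr1n => /eqP.
  by rewrite oner_eq0.
split; last by move=> u [/EQ|->].
have xx : ip x x = 1 by rewrite (sipxx ipP) (sq_nm ip_norm) nx expr1n.
have ne u : E u -> (u == x) = false.
  move=> Eu; apply/negbTE/eqP => ux; have := xE u Eu.
  by rewrite ux xx => /eqP; rewrite oner_eq0.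
move=> u v [Eu|->] [Ev|->]; first exact: EE.
- by rewrite ne// (sip_sym ipP) xE// conjc0.
- by rewrite eq_sym ne// xE.
- by rewrite eqxx xx.
Qed.

Lemma onb_is_onb : is_onb ip (onb ip).
Proof.
have [E [EE _ Emax]] := maximal_onset setT.
have EP : is_onb ip E.
  split=> // x xE; apply: nm0_eq0; apply/eqP/negPn/negP => x0.
  apply: (Emax ((nm x)^-1%:C *: x)) => //; first exact: nm_normalize.
  by move=> u Eu; rewrite (sipZl ipP) xE ?mulr0.
by rewrite /onb; case: xgetP => [F -> //|/(_ E)].
Qed.

End OrthonormalSets.

(** * Diagonal and compact operators *)

Section DiagonalOperators.
Context {R : realType} {H : completeNormedModType R[i]}.
Variable ip : {dot H for @conjC R[i]}.
Hypothesis ip_norm : forall x : H, ip x x = `|x| ^+ 2.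
Implicit Types (x y z u v : H) (a : R[i]) (e M : R) (s t : seq H) (E : set H).
Implicit Types (A B K : H -> H) (g h : H -> R).
Local Notation ipP := (ip_sip ip_norm).

Definition diag E g B := forall u, E u -> B u = (g u)%:C *: u.

Lemma bop_rank1 A v w : bounded_op A -> bounded_op (fun x => ip (A x) v *: w).
Proof.
move=> AP; have [M M0 AM] := bop_bd AP; split=> [a x y|].
  by rewrite (bop_lin AP) (sip_lin ipP) scalerDl scalerA.
exists (M * nm v * nm w) => [|x]; first by rewrite !mulr_ge0 ?nm_ge0.
rewrite nmZ -mulrA [nm w * _]mulrC mulrA ler_wpM2r ?nm_ge0//.
apply: le_trans (ip_CS ip_norm _ _) _; rewrite mulrAC ler_wpM2r ?nm_ge0//.
Qed.

(** Both sides are coefficients of bounded operators that agree on [E]. *)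
Lemma diag_coef E g B x u : is_onb ip E -> bounded_op B -> diag E g B -> E u ->
  ip (B x) u = (g u)%:C * ip x u.
Proof.
move=> EP BP Bd Eu.
have uu : ip u u = 1 by rewrite (EP.1 u u)// eqxx.
have : ip (B x) u *: u = ((g u)%:C * ip x u) *: u.
  have b1 := bop_rank1 u u BP.
  have b2 := bop_scale (g u)%:C (bop_rank1 u u bop_id).
  rewrite -scalerA; apply: (bop_ext ip_norm EP b1 b2) => v Ev.
  rewrite (Bd v Ev) (sipZl ipP) (EP.1 v u)// scalerA.
  by have [->|_] := eqVneq v u; rewrite ?mulr0.
move=> /(congr1 (fun z => ip z u)).
by rewrite !(sipZl ipP) uu !mulr1.
Qed.

Lemma diag_bound E g B e : is_onb ip E -> bounded_op B -> diag E g B -> 0 <= e ->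
  (forall u, E u -> `|g u| <= e) -> forall x, nm (B x) <= e * nm x.
Proof.
move=> EP BP Bd e0 ge x.
rewrite -(@ler_pXn2r _ 2)// ?nnegrE ?mulr_ge0 ?nm_ge0// -lee_fin.
rewrite -(parseval ip_norm (B x) EP); apply: esum_le_seq => s us sE.
rewrite lee_fin exprMn.
apply: le_trans (ler_wpM2l (sqr_ge0 e) (bessel_ons ip_norm x (onset_ons EP.1 us sE))).
rewrite mulr_sumr; apply: ler_sum_seq => u su.
rewrite (diag_coef x EP BP Bd (sE u su)) mdM exprMn ler_wpM2r ?sqr_ge0//.
by rewrite md_real ler_pXn2r ?nnegrE// (ge u (sE u su)).
Qed.

(** The sum is exactly the inner product of [B x] with the finite expansion of [x]. *)
Lemma diag_quad E g B s x : is_onb ip E -> bounded_op B -> diag E g B ->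
  (forall u, u \in s -> E u) ->
  `|complex.Re (ip (B x) x) - \sum_(u <- s) g u * md (ip x u) ^+ 2|
     <= nm (B x) * nm (x - prj ip s x).
Proof.
move=> EP BP Bd sE.
have -> : \sum_(u <- s) g u * md (ip x u) ^+ 2 = complex.Re (ip (B x) (prj ip s x)).
  rewrite /prj (sip_sumr ipP) Re_sum big_seq [RHS]big_seq; apply: eq_bigr => u su.
  rewrite (sipZr ipP) (diag_coef x EP BP Bd (sE u su)) [in RHS]mulrCA [conjc _ * _]mulrC mulJ.
  by rewrite ReZ.
rewrite -ReB -(sipBr ipP); apply: le_trans (ip_CS ip_norm _ _).
rewrite ler_norml Re_md andbT lerNl -ReN; apply: le_trans (Re_md _) _.
by rewrite mdN.
Qed.

Lemma diag_pos E g B x : is_onb ip E -> bounded_op B -> diag E g B ->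
  (forall u, E u -> 0 <= g u) -> 0 <= complex.Re (ip (B x) x).
Proof.
move=> EP BP Bd g0; apply/ler_addgt0Pl => e e0.
have B1 : 0 < nm (B x) + 1 by rewrite ltr_wpDl ?nm_ge0.
have [s [so sE sx]] := onb_approx1 ip_norm x EP (divr_gt0 e0 B1).
have := diag_quad x EP BP Bd sE; rewrite ler_norml => /andP[h _].
have S0 : 0 <= \sum_(u <- s) g u * md (ip x u) ^+ 2.
  by apply: sumr_ge0_seq => u su; rewrite mulr_ge0 ?sqr_ge0// g0//; apply: sE.
have : nm (B x) * nm (x - prj ip s x) <= e.
  apply: le_trans (ler_wpM2l (nm_ge0 _) sx) _.
  by rewrite mulrCA ler_piMr ?(ltW e0)// ler_pdivrMr// mul1r lerDl.
lra.
Qed.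

Lemma diag_selfadj E g B x y : is_onb ip E -> bounded_op B -> diag E g B ->
  ip (B x) y = ip x (B y).
Proof.
move=> EP BP Bd; rewrite (adjointEr ip_norm x y BP); congr (ip _ _).
apply: (bop_ext ip_norm EP BP (adjoint_bop ip_norm BP)) => u Eu.
rewrite (Bd u Eu); apply: (ip_inj ip_norm) => z.
rewrite -(adjointEr ip_norm _ _ BP) [RHS](sip_sym ipP) (diag_coef z EP BP Bd Eu).
by rewrite conjM conjc_real (sipZl ipP) -(sip_sym ipP).
Qed.

End DiagonalOperators.

Section CompactOperators.
Context {R : realType} {H : completeNormedModType R[i]}.
Variable ip : {dot H for @conjC R[i]}.
Hypothesis ip_norm : forall x : H, ip x x = `|x| ^+ 2.
Implicit Types (x y z u v : H) (a : R[i]) (e M : R) (s t : seq H) (E : set H).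
Implicit Types (A B K : H -> H).
Local Notation ipP := (ip_sip ip_norm).

(** Compactness as smallness off finitely many directions. In this form it is
    visibly stable under sums and under products with bounded operators on
    either side. *)
Definition compact_op A := forall e, 0 < e -> exists s, forall x,
  nm (A x) <= e * nm x + \sum_(u <- s) md (ip x u).

Lemma cpt_compl A B : bounded_op B -> compact_op A -> compact_op (B \o A).
Proof.
move=> /bop_bd[M M0 BM] Ac e e0.
have M1 : 0 < M + 1 by rewrite ltr_wpDl.
have [s sP] := Ac _ (divr_gt0 e0 M1).
exists [seq M%:C *: u | u <- s] => x /=.
rewrite big_map; apply: le_trans (BM _) _.
apply: le_trans (ler_wpM2l M0 (sP x)) _; rewrite mulrDr lerD//.
  rewrite mulrA ler_wpM2r ?nm_ge0// mulrCA ler_piMr ?(ltW e0)//.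
  by rewrite ler_pdivrMr// mul1r lerDl.
rewrite mulr_sumr; apply: ler_sum => u _.
by rewrite (sipZr ipP) mdM conjc_real md_real ger0_norm.
Qed.

Lemma cpt_scale a A : compact_op A -> compact_op (fun x => a *: A x).
Proof. exact: (cpt_compl (bop_scale a bop_id)). Qed.

Lemma cpt_compr A B : compact_op A -> bounded_op B -> compact_op (A \o B).
Proof.
move=> Ac BP e e0; have [M M0 BM] := bop_bd BP.
have M1 : 0 < M + 1 by rewrite ltr_wpDl.
have [s sP] := Ac _ (divr_gt0 e0 M1).
exists [seq adjoint ip B u | u <- s] => x /=.
rewrite big_map; apply: le_trans (sP _) _; rewrite lerD//.
  apply: le_trans (ler_wpM2l _ (BM x)) _; first by rewrite divr_ge0 ?ltW.
  rewrite mulrA ler_wpM2r ?nm_ge0// mulrAC ler_pdivrMr// ler_wpM2l ?(ltW e0)//.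
  by rewrite lerDl.
by apply: ler_sum => u _; rewrite (adjointE ip_norm _ _ BP).
Qed.

Lemma cpt_add A B : compact_op A -> compact_op B -> compact_op (fun x => A x + B x).
Proof.
move=> Ac Bc e e0; have e2 : 0 < e / 2 by rewrite divr_gt0.
have [s sP] := Ac _ e2; have [t tP] := Bc _ e2.
exists (s ++ t) => x; rewrite big_cat /=; apply: le_trans (nmD _ _) _.
by apply: le_trans (lerD (sP x) (tP x)) _; rewrite addrACA -mulrDl -splitr.
Qed.

Lemma cpt0 : compact_op (fun=> 0).
Proof.
by move=> e e0; exists [::] => x; rewrite nm0 big_nil addr0 mulr_ge0 ?nm_ge0 ?ltW.
Qed.

Lemma cpt_bigsum (I : Type) (r : seq I) (A : I -> H -> H) :
  (forall i, compact_op (A i)) -> compact_op (fun x => \sum_(i <- r) A i x).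
Proof.
move=> Ab; elim: r => [|i r IH].
  by under eq_fun do rewrite big_nil; exact: cpt0.
by under eq_fun do rewrite big_cons; exact: cpt_add.
Qed.

Definition positive_op A := (forall x y, ip (A x) y = ip x (A y)) /\
  (forall x, 0 <= complex.Re (ip (A x) x)).

Lemma positive_sip A : bounded_op A -> positive_op A -> sip (fun x y => ip (A x) y).
Proof.
move=> AP [As Ap]; split=> [a x y z|x y|] //.
  by rewrite (bop_lin AP) (sip_lin ipP).
by rewrite As (sip_sym ipP).
Qed.

(** A cluster point of [f] in the segment is a limit, because an ultrafilter
    contains each neighbourhood condition or its negation. *)
Lemma ultra_bounded (T : Type) (U : set_system T) (UF : UltraFilter U) (f : T -> R) M :
  (forall i, `|f i| <= M) -> forall e, 0 < e ->
  exists2 A, U A & forall i j, A i -> A j -> `|f i - f j| <= e.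
Proof.
move=> fM e e0.
have [|l [_ lcl]] := @segment_compact R (- M) M (f @ U) _.
  suff : U (f @^-1` `[- M, M]) by [].
  by apply: filterS filterT => i _ /=; rewrite in_itv /= -ler_norml; exact: fM.
have e2 : 0 < e / 2 by rewrite divr_gt0.
exists [set i | `|f i - l| <= e / 2].
  have [//|Uc] := in_ultra_setVsetC [set i | `|f i - l| <= e / 2] UF.
  have Uc' : (f @ U) [set y | ~ `|y - l| <= e / 2] by [].
  have [y [/= h1 h2]] := lcl _ _ Uc' (nbhsx_ballx l _ e2).
  by case: h1; move: h2; rewrite /ball /= distrC => /ltW.
move=> i j /= hi hj; rewrite [leRHS]splitr.
have -> : f i - f j = (f i - l) - (f j - l) by ring.
by rewrite (le_trans (ler_normB _ _))// lerD.
Qed.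

Lemma md_ReIm (z : R[i]) : md z <= `|complex.Re z| + `|complex.Im z|.
Proof.
rewrite -(@ler_pXn2r _ 2)// ?nnegrE ?md_ge0 ?addr_ge0//.
rewrite md_sqr -[complex.Re z ^+ 2]real_normK ?num_real//.
rewrite -[complex.Im z ^+ 2]real_normK ?num_real//.
have := normr_ge0 (complex.Re z); have := normr_ge0 (complex.Im z); nra.
Qed.

Lemma Re_le_md (z : R[i]) : `|complex.Re z| <= md z.
Proof. by rewrite ler_norml Re_md andbT lerNl -ReN -mdN Re_md. Qed.
Lemma Im_le_md (z : R[i]) : `|complex.Im z| <= md z.
Proof.
rewrite -(@ler_pXn2r _ 2)// ?nnegrE ?md_ge0// real_normK ?num_real//.
by rewrite md_sqr lerDr sqr_ge0.
Qed.

(** A compact operator turns a bounded family into one converging along any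
    ultrafilter: the finitely many coordinates that matter converge. *)
Lemma cpt_ultra A (T : Type) (U : set_system T) (UF : UltraFilter U) (x : T -> H) M :
  bounded_op A -> compact_op A -> (forall i, nm (x i) <= M) ->
  exists l, forall e, 0 < e -> U [set i | nm (A (x i) - l) <= e].
Proof.
move=> AP Ac xM; apply: complete_filter => e e0.
have [[i0 _]|noi] := pselect (exists i0 : T, True); last first.
  exists setT; first exact: filterT.
  by move=> i j _ _; case: noi; exists i.
have M0 : 0 <= M by apply: le_trans (xM i0); exact: nm_ge0.
have M1 : 0 < 2 * M + 1 by rewrite ltr_wpDl ?mulr_ge0.
have e2 : 0 < e / 2 by rewrite divr_gt0.
have [s sP] := Ac _ (divr_gt0 e2 M1).
have [B UB hB] : exists2 B, U B & forall i j, B i -> B j ->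
    \sum_(u <- s) md (ip (x i - x j) u) <= e / 2.
  elim: s (e / 2) e2 {sP} => [|u s IH] r r0.
    by exists setT => [|i j _ _]; [exact: filterT|rewrite big_nil ltW].
  have r4 : 0 < r / 2 / 2 by rewrite !divr_gt0.
  have xu i : md (ip (x i) u) <= M * nm u.
    by apply: le_trans (ip_CS ip_norm _ _) _; rewrite ler_wpM2r ?nm_ge0.
  have [B1 UB1 h1] := ultra_bounded UF (fun i => le_trans (Re_le_md _) (xu i)) r4.
  have [B2 UB2 h2] := ultra_bounded UF (fun i => le_trans (Im_le_md _) (xu i)) r4.
  have [B3 UB3 h3] := IH (r / 2) (divr_gt0 r0 (ltr0n _ 2)).
  exists (B1 `&` (B2 `&` B3)); first by apply: filterI => //; apply: filterI.
  move=> i j [i1 [i2 i3]] [j1 [j2 j3]].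
  rewrite big_cons [leRHS]splitr lerD ?h3// (sipBl ipP).
  apply: (le_trans (md_ReIm _)); rewrite [leRHS]splitr lerD//.
    by rewrite ReB h1.
  by rewrite raddfB /= h2.
exists B => // i j Bi Bj; rewrite -(bopB AP).
apply: le_trans (sP _) _; rewrite [leRHS]splitr lerD ?hB//.
apply: (@le_trans _ _ (e / 2 / (2 * M + 1) * (2 * M))).
  rewrite (ler_wpM2l (divr_ge0 (ltW e2) (ltW M1)))//.
  apply: le_trans (nmD _ _) _; rewrite nmN.
  have := xM i; have := xM j; lra.
by rewrite mulrAC ler_pdivrMr// ler_wpM2l ?(ltW e2)// lerDl.
Qed.

End CompactOperators.

(** * The spectral theorem for compact positive operators *)

Section SpectralTheorem.
Context {R : realType} {H : completeNormedModType R[i]}.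
Variable ip : {dot H for @conjC R[i]}.
Hypothesis ip_norm : forall x : H, ip x x = `|x| ^+ 2.
Implicit Types (x y z u v : H) (a : R[i]) (e M : R) (s t : seq H) (E : set H).
Implicit Types (A B K : H -> H).
Local Notation ipP := (ip_sip ip_norm).

(** A compact positive operator attains the supremum of its quadratic form on
    the unit sphere of any closed invariant subspace [S]: a maximizing sequence
    [x] satisfies [A x - m x -> 0], and compactness makes [A x] converge. *)
Lemma max_eigenvector A (S : H -> Prop) x0 : bounded_op A -> compact_op ip A -> positive_op ip A ->
  S x0 -> nm x0 = 1 -> (forall a x, S x -> S (a *: x)) -> (forall x, S x -> S (A x)) ->
  (forall x, (forall e, 0 < e -> exists2 y, S y & nm (x - y) <= e) -> S x) ->
  exists x, [/\ S x, nm x = 1 & exists l : R, A x = l%:C *: x].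
Proof.
move=> AP Ac Ap Sx0 nx0 SZ SA Scl.
pose q x := complex.Re (ip (A x) x).
pose D : set R := [set r | exists x, [/\ S x, nm x = 1 & r = q x]].
have [M M0 AM] := bop_bd AP.
have q0 x : 0 <= q x := Ap.2 x.
have qM x : q x <= M * nm x ^+ 2.
  apply: le_trans (Re_md _) _; apply: le_trans (ip_CS ip_norm _ _) _.
  by rewrite expr2 mulrA ler_wpM2r ?nm_ge0.
have D1 : has_sup D.
  split; first by exists (q x0), x0.
  by exists M => _ [x [_ nx ->]]; have := qM x; rewrite nx expr1n mulr1.
pose m := sup D.
have qm x : S x -> nm x = 1 -> q x <= m.
  by move=> Sx nx; apply: sup_upper_bound => //; exists x.
have m0 : 0 <= m by apply: le_trans (qm _ Sx0 nx0).
have qmS x : S x -> q x <= m * nm x ^+ 2.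
  move=> Sx; have [nx0'|nx] := eqVneq (nm x) 0.
    have := qM x; rewrite nx0' expr0n mulr0 => /le_trans; apply.
    by rewrite mulr0.
  have nx' : 0 < nm x by rewrite lt_neqAle eq_sym nx nm_ge0.
  have := qm _ (SZ ((nm x)^-1)%:C x Sx) (nm_normalize nx).
  rewrite /q (bopZ AP) (sipZl ipP) (sipZr ipP) conjc_real mulrA -rmorphM /= ReZ.
  by rewrite -expr2 mulrC exprVn ler_pdivrMr ?exprn_gt0// mulrC.
have Am x : S x -> nm (A x) ^+ 2 <= m * q x.
  move=> Sx.
  have := sip_CS (positive_sip ip_norm AP Ap) x (A x); rewrite /sq -/(q x) -/(q (A x)) => h.
  have nA : md (ip (A x) (A x)) = nm (A x) ^+ 2.
    by rewrite (sipxx ipP) (sq_nm ip_norm) md_real ger0_norm// sqr_ge0.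
  rewrite nA in h.
  have [->|nAx] := eqVneq (nm (A x)) 0; first by rewrite expr0n mulr_ge0.
  have nAx' : 0 < nm (A x) ^+ 2 by rewrite exprn_gt0// lt_neqAle eq_sym nAx nm_ge0.
  rewrite -(ler_pM2l nAx') -expr2; apply: le_trans h _.
  apply: le_trans (ler_wpM2l (q0 x) (qmS _ (SA x Sx))) _.
  by rewrite mulrA mulrC [q x * m]mulrC.
have Ares x : S x -> nm x = 1 -> nm (A x - m%:C *: x) ^+ 2 <= m * (m - q x).
  move=> Sx nx; rewrite -(sq_nm ip_norm) (sqB ipP) (sqZ ipP) !(sq_nm ip_norm) nx.
  rewrite expr1n mulr1 (sipZr ipP) conjc_real ReZ -/(q x) md_real real_normK ?num_real//.
  by have := Am x Sx; lra.
have [m00|mn0] := eqVneq m 0.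
  exists x0; split=> //; exists 0; rewrite scale0r; apply: nm0_eq0; apply/eqP.
  rewrite -sqrf_eq0 eq_le sqr_ge0 andbT.
  by have := Am _ Sx0; rewrite m00 mul0r.
have {mn0}mp : 0 < m by rewrite lt_neqAle eq_sym mn0.
have [x xP] : exists x : nat -> H, forall n, [/\ S (x n), nm (x n) = 1 & m - n.+1%:R^-1 <= q (x n)].
  suff hx : forall n : nat, exists x, [/\ S x, nm x = 1 & m - n.+1%:R^-1 <= q x].
    by have [x xP] := choice hx; exists x.
  move=> n; have [|_ [x [Sx nx ->]] h] := @sup_adherent _ D n.+1%:R^-1 _ D1.
    by rewrite invr_gt0 ltr0n.
  by exists x; split=> //; apply: ltW.
have [U [UU oU]] := @ultraFilterLemma nat \oo _.
have [|l hl] := cpt_ultra ip_norm UU (x := x) (M := 1) AP Ac.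
  by move=> n; have [_ -> _] := xP n.
have hres e : 0 < e -> U [set n | nm (A (x n) - m%:C *: x n) <= e].
  move=> e0; apply: oU.
  have [N hN] := harmonic_le (divr_gt0 (exprn_gt0 2 e0) mp).
  exists N => // n /= Nn; have [Sx nx qx] := xP n.
  rewrite -(@ler_pXn2r _ 2)// ?nnegrE ?nm_ge0 ?(ltW e0)//.
  apply: le_trans (Ares _ Sx nx) _.
  apply: (@le_trans _ _ (m * n.+1%:R^-1)).
    by rewrite ler_wpM2l//; move: qx; move: (n.+1%:R^-1 : R) => b; lra.
  by rewrite mulrC -ler_pdivlMr// hN.
pose z := (m^-1)%:C *: l.
have hz e : 0 < e -> U [set n | nm (x n - z) <= e].
  move=> e0; have e2 : 0 < m * e / 2 by rewrite !mulr_gt0 ?invr_gt0.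
  apply: filterS (filterI (hres _ e2) (hl _ e2)) => n /= [h1 h2].
  have mC : (m^-1)%:C * m%:C = 1 :> R[i] by rewrite -rmorphM /= mulVf ?gt_eqF.
  have -> : x n - z = (m^-1)%:C *: (m%:C *: x n - l).
    by rewrite scalerBr scalerA mC scale1r.
  rewrite nmZ md_real ger0_norm ?invr_ge0 ?(ltW mp)// mulrC ler_pdivrMr//.
  apply: le_trans (nm_tri (A (x n)) _ _) _.
  by rewrite [e * m]mulrC [leRHS]splitr; apply: lerD => //; rewrite nmC.
have Sz : S z.
  apply: Scl => e e0; have [n /= hn] := filter_ex (hz _ e0).
  by exists (x n); [have [] := xP n|rewrite nmC].
exists z; split=> //.
  apply/eqP; rewrite eq_le; apply/andP; split; apply/ler_addgt0Pl => e e0.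
    have [n /= hn] := filter_ex (hz _ e0); have [_ nx _] := xP n.
    have := nmD (z - x n) (x n); rewrite subrK nx nmC.
    by move/le_trans; apply; rewrite lerD2r.
  have [n /= hn] := filter_ex (hz _ e0); have [_ nx _] := xP n.
  by have := nmD (x n - z) z; rewrite subrK nx => /le_trans; apply; rewrite lerD2r.
exists m; apply/eqP; rewrite -subr_eq0; apply/eqP.
have K0 : 0 <= M + 1 + m by rewrite !addr_ge0.
apply: (nm_closure K0) => e e0.
have [n /= [h1 h2]] := filter_ex (filterI (hres _ e0) (hz _ e0)).
have -> : A z - m%:C *: z = A (z - x n) + (A (x n) - m%:C *: x n) + m%:C *: (x n - z).
  by rewrite (bopB AP) addrA subrK scalerBr addrA subrK.
apply: le_trans (nmD _ _) _; rewrite mulrDl lerD//; last first.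
  by rewrite nmZ md_real ger0_norm// ler_wpM2l.
apply: le_trans (nmD _ _) _; rewrite mulrDl mul1r lerD//.
by apply: le_trans (AM _) _; rewrite ler_wpM2l// nmC.
Qed.

(** A maximal orthonormal set of eigenvectors is total, since otherwise its
    orthogonal complement would contain a further eigenvector. *)
Lemma spectral_theorem A : bounded_op A -> compact_op ip A -> positive_op ip A ->
  exists E (g : H -> R), [/\ is_onb ip E, diag E g A & forall u, E u -> 0 <= g u].
Proof.
move=> AP Ac Ap.
have [E [EE EQ Emax]] := maximal_onset ip_norm [set u | exists l : R, A u = l%:C *: u].
pose g u := complex.Re (ip (A u) u).
have gd : diag E g A.
  move=> u Eu; have [l Al] := EQ _ Eu; rewrite Al; congr (_%:C *: _).
  by rewrite /g Al (sipZl ipP) (EE u u)// (eqxx u) mulr1.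
exists E, g; split=> //; last by move=> u _; apply: Ap.2.
split=> // x0 xE; apply: nm0_eq0; apply/eqP/negPn/negP => x00.
have [|||||x [Sx nx ex]] := @max_eigenvector A (fun x => forall u, E u -> ip x u = 0)
    ((nm x0)^-1%:C *: x0) AP Ac Ap.
- by move=> u Eu; rewrite (sipZl ipP) xE ?mulr0.
- exact: nm_normalize.
- by move=> a x Sx u Eu; rewrite (sipZl ipP) Sx ?mulr0.
- by move=> x Sx u Eu; rewrite Ap.1 gd// (sipZr ipP) Sx ?mulr0.
- move=> x hx u Eu; apply: md_small_eq0 => e e0; have [y Sy xy] := hx _ e0.
  rewrite -[x](subrK y) (sipDl ipP) Sy// addr0; apply: le_trans (ip_CS ip_norm _ _) _.
  by rewrite (onset_nm ip_norm EE Eu) mulr1.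
exact: Emax ex nx Sx.
Qed.

(** Each new vector is replaced by its normalized residual, unless that
    residual vanishes. *)
Lemma gram_schmidt s : exists t, orthonormal ip t /\ forall x, x \in s -> prj ip t x = x.
Proof.
elim: s => [|x s [t [to ts]]]; first by exists [::].
pose r := x - prj ip t x.
have [r0|rn] := eqVneq (nm r) 0.
  exists t; split=> // y; rewrite inE => /predU1P[->|]; last exact: ts.
  by have /eqP := nm0_eq0 r0; rewrite subr_eq0 => /eqP <-.
pose w := (nm r)^-1%:C *: r.
have nw : nm w = 1 by apply: nm_normalize.
have ww : ip w w = 1 by rewrite (sipxx ipP) (sq_nm ip_norm) nw expr1n.
have wt u : u \in t -> ip w u = 0.
  by move=> ut; rewrite (sipZl ipP) (sipBl ipP) (ip_prj ip_norm)// subrr mulr0.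
have wnt : w \notin t.
  by apply/negP => /wt; rewrite ww => /eqP; rewrite oner_eq0.
have [ut uo] := to.
have wto : orthonormal ip (w :: t).
  split; first by rewrite /= wnt.
  move=> u v /=; rewrite !inE => /predU1P[->|su] /predU1P[->|sv].
  - by rewrite (eqxx w).
  - by rewrite wt// (negbTE (memPnC wnt v sv)).
  - by rewrite (sip_sym ipP) wt// conjc0 (negbTE (memPn wnt u su)).
  - exact: uo.
have rw : r = (nm r)%:C *: w.
  by rewrite /w scalerA -rmorphM /= divff// scale1r.
exists (w :: t); split=> // y; rewrite inE => /predU1P[->|ys].
  rewrite /prj big_cons -/(prj ip t x).
  have -> : ip x w = (nm r)%:C.
    have -> : x = r + prj ip t x by rewrite subrK.
    rewrite (sipDl ipP) {1}rw (sipZl ipP) ww mulr1 /prj (sip_suml ipP) big_seq big1 ?addr0//.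
    by move=> u ut'; rewrite (sipZl ipP) (sip_sym ipP w u) wt// conjc0 mulr0.
  by rewrite -rw subrK.
rewrite /prj big_cons -/(prj ip t y) ts//.
have -> : ip y w = 0.
  rewrite -(ts y ys) /prj (sip_suml ipP) big_seq big1// => u ut'.
  by rewrite (sipZl ipP) (sip_sym ipP w u) wt// conjc0 mulr0.
by rewrite scale0r add0r.
Qed.

Lemma prj_selfadj s x y : ip (prj ip s x) y = ip x (prj ip s y).
Proof.
rewrite /prj (sip_suml ipP) (sip_sumr ipP); apply: eq_bigr => u _.
by rewrite (sipZl ipP) (sipZr ipP) (sip_sym ipP u y) conjcK mulrC.
Qed.

Lemma prj_idem s x : orthonormal ip s -> prj ip s (prj ip s x) = prj ip s x.
Proof.
move=> so; rewrite [in LHS]/prj big_seq [in RHS]/prj [RHS]big_seq.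
by apply: eq_bigr => u su; rewrite -/(prj ip s x) (ip_prj ip_norm).
Qed.

Lemma nm_prj s x : orthonormal ip s -> nm (prj ip s x) <= nm x.
Proof.
move=> so; have [->|n0] := eqVneq (nm (prj ip s x)) 0; first exact: nm_ge0.
have n1 : 0 < nm (prj ip s x) by rewrite lt_neqAle eq_sym n0 nm_ge0.
rewrite -(ler_pM2r n1) -expr2 -(sq_nm ip_norm) /sq prj_selfadj prj_idem//.
by apply: le_trans (Re_md _) _; apply: ip_CS.
Qed.

Lemma prj_is_bop s : orthonormal ip s -> bounded_op (prj ip s).
Proof.
move=> so; split=> [a x y|]; first exact: prj_lin.
by exists 1 => // x; rewrite mul1r nm_prj.
Qed.

Lemma prj_cpt s : orthonormal ip s -> compact_op ip (prj ip s).
Proof.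
move=> so e e0; exists s => x; apply: (@le_trans _ _ (\sum_(u <- s) md (ip x u))).
  apply: le_trans (nm_sum _ _) _; apply: ler_sum_seq => u su.
  by rewrite nmZ (onset_nm ip_norm so.2)// mulr1.
by rewrite lerDr mulr_ge0 ?nm_ge0 ?(ltW e0).
Qed.

(** A positive operator agrees, as far as finitely many powers at a given
    vector are concerned, with its compression to a finite-dimensional
    (Krylov) subspace, which is compact. *)
Lemma krylov_compression A M n x : bounded_op A -> positive_op ip A -> 0 <= M ->
  (forall y, nm (A y) <= M * nm y) ->
  exists K, [/\ bounded_op K, compact_op ip K, positive_op ip K, forall y, nm (K y) <= M * nm y &
    forall k, (k <= n)%N -> iter k K x = iter k A x].
Proof.
move=> AP [As Ap] M0 AM.
have [t [to tP]] := gram_schmidt [seq iter k A x | k <- iota 0 n.+1].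
have Pb := prj_is_bop to.
exists (prj ip t \o A \o prj ip t); split.
- exact: bop_comp (bop_comp Pb AP) Pb.
- apply: cpt_compl; first exact: ip_norm; first exact: bop_comp.
  exact: prj_cpt.
- split=> [y z|y] /=; first by rewrite prj_selfadj As prj_selfadj.
  by rewrite prj_selfadj.
- move=> y /=; apply: le_trans (nm_prj _ to) _; apply: le_trans (AM _) _.
  by rewrite ler_wpM2l// nm_prj.
- have tA k : (k <= n)%N -> prj ip t (iter k A x) = iter k A x.
    by move=> kn; apply: tP; apply/mapP; exists k => //; rewrite mem_iota.
  elim=> [//|k IH] kn; rewrite !iterS IH ?(ltnW kn)//= tA ?(ltnW kn)//.
  by rewrite -iterS tA.
Qed.

End SpectralTheorem.

(** * Diagonal operators with prescribed eigenvalues *)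

Section UniformConvergence.
Context {R : realType}.
Implicit Types (f : R -> R) (q : nat -> {poly R}) (S : set R).

Lemma uniform_cvgP S q f :
  {uniform S, (fun n => horner (q n)) @ \oo --> f} <->
  forall e : R, 0 < e -> exists N, forall n, (N <= n)%N ->
    forall x, S x -> `|(q n).[x] - f x| <= e.
Proof.
split=> [cf e e0|h P].
  have : nbhs (f : {uniform` S -> R}) [set h : {uniform` S -> R} | forall y, S y -> `|h y - f y| <= e].
    apply/uniform_nbhs; exists [set xy | ball xy.1 e xy.2]; split.
      by rewrite -entourage_ballE; exists e.
    move=> h /= hS y /hS; rewrite /ball /= distrC; exact: ltW.
  by move=> /cf[N _ hN]; exists N => n Nn; apply: hN.
move=> /uniform_nbhs[E [entE EP]].
move: entE; rewrite -entourage_ballE => -[e /= e0 eE].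
have [N hN] := h (e / 2) (divr_gt0 e0 (ltr0n _ 2)).
exists N => // n /= Nn; apply: EP => y Sy; apply: eE => /=.
rewrite /ball /= distrC; apply: le_lt_trans (hN n Nn y Sy) _.
by rewrite ltr_pdivrMr// ltr_pMr// ltr1n.
Qed.

End UniformConvergence.

Section DiagonalExistence.
Context {R : realType} {H : completeNormedModType R[i]}.
Variable ip : {dot H for @conjC R[i]}.
Hypothesis ip_norm : forall x : H, ip x x = `|x| ^+ 2.
Implicit Types (x y z u v : H) (a : R[i]) (e M : R) (s t : seq H) (E : set H).
Implicit Types (A B K : H -> H) (g h : H -> R).
Local Notation ipP := (ip_sip ip_norm).

(** Parseval's identity transfers a coefficientwise bound to the norms. *)
Lemma coef_bound E M w v : is_onb ip E -> 0 <= M ->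
  (forall u, E u -> md (ip w u) <= M * md (ip v u)) -> nm w <= M * nm v.
Proof.
move=> EP M0 h; rewrite -(@ler_pXn2r _ 2)// ?nnegrE ?mulr_ge0 ?nm_ge0// -lee_fin.
rewrite -(parseval ip_norm w EP); apply: esum_le_seq => s us sE.
rewrite lee_fin exprMn.
apply: le_trans (ler_wpM2l (sqr_ge0 M) (bessel_ons ip_norm v (onset_ons EP.1 us sE))).
rewrite mulr_sumr; apply: ler_sum_seq => u su.
by rewrite -exprMn ler_pXn2r ?nnegrE ?mulr_ge0 ?md_ge0// h//; apply: sE.
Qed.

Lemma coef_inj E w v : is_onb ip E -> (forall u, E u -> ip w u = ip v u) -> w = v.
Proof.
move=> EP h; apply/eqP; rewrite -subr_eq0; apply/eqP/EP.2 => u Eu.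
by rewrite (sipBl ipP) h// subrr.
Qed.

Lemma ip_comb E s (c : H -> R[i]) v : orthonormal_set ip E -> uniq s ->
  (forall u, u \in s -> E u) -> E v ->
  ip (\sum_(u <- s) c u *: u) v = (v \in s)%:R * c v.
Proof.
move=> EE us sE Ev; rewrite (sip_suml ipP).
have [vs|vs] := boolP (v \in s).
  rewrite (bigD1_seq v)//= (sipZl ipP) (EE v v)// (eqxx v) mulr1 mul1r.
  rewrite big_seq_cond big1 ?addr0// => u /andP[su uv].
  by rewrite (sipZl ipP) (EE u v (sE u su) Ev) (negbTE uv) mulr0.
rewrite mul0r big_seq big1// => u su.
rewrite (sipZl ipP) (EE u v (sE u su) Ev).
by rewrite (negbTE (memPn vs u su)) mulr0.
Qed.

(** Riesz-Fischer: the partial sums of the series with coefficients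
    [g u * ip x u] are Cauchy because those of [x] are. *)
Lemma diag_exists E g M : is_onb ip E -> (forall u, E u -> `|g u| <= M) ->
  exists B, bounded_op B /\ diag E g B.
Proof.
move=> EP gM; pose M' := `|M|; have M0 : 0 <= M' by rewrite /M'.
have {}gM u : E u -> `|g u| <= M'.
  by move=> Eu; rewrite /M' (le_trans (gM u Eu))// ler_norm.
have M1 : 0 < M' + 1 by rewrite ltr_wpDl.
pose F s x : H := \sum_(u <- s) ((g u)%:C * ip x u) *: u.
have FE s x u e : approx ip E s x e -> E u -> ip (F s x) u = (g u)%:C * ip (prj ip s x) u.
  move=> [[us _] sE _] Eu; rewrite (ip_comb _ EP.1)// (ip_comb _ EP.1)//.
  by rewrite mulrCA.
have ex x : exists y, forall u, E u -> ip y u = (g u)%:C * ip x u.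
  have hs n : exists s, approx ip E s x (n.+1%:R^-1).
    by apply: (onb_approx1 ip_norm x EP); rewrite invr_gt0.
  have [s sP] := choice hs.
  have [|y hy] := @complete_seq _ _ (fun n => F (s n) x).
    move=> e e0; have [N hN] := harmonic_le (divr_gt0 (divr_gt0 e0 (ltr0n _ 2)) M1).
    exists N => i j Ni Nj.
    apply: (@le_trans _ _ (M' * nm (prj ip (s i) x - prj ip (s j) x))).
      apply: (coef_bound EP) => // u Eu.
      rewrite !(sipBl ipP) (FE _ _ _ _ (sP i))// (FE _ _ _ _ (sP j))// -mulrBr mdM md_real.
      by rewrite ler_wpM2r ?md_ge0 ?gM.
    have [_ _ hi] := sP i; have [_ _ hj] := sP j.
    have : nm (prj ip (s i) x - prj ip (s j) x) <= e / 2 / (M' + 1) + e / 2 / (M' + 1).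
      apply: le_trans (nm_tri x _ _) _; rewrite nmC lerD//.
        by apply: le_trans hi _; apply: hN.
      by apply: le_trans hj _; apply: hN.
    move=> /(ler_wpM2l M0) /le_trans; apply.
    rewrite -mulrDl -splitr mulrCA ler_piMr ?(ltW e0)//.
    by rewrite ler_pdivrMr// mul1r lerDl.
  exists y => u Eu; apply/eqP; rewrite -subr_eq0; apply/eqP/md_small_eq0 => e e0.
  have nu := onset_nm ip_norm EP.1 Eu.
  have [N1 h1] := hy _ (divr_gt0 e0 (ltr0n _ 2)).
  have [N2 h2] := harmonic_le (divr_gt0 (divr_gt0 e0 (ltr0n _ 2)) M1).
  pose n := maxn N1 N2; have [_ _ hn] := sP n.
  have -> : ip y u - (g u)%:C * ip x u
     = ip (y - F (s n) x) u + (g u)%:C * ip (prj ip (s n) x - x) u.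
    by rewrite !(sipBl ipP) (FE _ _ _ _ (sP n))// mulrBr addrA subrK.
  apply: le_trans (mdD _ _) _; rewrite [leRHS]splitr lerD//.
    apply: le_trans (ip_CS ip_norm _ _) _; rewrite nu mulr1 nmC.
    by apply: h1; rewrite leq_maxl.
  rewrite mdM md_real.
  apply: (@le_trans _ _ (M' * (e / 2 / (M' + 1)))); last first.
    by rewrite mulrCA ler_piMr ?divr_ge0 ?(ltW e0)// ler_pdivrMr// mul1r lerDl.
  apply: ler_pM; rewrite ?md_ge0 ?gM//.
  apply: le_trans (ip_CS ip_norm _ _) _; rewrite nu mulr1 nmC.
  by apply: le_trans hn _; apply: h2; apply: leq_maxr.
have [B hB] := choice ex.
exists B; split; last first.
  move=> u Eu; apply: (coef_inj EP) => v Ev; rewrite hB// (sipZl ipP).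
  by rewrite (EP.1 u v)//; have [->|_] := eqVneq u v; rewrite ?mulr0.
split=> [a x y|].
  apply: (coef_inj EP) => u Eu; rewrite (sip_lin ipP) !hB// (sip_lin ipP).
  by rewrite mulrDr mulrCA.
exists M' => // x; apply: (coef_bound EP) => // u Eu.
by rewrite hB// mdM md_real ler_wpM2r ?md_ge0 ?gM.
Qed.

(** A finite expansion of [x] involves finitely many eigenvalues, which converge
    together; on the small remainder the uniform bound [M] controls the
    difference. *)
Lemma diag_strong_cvg E (gn : nat -> H -> R) g (Bn : nat -> H -> H) B M x :
  is_onb ip E -> (forall n, bounded_op (Bn n)) -> (forall n, diag E (gn n) (Bn n)) ->
  bounded_op B -> diag E g B -> (forall n u, E u -> `|gn n u - g u| <= M) ->
  (forall u, E u -> forall e, 0 < e -> exists N, forall n, (N <= n)%N -> `|gn n u - g u| <= e) ->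
  forall e, 0 < e -> exists N, forall n, (N <= n)%N -> nm (Bn n x - B x) <= e.
Proof.
move=> EP Bb Bd BP Bg gM gc e e0.
pose M' := `|M|; have M1 : 0 < M' + 1 by rewrite /M' ltr_wpDl.
have e2 : 0 < e / 2 by rewrite divr_gt0.
have [s [so sE sx]] := onb_approx1 ip_norm x EP (divr_gt0 e2 M1).
pose Sg := \sum_(u <- s) md (ip x u).
have S0 : 0 <= Sg by apply: sumr_ge0 => u _; apply: md_ge0.
have S1 : 0 < Sg + 1 by rewrite ltr_wpDl.
have [N hN] : exists N, forall n, (N <= n)%N -> forall u, u \in s -> `|gn n u - g u| <= e / 2 / (Sg + 1).
  have d0 : 0 < e / 2 / (Sg + 1) by rewrite divr_gt0.
  elim: (s) sE => [|u t IH] sE; first by exists 0%N.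
  have [|N1 h1] := IH; first by move=> v vt; apply: sE; rewrite inE vt orbT.
  have [N2 h2] := gc u (sE u (mem_head _ _)) _ d0.
  exists (maxn N1 N2) => n; rewrite geq_max => /andP[n1 n2] v; rewrite inE => /predU1P[->|].
    exact: h2.
  exact: h1.
exists N => n Nn.
have Db := bop_sub (Bb n) BP.
have Dd : diag E (fun u => gn n u - g u) (fun x => Bn n x - B x).
  by move=> u Eu; rewrite (Bd n u Eu) (Bg u Eu) rmorphB scalerBl.
rewrite -[x in Bn n x - B x](subrK (prj ip s x)) (bopD Db); apply: le_trans (nmD _ _) _.
rewrite [leRHS]splitr lerD//.
  have := @diag_bound _ _ ip ip_norm E _ _ M' EP Db Dd (normr_ge0 _).
  move=> /(_ (fun u Eu => le_trans (gM n u Eu) (ler_norm M))) /(_ (x - prj ip s x)) /le_trans; apply.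
  apply: le_trans (ler_wpM2l (normr_ge0 M) sx) _; rewrite -/M'.
  by rewrite mulrCA ler_piMr ?(ltW e2)// ler_pdivrMr// mul1r lerDl.
rewrite (prj_bop ip s x Db); apply: le_trans (nm_sum _ _) _.
apply: (@le_trans _ _ (\sum_(u <- s) md (ip x u) * (e / 2 / (Sg + 1)))).
  apply: ler_sum_seq => u su; rewrite nmZ ler_wpM2l ?md_ge0// (Dd u (sE u su)) nmZ md_real.
  by rewrite (onset_nm ip_norm EP.1 (sE u su)) mulr1 hN.
rewrite -mulr_suml -/Sg mulrCA ler_piMr ?(ltW e2)//.
by rewrite ler_pdivrMr// mul1r lerDl.
Qed.

End DiagonalExistence.

(** * Functional calculus of bounded positive operators *)

Section FunctionalCalculus.
Context {R : realType} {H : completeNormedModType R[i]}.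
Variable ip : {dot H for @conjC R[i]}.
Hypothesis ip_norm : forall x : H, ip x x = `|x| ^+ 2.
Implicit Types (x y z u v : H) (a : R[i]) (e M c : R) (s t : seq H) (E : set H).
Implicit Types (A B K : H -> H) (g h : H -> R) (q : {poly R}) (f : R -> R).
Local Notation ipP := (ip_sip ip_norm).

Lemma op_polyE n q A x : (size q <= n)%N ->
  op_poly q A x = \sum_(k < n) (q`_k)%:C *: iter k A x.
Proof.
move=> qn; rewrite /op_poly (big_ord_widen n (fun k => (q`_k)%:C *: iter k A x))//.
rewrite big_mkcond /=; apply: eq_bigr => k _; case: ltnP => // kq.
by rewrite nth_default// scale0r.
Qed.

Lemma op_polyD p q A x : op_poly (p + q) A x = op_poly p A x + op_poly q A x.
Proof.
pose n := maxn (size p) (size q).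
rewrite !(@op_polyE n) ?leq_maxl ?leq_maxr ?size_polyD// -big_split /=.
by apply: eq_bigr => k _; rewrite coefD rmorphD /= scalerDl.
Qed.

Lemma op_polyZ c q A x : op_poly (c *: q) A x = c%:C *: op_poly q A x.
Proof.
rewrite !(@op_polyE (size q)) ?size_scale_leq// scaler_sumr.
by apply: eq_bigr => k _; rewrite coefZ rmorphM /= scalerA.
Qed.

Lemma op_polyB p q A x : op_poly (p - q) A x = op_poly p A x - op_poly q A x.
Proof. by rewrite -scaleN1r op_polyD op_polyZ rmorphN1 scaleN1r. Qed.

Lemma op_polyC c A x : op_poly c%:P A x = c%:C *: x.
Proof.
by rewrite (@op_polyE 1) ?size_polyC ?leq_b1// big_ord1 /= coefC.
Qed.

Lemma op_polyX2 A x : op_poly 'X^2 A x = A (A x).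
Proof.
rewrite (@op_polyE 3) ?size_polyXn// !big_ord_recl big_ord0 /= !coefXn /=.
by rewrite !scale0r !add0r addr0 scale1r.
Qed.

Lemma iter_bop k A : bounded_op A -> bounded_op (iter k A).
Proof.
move=> AP; elim: k => [|k IH]; first exact: bop_id.
exact: (bop_comp AP IH).
Qed.

Lemma op_poly_bop q A : bounded_op A -> bounded_op (op_poly q A).
Proof.
move=> AP; rewrite /op_poly.
by apply: (bop_bigsum _ (A := fun k : 'I_(size q) => fun x => (q`_k)%:C *: iter k A x)) => k;
  apply/bop_scale/iter_bop.
Qed.

Lemma op_poly_diag E g q A : bounded_op A -> diag E g A ->
  diag E (fun u => q.[g u]) (op_poly q A).
Proof.
move=> AP Ad u Eu.
have iterE k : iter k A u = ((g u) ^+ k)%:C *: u.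
  elim: k => [|k IH]; first by rewrite scale1r.
  by rewrite iterS IH (bopZ AP) Ad// scalerA -rmorphM /= -exprSr.
rewrite /op_poly horner_coef rmorph_sum /= scaler_suml; apply: eq_bigr => k _.
by rewrite iterE scalerA -rmorphM.
Qed.

Lemma op_poly_selfadj q A x y : (forall x y, ip (A x) y = ip x (A y)) ->
  ip (op_poly q A x) y = ip x (op_poly q A y).
Proof.
move=> As; rewrite /op_poly (sip_suml ipP) (sip_sumr ipP); apply: eq_bigr => k _.
rewrite (sipZl ipP) (sipZr ipP) conjc_real; congr (_ * _).
elim: (k : nat) x y => [//|n IH] x y; by rewrite iterS As IH iterSr.
Qed.

Lemma diag_le E g A M u : is_onb ip E -> diag E g A ->
  (forall x, nm (A x) <= M * nm x) -> E u -> `|g u| <= M.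
Proof.
move=> EP Ad AM Eu; have := AM u.
by rewrite Ad// nmZ (onset_nm ip_norm EP.1 Eu) !mulr1 md_real.
Qed.

(** A polynomial in [A], evaluated at one vector, only sees a Krylov subspace,
    so it may be computed from a diagonal operator with spectrum in [[0, M]].
    This replaces a spectral theorem for the bounded operator [A]. *)
Lemma poly_reduce A M q x : bounded_op A -> positive_op ip A -> 0 <= M ->
  (forall y, nm (A y) <= M * nm y) ->
  exists E g K, [/\ is_onb ip E, bounded_op K, diag E g K, forall u, E u -> 0 <= g u <= M &
    op_poly q A x = op_poly q K x].
Proof.
move=> AP Ap M0 AM.
have [K [KP Kc Kp KM KA]] := krylov_compression ip_norm (size q) x AP Ap M0 AM.
have [E [g [EP gd g0]]] := spectral_theorem ip_norm KP Kc Kp.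
exists E, g, K; split=> //.
  move=> u Eu; rewrite g0//=; apply: le_trans (ler_norm _) _.
  exact: diag_le EP gd KM Eu.
by rewrite /op_poly; apply: eq_bigr => k _; rewrite KA// ltnW.
Qed.

Lemma poly_bound A M q e x : bounded_op A -> positive_op ip A -> 0 <= M ->
  (forall y, nm (A y) <= M * nm y) -> 0 <= e ->
  (forall l, 0 <= l <= M -> `|q.[l]| <= e) -> nm (op_poly q A x) <= e * nm x.
Proof.
move=> AP Ap M0 AM e0 qe.
have [E [g [K [EP KP Kd gM ->]]]] := poly_reduce q x AP Ap M0 AM.
apply: (diag_bound ip_norm EP (op_poly_bop q KP) (op_poly_diag q KP Kd) e0).
by move=> u Eu; apply: qe; apply: gM.
Qed.

Lemma poly_pos A M q x : bounded_op A -> positive_op ip A -> 0 <= M ->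
  (forall y, nm (A y) <= M * nm y) ->
  (forall l, 0 <= l <= M -> 0 <= q.[l]) -> 0 <= complex.Re (ip (op_poly q A x) x).
Proof.
move=> AP Ap M0 AM qe.
have [E [g [K [EP KP Kd gM ->]]]] := poly_reduce q x AP Ap M0 AM.
apply: (diag_pos ip_norm x EP (op_poly_bop q KP) (op_poly_diag q KP Kd)).
by move=> u Eu; apply: qe; apply: gM.
Qed.

(** The functional calculus relation with real norms and explicit ranks. *)
Definition fun_limit A f B M (q : nat -> {poly R}) := [/\ 0 <= M,
  forall x, nm (A x) <= M * nm x,
  forall e, 0 < e -> exists N, forall n, (N <= n)%N -> forall l, 0 <= l <= M ->
    `|(q n).[l] - f l| <= e &
  forall e, 0 < e -> exists N, forall n, (N <= n)%N -> forall x,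
    nm (op_poly (q n) A x - B x) <= e * nm x].

Lemma is_fun_calcP A f B : is_fun_calc A f B <-> exists M (q : nat -> {poly R}), fun_limit A f B M q.
Proof.
split=> -[M [q [M0 AM qf qB]]]; exists M, q; split=> //.
- by apply/op_boundE.
- move=> e e0; have [N hN] := (uniform_cvgP _ _ _).1 qf e e0; exists N => n Nn l lM.
  by apply: hN => //=; rewrite in_itv.
- move=> e e0; have [N _ hN] := qB e e0; exists N => n Nn x.
  by have /op_boundE/(_ x) := hN n Nn.
- by apply/op_boundE.
- apply/uniform_cvgP => e e0; have [N hN] := qf e e0; exists N => n Nn l /=.
  by rewrite in_itv /=; apply: hN.
- move=> e e0; have [N hN] := qB e e0; exists N => // n /= Nn.
  by apply/op_boundE => x; apply: hN.
Qed.

Lemma fun_calc_bop A f B : bounded_op A -> is_fun_calc A f B -> bounded_op B.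
Proof.
move=> AP /is_fun_calcP[M [q [M0 AM qf qB]]]; split=> [a x y|].
  apply/eqP; rewrite -subr_eq0; apply/eqP.
  have K0 : 0 <= nm (a *: x + y) + md a * nm x + nm y.
    by rewrite !addr_ge0 ?nm_ge0// mulr_ge0 ?md_ge0 ?nm_ge0.
  apply: (nm_closure K0) => e e0; have [N hN] := qB e e0.
  have {}hN := hN N (leqnn N); set Q := op_poly (q N) A in hN *.
  have QP : bounded_op Q by apply: op_poly_bop.
  have -> : B (a *: x + y) - (a *: B x + B y) =
     - (Q (a *: x + y) - B (a *: x + y)) + (a *: (Q x - B x) + (Q y - B y)).
    rewrite (bop_lin QP) scalerBr addrACA opprB -opprD addrA; congr (_ - _).
    by rewrite subrK.
  apply: le_trans (nmD _ _) _; rewrite nmN -addrA mulrDl lerD 1?mulrC//.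
  apply: le_trans (nmD _ _) _; rewrite mulrDr lerD// nmZ ?[e * nm y]mulrC//.
  by rewrite mulrCA ler_wpM2l ?md_ge0.
have [N hN] := qB 1 ltr01; have [M' M'0 QM] := bop_bd (op_poly_bop (q N) AP).
exists (M' + 1) => [|x]; first by rewrite addr_ge0.
rewrite -[B x](subKr (op_poly (q N) A x)); apply: le_trans (nmD _ _) _.
by rewrite nmN mulrDl lerD// hN.
Qed.

(** On an eigenvector the polynomial approximations converge to [f] of the
    eigenvalue, which lies in the interval of uniform approximation. *)
Lemma fun_calc_diag A f B E g : is_onb ip E -> diag E g A -> bounded_op A ->
  (forall u, E u -> 0 <= g u) -> is_fun_calc A f B -> diag E (f \o g) B.
Proof.
move=> EP Ad AP g0 /is_fun_calcP[M [q [M0 AM qf qB]]] u Eu.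
apply/eqP; rewrite -subr_eq0; apply/eqP.
apply: (@nm_closure _ _ _ 2) => // e e0.
have [N1 h1] := qf e e0; have [N2 h2] := qB e e0.
pose n := maxn N1 N2; have nu := onset_nm ip_norm EP.1 Eu.
have {}h2 := h2 n (leq_maxr _ _) u; have {}h1 := h1 n (leq_maxl _ _) (g u).
rewrite (op_poly_diag (q n) AP Ad Eu) nu mulr1 in h2.
have gu : 0 <= g u <= M.
  by rewrite g0//= (le_trans (ler_norm _))// (diag_le EP Ad AM Eu).
have -> : B u - ((f \o g) u)%:C *: u = ((q n).[g u] - f (g u))%:C *: u - ((q n).[g u]%:C *: u - B u).
  by rewrite rmorphB scalerBl opprB [RHS]addrC addrA subrK.
apply: le_trans (nmD _ _) _; rewrite nmN nmZ nu mulr1 md_real.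
by rewrite mulr2n mulrDl !mul1r lerD// h1.
Qed.

(** Polynomials converging uniformly on the interval give operators that are
    Cauchy in norm. *)
Lemma fun_calc_pow A (s : R) : bounded_op A -> positive_op ip A -> 0 <= s ->
  exists B, is_fun_calc A (fun l => l `^ s) B.
Proof.
move=> AP Ap s0; have [M0 M00 AM0] := bop_bd AP.
pose M := M0 + 1; have Mp : 0 < M by rewrite ltr_wpDl.
have AM x : nm (A x) <= M * nm x.
  by apply: le_trans (AM0 x) _; rewrite ler_wpM2r ?nm_ge0// lerDl.
have hq (n : nat) : exists q : {poly R}, forall l, 0 <= l <= M -> `|q.[l] - l `^ s| <= n.+1%:R^-1.
  by apply: powR_approx => //; rewrite invr_gt0 ltr0n.
have [q qP] := choice hq.
have qq i j x : nm (op_poly (q i) A x - op_poly (q j) A x)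
    <= (i.+1%:R^-1 + j.+1%:R^-1) * nm x.
  rewrite -op_polyB; apply: (poly_bound _ AP Ap (ltW Mp) AM).
    by rewrite addr_ge0 ?invr_ge0.
  move=> l lM; rewrite hornerD hornerN.
  have -> : (q i).[l] - (q j).[l] = ((q i).[l] - l `^ s) - ((q j).[l] - l `^ s) by ring.
  by apply: le_trans (ler_normB _ _) _; rewrite lerD// qP.
have ex x : exists y, forall e, 0 < e -> exists N, forall i, (N <= i)%N ->
    nm (op_poly (q i) A x - y) <= e.
  apply: complete_seq => e e0.
  have n1 : 0 < nm x + 1 by rewrite ltr_wpDl ?nm_ge0.
  have [N hN] := harmonic_le (divr_gt0 (divr_gt0 e0 (ltr0n _ 2)) n1).
  exists N => i j Ni Nj; apply: le_trans (qq i j x) _.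
  have h := lerD (hN i Ni) (hN j Nj).
  apply: le_trans (ler_wpM2r (nm_ge0 x) h) _.
  by rewrite -mulrDl -splitr mulrAC ler_pdivrMr// ler_wpM2l ?(ltW e0)// lerDl.
have [B BP] := choice ex.
exists B; apply/is_fun_calcP; exists M, q; split=> //; first exact: ltW.
- move=> e e0; have [N hN] := harmonic_le e0; exists N => n Nn l lM.
  by apply: le_trans (qP n l lM) _; apply: hN.
- move=> e e0; have [N hN] := harmonic_le (divr_gt0 e0 (ltr0n _ 2)); exists N => n Nn x.
  apply/ler_addgt0Pl => r r0; have [N' hN'] := BP x r r0.
  apply: le_trans (nm_tri (op_poly (q (maxn N N')) A x) _ _) _; rewrite addrC lerD//.
    by apply: hN'; apply: leq_maxr.
  apply: le_trans (qq _ _ _) _; rewrite ler_wpM2r ?nm_ge0// [leRHS]splitr.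
  by apply: lerD; apply: hN => //; apply: leq_maxl.
Qed.

Lemma op_powP A (s : R) : bounded_op A -> positive_op ip A -> 0 <= s ->
  is_fun_calc A (fun l => l `^ s) (op_pow A s).
Proof.
move=> AP Ap s0; rewrite /op_pow; case: xgetP => [B _ //|nB].
by have [B hB] := fun_calc_pow AP Ap s0; case: (nB B).
Qed.

(** A scalar inequality between a polynomial and [f] on the interval containing
    the spectrum becomes an inequality of quadratic forms. *)
Lemma fun_calc_pos A f B r c M x : bounded_op A -> positive_op ip A -> is_fun_calc A f B ->
  0 <= M -> (forall y, nm (A y) <= M * nm y) ->
  0 <= c -> (forall l, 0 <= l <= M -> 0 <= r.[l] + c * f l) ->
  0 <= complex.Re (ip (op_poly r A x) x) + c * complex.Re (ip (B x) x).
Proof.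
move=> AP Ap /is_fun_calcP[M' [q [M'0 AM' qf qB]]] M0 AM c0 h.
apply/ler_addgt0Pl => e e0.
pose K := 2 * c * nm x ^+ 2 + 1.
have K1 : 0 < K by rewrite ltr_wpDl// !mulr_ge0 ?nm_ge0.
pose dl := e / K; have d0 : 0 < dl by rewrite divr_gt0.
have [N1 h1] := qf dl d0; have [N2 h2] := qB dl d0.
pose n := maxn N1 N2.
have {}h2 := h2 n (leq_maxr _ _) x; have {}h1 := h1 n (leq_maxl _ _).
have mM0 : 0 <= Num.min M M' by rewrite le_min M0 M'0.
have AmM y : nm (A y) <= Num.min M M' * nm y.
  by rewrite minEle; case: ifP => _; [exact: AM|exact: AM'].
have := @poly_pos A (Num.min M M') (r + c *: q n + (c * dl)%:P) x AP Ap mM0 AmM.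
rewrite !op_polyD op_polyZ op_polyC !(sipDl ipP) !(sipZl ipP) !ReD !ReZ.
have -> : complex.Re (ip x x) = nm x ^+ 2 by rewrite -(sq_nm ip_norm).
set r0 := complex.Re (ip (op_poly r A x) x) => h3.
have {}h3 : 0 <= r0 + c * complex.Re (ip (op_poly (q n) A x) x) + c * dl * nm x ^+ 2.
  apply: h3 => l; rewrite le_min => /and3P[l0 lM lM']; rewrite !hornerD hornerZ hornerC.
  have := h l; have := h1 l; rewrite l0 lM lM' => /(_ isT) + /(_ isT); rewrite ler_norml => /andP[? ?].
  by nra.
have : complex.Re (ip (op_poly (q n) A x) x) - complex.Re (ip (B x) x) <= dl * nm x ^+ 2.
  rewrite -ReB -(sipBl ipP); apply: le_trans (Re_md _) _.
  apply: le_trans (ip_CS ip_norm _ _) _.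
  by rewrite expr2 mulrA ler_wpM2r ?nm_ge0.
move=> /(ler_wpM2l c0).
have : dl * (2 * c * nm x ^+ 2) <= e.
  rewrite /dl mulrAC ler_pdivrMr// ler_wpM2l ?(ltW e0)//; first by rewrite lerDl.
by nra.
Qed.

Lemma fun_calc_selfadj A f B x y : bounded_op A -> positive_op ip A -> is_fun_calc A f B ->
  ip (B x) y = ip x (B y).
Proof.
move=> AP Ap /is_fun_calcP[M [q [M0 AM qf qB]]].
apply/eqP; rewrite -subr_eq0; apply/eqP/md_small_eq0 => e e0.
pose K := 2 * nm x * nm y + 1.
have K1 : 0 < K by rewrite ltr_wpDl// !mulr_ge0 ?nm_ge0.
have [N hN] := qB (e / K) (divr_gt0 e0 K1); have {}hN := hN N (leqnn N).
set Q := op_poly (q N) A in hN.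
have -> : ip (B x) y - ip x (B y) = ip x (Q y - B y) - ip (Q x - B x) y.
  by rewrite (sipBl ipP) (sipBr ipP) (op_poly_selfadj _ _ _ Ap.1) -/Q; ring.
apply: le_trans (mdD _ _) _; rewrite mdN.
apply: (@le_trans _ _ (nm x * (e / K * nm y) + e / K * nm x * nm y)).
  apply: lerD; apply: le_trans (ip_CS ip_norm _ _) _.
    by rewrite ler_wpM2l ?nm_ge0.
  by rewrite ler_wpM2r ?nm_ge0.
have -> : nm x * (e / K * nm y) + e / K * nm x * nm y = e / K * (2 * nm x * nm y) by ring.
by rewrite mulrAC ler_pdivrMr// ler_wpM2l ?(ltW e0)// lerDl.
Qed.

Lemma op_pow_bop A (s : R) : bounded_op A -> positive_op ip A -> 0 <= s -> bounded_op (op_pow A s).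
Proof. by move=> AP Ap s0; apply: (fun_calc_bop AP (op_powP AP Ap s0)). Qed.

Lemma op_pow_positive A (s : R) : bounded_op A -> positive_op ip A -> 0 <= s ->
  positive_op ip (op_pow A s).
Proof.
move=> AP Ap s0; have h := op_powP AP Ap s0; split=> [x y|x].
  exact: fun_calc_selfadj AP Ap h.
have [M M0 AM] := bop_bd AP.
have := @fun_calc_pos A _ _ 0 1 M x AP Ap h M0 AM ler01.
rewrite mul1r (@op_polyE 0) ?size_poly0// big_ord0 (sip0l ipP) add0r.
by apply=> l _; rewrite horner0 add0r mul1r powR_ge0.
Qed.

Lemma diag_positive E g A : is_onb ip E -> bounded_op A -> diag E g A ->
  (forall u, E u -> 0 <= g u) -> positive_op ip A.
Proof.
move=> EP AP Ad g0; split=> [x y|x]; first exact: diag_selfadj EP AP Ad.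
exact: diag_pos EP AP Ad g0.
Qed.

(** From here on real powers are only met through their eigenvalues. *)
Lemma op_pow_diag E g A (s : R) : is_onb ip E -> bounded_op A -> diag E g A ->
  (forall u, E u -> 0 <= g u) -> 0 <= s ->
  bounded_op (op_pow A s) /\ diag E (fun u => g u `^ s) (op_pow A s).
Proof.
move=> EP AP Ad g0 s0; have Ap := diag_positive EP AP Ad g0.
have h := op_powP AP Ap s0; split; first exact: op_pow_bop.
exact: fun_calc_diag EP Ad AP g0 h.
Qed.

End FunctionalCalculus.

(** * The trace, and compactness from a finite trace *)

Section Exchange.
Context {R : realType} {T U : choiceType}.

Lemma esum_exchange_le (I : set T) (J : set U) (a : T -> U -> \bar R) :
  (forall i j, (0 <= a i j)%E) ->
  (\esum_(i in I) \esum_(j in J) a i j <= \esum_(j in J) \esum_(i in I) a i j)%E.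
Proof.
move=> a0; apply: ge_ereal_sup => _ [F [Ff FI] <-].
rewrite fsbig_finite//= -esum_sum//; apply: le_esum => j _.
apply: ereal_sup_ubound; exists F; first by split.
by rewrite fsbig_finite.
Qed.

Lemma esum_adherent (I : set T) (a : T -> R) (e : R) :
  (\esum_(i in I) (a i)%:E < +oo)%E -> (forall i, 0 <= a i) -> 0 < e ->
  exists s, [/\ uniq s, forall i, i \in s -> I i &
    (\esum_(i in I) (a i)%:E <= (\sum_(i <- s) a i + e)%:E)%E].
Proof.
move=> fin a0 e0.
have finn : (\esum_(i in I) (a i)%:E)%E \is a fin_num.
  by rewrite ge0_fin_numE// esum_ge0// => i _; rewrite lee_fin.
have [_ [F [Ff FI] <-]] := ub_ereal_sup_adherent e0 finn.
rewrite fsbig_finite//= sumEFin => h.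
exists (finmap.enum_fset (fset_set F)); split.
- exact: finmap.fset_uniq.
- by move=> i; rewrite in_fset_set// inE => /FI.
- by rewrite EFinD -leeBlDr// ltW.
Qed.

End Exchange.

Lemma sum_CS {R : realType} (I : Type) (s : seq I) (a b : I -> R) :
  (\sum_(i <- s) a i * b i) ^+ 2 <= (\sum_(i <- s) a i ^+ 2) * \sum_(i <- s) b i ^+ 2.
Proof.
set A := \sum_(i <- s) a i ^+ 2; set B := \sum_(i <- s) b i ^+ 2; set X := \sum_(i <- s) _.
have h (l : R) : 0 <= l ^+ 2 * A - 2 * l * X + B.
  have -> : l ^+ 2 * A - 2 * l * X + B = \sum_(i <- s) (l * a i - b i) ^+ 2.
    rewrite /A /B /X !mulr_sumr -sumrB -big_split /=; apply: eq_bigr => i _; ring.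
  by apply: sumr_ge0 => i _; apply: sqr_ge0.
have A0 : 0 <= A by apply: sumr_ge0 => i _; apply: sqr_ge0.
have [Az|An] := eqVneq A 0.
  have [->|Xn] := eqVneq X 0; first by rewrite expr0n Az mul0r.
  have := h ((B + 1) / (2 * X)); rewrite Az mulr0 add0r.
  have -> : - (2 * ((B + 1) / (2 * X)) * X) + B = -1 by field.
  by rewrite oppr_ge0 ler10.
have Ap : 0 < A by rewrite lt_neqAle eq_sym An.
have := h (X / A).
have -> : (X / A) ^+ 2 * A - 2 * (X / A) * X + B = B - X ^+ 2 / A by field.
by rewrite subr_ge0 ler_pdivrMr// mulrC.
Qed.

Section TraceClass.
Context {R : realType} {H : completeNormedModType R[i]}.
Variable ip : {dot H for @conjC R[i]}.
Hypothesis ip_norm : forall x : H, ip x x = `|x| ^+ 2.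
Implicit Types (x y z u v : H) (a : R[i]) (e M c p : R) (s t : seq H) (E : set H).
Implicit Types (A B K : H -> H) (g h : H -> R).
Local Notation ipP := (ip_sip ip_norm).

Lemma diag_quad_esum E g B x : is_onb ip E -> bounded_op B -> diag E g B ->
  (forall u, E u -> 0 <= g u) ->
  ((complex.Re (ip (B x) x))%:E = \esum_(u in E) (g u * md (ip x u) ^+ 2)%:E)%E.
Proof.
move=> EP BP Bd g0.
have B1 : 0 < nm (B x) + 1 by rewrite ltr_wpDl ?nm_ge0.
have apx e : 0 < e -> exists s, approx ip E s x e /\ nm (B x) * nm (x - prj ip s x) <= e.
  move=> e0; have d0 : 0 < Num.min e (e / (nm (B x) + 1)) by rewrite lt_min e0 divr_gt0.
  have [s [so sE]] := onb_approx1 ip_norm x EP d0; rewrite le_min => /andP[h1 h2].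
  exists s; split; first by split.
  apply: le_trans (ler_wpM2l (nm_ge0 _) h2) _.
  by rewrite mulrCA ler_piMr ?(ltW e0)// ler_pdivrMr// mul1r lerDl.
apply/eqP; rewrite eq_le; apply/andP; split.
  apply/lee_addgt0Pr => e e0; have [s [[[us so] sE _] sx]] := apx e e0.
  apply: (@le_trans _ _ ((\sum_(u <- s) g u * md (ip x u) ^+ 2)%:E + e%:E)%E).
    rewrite -EFinD lee_fin -lerBlDl; apply: le_trans sx.
    by apply: le_trans (diag_quad ip_norm x EP BP Bd sE); apply: ler_norm.
  by rewrite leeD2r// esum_ge_seq.
apply: esum_le_seq => s us sE; rewrite lee_fin.
apply/ler_addgt0Pr => e e0; have [t [[[ut tso] tE _] tx]] := apx e e0.
have [[uw wso] wE] := ons_union EP.1 sE tE.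
set w := undup (s ++ t) in uw wso wE.
have sw : {subset s <= w} by move=> u us'; rewrite /w mem_undup mem_cat us'.
have tw : {subset t <= w} by move=> u ut'; rewrite /w mem_undup mem_cat ut' orbT.
have := diag_quad ip_norm x EP BP Bd wE; rewrite ler_norml => /andP[h _].
apply: (@le_trans _ _ (\sum_(u <- w) g u * md (ip x u) ^+ 2)); last first.
  have : nm (B x) * nm (x - prj ip w x) <= e.
    apply: le_trans tx; rewrite ler_wpM2l ?nm_ge0//.
    by apply: (nm_prj_res_subset ip_norm) => //; split.
  lra.
have gE v : v \in w -> `|g v| = g v by move=> vw; rewrite ger0_norm// g0//; apply: wE.
have absE r : {subset r <= w} ->
    \sum_(u <- r) g u * md (ip x u) ^+ 2 = \sum_(u <- r) `|g u| * md (ip x u) ^+ 2.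
  by move=> rw; rewrite big_seq [RHS]big_seq; apply: eq_bigr => v /rw /gE ->.
rewrite (absE s)// (absE w)//.
by apply: ler_sum_subset => // u; rewrite mulr_ge0 ?sqr_ge0.
Qed.

(** The trace of a positive diagonal operator does not depend on the
    orthonormal basis: Parseval's identity used twice. *)
Lemma trace_diag E g B : is_onb ip E -> bounded_op B -> diag E g B ->
  (forall u, E u -> 0 <= g u) ->
  (op_trace ip B = \esum_(u in E) (g u)%:E)%E.
Proof.
move=> EP BP Bd g0; have FP := onb_is_onb ip_norm.
pose k (u e : H) : \bar R := ((md (ip ((Num.sqrt (g u))%:C *: u) e) ^+ 2)%:E)%E.
have k0 (u e : H) : (0 <= k u e)%E by rewrite lee_fin sqr_ge0.
have inner (e : H) : onb ip e -> ((complex.Re (ip (B e) e))%:E = \esum_(u in E) k u e)%E.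
  move=> _; rewrite (diag_quad_esum e EP BP Bd g0); apply: eq_esum => u Eu.
  rewrite /k (sipZl ipP) mdM md_real ger0_norm ?sqrtr_ge0// exprMn sqr_sqrtr ?g0//.
  by rewrite (md_sip_sym ipP).
have outer u : E u -> (\esum_(e in onb ip) k u e = (g u)%:E)%E.
  move=> Eu; rewrite /k (parseval ip_norm _ FP) nmZ md_real ger0_norm ?sqrtr_ge0//.
  by rewrite (onset_nm ip_norm EP.1 Eu) mulr1 sqr_sqrtr ?g0.
rewrite /op_trace (eq_esum inner) -(eq_esum outer).
by apply/eqP; rewrite eq_le; apply/andP; split; apply: esum_exchange_le.
Qed.

(** The form of [B] satisfies Cauchy-Schwarz, so on vectors orthogonal to a
    finite part [s] of the basis it is controlled by the tail of the trace
    outside [s].  This is how finite trace yields compactness. *)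
Lemma finite_trace_small B e : bounded_op B -> positive_op ip B ->
  (op_trace ip B < +oo)%E -> 0 < e ->
  exists s, orthonormal ip s /\ forall y, (forall u, u \in s -> ip y u = 0) ->
    complex.Re (ip (B y) y) <= e * nm y ^+ 2.
Proof.
move=> BP Bp fin e0; have FP := onb_is_onb ip_norm.
pose b x := complex.Re (ip (B x) x).
have b0 x : 0 <= b x := Bp.2 x.
have [s [us sF hs]] := esum_adherent fin b0 e0.
have so := onset_ons FP.1 us sF.
exists s; split=> // y ys; rewrite -/(b y).
have tail t : uniq t -> (forall u, u \in t -> onb ip u) -> (forall u, u \in t -> u \notin s) ->
    \sum_(u <- t) b u <= e.
  move=> ut tF ts.
  have : ((\sum_(u <- s ++ t) b u)%:E <= \esum_(u in onb ip) (b u)%:E)%E.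
    apply: esum_ge_seq => [|u].
      rewrite cat_uniq us ut andbT; apply/hasPn => u ut'; exact: ts.
    by rewrite mem_cat => /orP[/sF|/tF].
  by move=> /le_trans /(_ hs); rewrite lee_fin big_cat /= lerD2l.
have key r : 0 < r -> b y <= nm (B y) * r + Num.sqrt (b y) * (nm y * Num.sqrt e).
  move=> r0; have [t0 [[ut0 t0o] t0F t0y]] := onb_approx1 ip_norm y FP r0.
  pose t := [seq u <- t0 | u \notin s].
  have pE : prj ip t0 y = prj ip t y.
    rewrite /prj (bigID (fun u => u \in s)) /= big1 ?add0r.
      by rewrite -big_filter.
    by move=> u us'; rewrite ys ?scale0r.
  have ut : uniq t by rewrite filter_uniq.
  have tF u : u \in t -> onb ip u by rewrite mem_filter => /andP[_ /t0F].
  have ts u : u \in t -> u \notin s by rewrite mem_filter => /andP[].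
  have bE : b y = complex.Re (ip (B y) (y - prj ip t y)) + complex.Re (ip (B y) (prj ip t y)).
    by rewrite -ReD -(sipDr ipP) subrK.
  rewrite {1}bE.
  apply: lerD.
    apply: le_trans (Re_md _) _; apply: le_trans (ip_CS ip_norm _ _) _.
    by rewrite ler_wpM2l ?nm_ge0// -pE.
  apply: le_trans (Re_md _) _; rewrite /prj (sip_sumr ipP); apply: le_trans (md_sum _ _) _.
  apply: (@le_trans _ _ (\sum_(u <- t) Num.sqrt (b y) * (md (ip y u) * Num.sqrt (b u)))).
    apply: ler_sum => u _; rewrite (sipZr ipP) mdM md_conj mulrCA ler_wpM2l ?md_ge0//.
    exact: sip_CS_sqrt (positive_sip ip_norm BP Bp) y u.
  rewrite -mulr_sumr; apply: ler_wpM2l; first exact: sqrtr_ge0.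
  rewrite -(@ler_pXn2r _ 2)// ?nnegrE ?mulr_ge0 ?nm_ge0 ?sqrtr_ge0//; last first.
    by apply: sumr_ge0 => u _; rewrite mulr_ge0 ?md_ge0 ?sqrtr_ge0.
  apply: le_trans (sum_CS _ _ _) _; rewrite exprMn sqr_sqrtr ?(ltW e0)//.
  apply: ler_pM.
  - by apply: sumr_ge0 => u _; apply: sqr_ge0.
  - by apply: sumr_ge0 => u _; apply: sqr_ge0.
  - by have := bessel_ons ip_norm y (onset_ons FP.1 ut tF).
  - under eq_bigr do rewrite sqr_sqrtr//.
    exact: tail.
have {}key : b y <= Num.sqrt (b y) * (nm y * Num.sqrt e).
  apply/ler_addgt0Pl => r r0; have B1 : 0 < nm (B y) + 1 by rewrite ltr_wpDl ?nm_ge0.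
  apply: le_trans (key _ (divr_gt0 r0 B1)) _; rewrite lerD2r.
  by rewrite mulrCA ler_piMr ?(ltW r0)// ler_pdivrMr// mul1r lerDl.
have [bz|bn] := eqVneq (b y) 0; first by rewrite bz mulr_ge0 ?sqr_ge0 ?(ltW e0).
have bp : 0 < Num.sqrt (b y) by rewrite sqrtr_gt0 lt_neqAle eq_sym bn b0.
have : Num.sqrt (b y) <= nm y * Num.sqrt e.
  by rewrite -(ler_pM2l bp) -expr2 sqr_sqrtr.
rewrite -(@ler_pXn2r _ 2)// ?nnegrE ?mulr_ge0 ?nm_ge0 ?sqrtr_ge0//.
by rewrite exprMn !sqr_sqrtr ?(ltW e0)// mulrC.
Qed.

(** Finite trace makes the form of [A `^ p] small off finitely many directions,
    and [l ^+ 2 <= dl + c * l `^ p] on the spectrum carries this over to [A]. *)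
Lemma finite_trace_cpt A p : bounded_op A -> positive_op ip A -> 0 < p ->
  (op_trace ip (op_pow A p) < +oo)%E -> compact_op ip A.
Proof.
move=> AP Ap p0 fin e e0.
have BP := op_pow_bop ip_norm AP Ap (ltW p0); have Bp := op_pow_positive ip_norm AP Ap (ltW p0).
have Bf := op_powP ip_norm AP Ap (ltW p0); set B := op_pow A p in fin BP Bp Bf.
have [M M0 AM] := bop_bd AP.
pose dl := e ^+ 2 / 2; have d0 : 0 < dl by rewrite divr_gt0 ?exprn_gt0.
have sd0 : 0 < Num.sqrt dl by rewrite sqrtr_gt0.
pose c := M ^+ 2 / (Num.sqrt dl) `^ p.
have c0 : 0 <= c by rewrite divr_ge0 ?sqr_ge0 ?powR_ge0.
have AB x : nm (A x) ^+ 2 <= dl * nm x ^+ 2 + c * complex.Re (ip (B x) x).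
  (* the scalar inequality [0 <= dl - l ^+ 2 + c * l `^ p] on [[0, M]] *)
  have := @fun_calc_pos _ _ ip ip_norm A _ B (dl%:P - 'X^2) c M x AP Ap Bf M0 AM c0.
  rewrite op_polyB op_polyC op_polyX2 (sipBl ipP) (sipZl ipP) ReB ReZ Ap.1.
  have -> : complex.Re (ip x x) = nm x ^+ 2 by rewrite -(sq_nm ip_norm).
  have -> : complex.Re (ip (A x) (A x)) = nm (A x) ^+ 2 by rewrite -(sq_nm ip_norm).
  rewrite addrAC subr_ge0; apply => l /andP[l0 lM]; rewrite !hornerE.
  have [ld|dl'] := leP l (Num.sqrt dl).
    rewrite addr_ge0 ?mulr_ge0 ?powR_ge0// subr_ge0.
    by rewrite -[leRHS](sqr_sqrtr (ltW d0)) ler_pXn2r ?nnegrE ?sqrtr_ge0.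
  have : M ^+ 2 <= c * l `^ p.
    rewrite /c mulrAC ler_pdivlMr ?powR_gt0// ler_wpM2l ?sqr_ge0//.
    by rewrite ge0_ler_powR ?nnegrE ?sqrtr_ge0 ?(ltW p0)// ltW.
  have : l ^+ 2 <= M ^+ 2 by rewrite ler_pXn2r ?nnegrE.
  by move: (ltW d0); lra.
have c1 : 0 < c + 1 by rewrite ltr_wpDl.
have [s [so hs]] := finite_trace_small BP Bp fin (divr_gt0 d0 c1).
exists [seq (nm (A u))%:C *: u | u <- s] => x.
rewrite big_map; pose y := x - prj ip s x.
have yx : nm y <= nm x := nm_prj_res ip_norm x so.
have Ay : nm (A y) <= e * nm x.
  rewrite -(@ler_pXn2r _ 2)// ?nnegrE ?mulr_ge0 ?nm_ge0 ?(ltW e0)//.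
  apply: le_trans (AB y) _.
  have /(ler_wpM2l c0) : complex.Re (ip (B y) y) <= dl / (c + 1) * nm y ^+ 2.
    by apply: hs => u us; rewrite (sipBl ipP) (ip_prj ip_norm)// subrr.
  have cd : c * (dl / (c + 1)) <= dl.
    by rewrite mulrCA ler_piMr ?(ltW d0)// ler_pdivrMr// mul1r lerDl.
  have y2 : nm y ^+ 2 <= nm x ^+ 2 by rewrite ler_pXn2r ?nnegrE ?nm_ge0.
  have := ler_wpM2r (sqr_ge0 (nm y)) cd; rewrite -mulrA.
  have := ler_wpM2l (sqr_ge0 e) y2; rewrite exprMn /dl; lra.
have -> : A x = A y + \sum_(u <- s) ip x u *: A u.
  by rewrite -(prj_bop ip s x AP) -(bopD AP) subrK.
apply: le_trans (nmD _ _) _; rewrite lerD//; apply: le_trans (nm_sum _ _) _.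
apply: ler_sum => u _.
by rewrite nmZ (sipZr ipP) mdM conjc_real md_real ger0_norm ?nm_ge0// mulrC.
Qed.

End TraceClass.

(** * Singular values of column operators *)

Section ColumnOperators.
Context {R : realType} {H : completeNormedModType R[i]}.
Variable ip : {dot H for @conjC R[i]}.
Hypothesis ip_norm : forall x : H, ip x x = `|x| ^+ 2.
Variable d : nat.
Implicit Types (u v h : H) (x y z : 'I_d -> H) (a : R[i]) (e M c p : R) (s t : seq H).
Implicit Types (E : set H) (X : 'I_d -> H -> H).
Local Notation ipP := (ip_sip ip_norm).

Definition ipK x y : R[i] := \sum_(i < d) ip (x i) (y i).
Definition nK x : R := Num.sqrt (sq ipK x).
(** A family of operators seen as one operator into [d] copies of the space. *)
Definition column X u : 'I_d -> H := fun i => X i u.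

Lemma ipK_sip : sip ipK.
Proof.
split=> [a x y z|x y|x].
- rewrite /ipK mulr_sumr -big_split /=; apply: eq_bigr => i _; exact: (sip_lin ipP).
- by rewrite /ipK rmorph_sum /=; apply: eq_bigr => i _; rewrite (sip_sym ipP).
- by rewrite /ipK Re_sum; apply: sumr_ge0 => i _; apply: (sip_ge0 ipP).
Qed.
Local Notation ipKP := ipK_sip.

Lemma sqK x : sq ipK x = \sum_(i < d) nm (x i) ^+ 2.
Proof. by rewrite /sq /ipK Re_sum; apply: eq_bigr => i _; rewrite -(sq_nm ip_norm). Qed.

Lemma nK_ge0 x : 0 <= nK x. Proof. exact: sqrtr_ge0. Qed.
Lemma sqr_nK x : nK x ^+ 2 = sq ipK x.
Proof. by rewrite sqr_sqrtr// (sip_ge0 ipKP). Qed.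
Lemma ipK_CS x y : md (ipK x y) <= nK x * nK y.
Proof. exact: sip_CS_sqrt ipKP x y. Qed.

Lemma ap_lin X a u v : (forall i, bounded_op (X i)) -> column X (a *: u + v) = a *: column X u + column X v.
Proof. by move=> XP; apply/funext => i; rewrite /column (bop_lin (XP i)). Qed.

Lemma ipK_ap_prj X s u y : (forall i, bounded_op (X i)) ->
  ipK (column X (prj ip s u)) y = \sum_(h <- s) ip u h * ipK (column X h) y.
Proof.
move=> XP; rewrite /ipK /column.
under eq_bigr do rewrite (prj_bop ip s u (XP _)) (sip_suml ipP).
rewrite exchange_big /=; apply: eq_bigr => h _; rewrite mulr_sumr.
by apply: eq_bigr => i _; rewrite (sipZl ipP).
Qed.

Lemma ap_bound X : (forall i, bounded_op (X i)) ->
  exists2 c, 0 <= c & forall u, nK (column X u) <= c * nm u.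
Proof.
move=> XP.
have hM i : exists M, 0 <= M /\ forall u, nm (X i u) <= M * nm u.
  by have [M M0 XM] := bop_bd (XP i); exists M.
have [M MP] := choice hM.
exists (Num.sqrt (\sum_(i < d) M i ^+ 2)) => [|u]; first exact: sqrtr_ge0.
rewrite -(@ler_pXn2r _ 2)// ?nnegrE ?nK_ge0 ?mulr_ge0 ?sqrtr_ge0 ?nm_ge0//.
rewrite sqr_nK sqK exprMn sqr_sqrtr; last by apply: sumr_ge0 => i _; apply: sqr_ge0.
rewrite mulr_suml; apply: ler_sum => i _; have [Mi h] := MP i.
have Mu : 0 <= M i * nm u by rewrite mulr_ge0 ?nm_ge0.
by rewrite -exprMn ler_pXn2r ?nnegrE ?nm_ge0 ?h.
Qed.

Lemma adj_self_ip X u v : (forall i, bounded_op (X i)) ->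
  ip (sum_adj_self ip X u) v = ipK (column X u) (column X v).
Proof.
move=> XP; rewrite /sum_adj_self (sip_suml ipP); apply: eq_bigr => i _.
by rewrite -(adjointEr ip_norm _ _ (XP i)).
Qed.

Lemma adj_self_bop X : (forall i, bounded_op (X i)) -> bounded_op (sum_adj_self ip X).
Proof.
move=> XP; apply: (bop_bigsum _ (A := fun i : 'I_d => adjoint ip (X i) \o X i)) => i.
exact: bop_comp (adjoint_bop ip_norm (XP i)) (XP i).
Qed.

Lemma adj_self_positive X : (forall i, bounded_op (X i)) -> positive_op ip (sum_adj_self ip X).
Proof.
move=> XP; split=> [u v|u]; last by rewrite adj_self_ip// (sip_ge0 ipKP).
by rewrite adj_self_ip// (sip_sym ipKP) -adj_self_ip// -(sip_sym ipP).
Qed.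

(** Singular value decomposition of a compact column operator: on an
    eigenbasis of [X^* X] the values of [X] are orthogonal, and their norms are
    the singular values. *)
Lemma svd X p : (forall i, bounded_op (X i)) -> (forall i, compact_op ip (X i)) -> 0 <= p ->
  exists E, [/\ is_onb ip E,
    forall u v, E u -> E v -> u != v -> ipK (column X u) (column X v) = 0 &
    (sph_norm ip p X = (\esum_(u in E) (nK (column X u) `^ p)%:E) `^ p^-1)%E].
Proof.
move=> XP Xc p0; have AP := adj_self_bop XP; have Ap := adj_self_positive XP.
have Ac : compact_op ip (sum_adj_self ip X).
  apply: (cpt_bigsum _ (A := fun i : 'I_d => adjoint ip (X i) \o X i)) => i.
  exact: (@cpt_compl _ _ ip ip_norm (X i)) (adjoint_bop ip_norm (XP i)) (Xc i).
have [E [g [EP Ad g0]]] := spectral_theorem ip_norm AP Ac Ap.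
have ge u : E u -> nK (column X u) = g u `^ 2^-1.
  move=> Eu; rewrite powR12_sqrt ?g0// /nK /sq -adj_self_ip// Ad// (sipZl ipP).
  by rewrite (EP.1 u u)// (eqxx u) mulr1.
exists E; split=> //.
  move=> u v Eu Ev uv; rewrite -adj_self_ip// Ad// (sipZl ipP).
  by rewrite (EP.1 u v)// (negbTE uv) mulr0.
have h0 : 0 <= 2^-1 :> R by rewrite invr_ge0.
have [PP Pd] := op_pow_diag ip_norm EP AP Ad g0 h0.
have [BP Bd] := op_pow_diag ip_norm EP PP Pd (fun u _ => powR_ge0 _ _) p0.
rewrite /sph_norm /sph_abs (trace_diag ip_norm EP BP Bd (fun u _ => powR_ge0 _ _)).
by congr (_ `^ _)%E; apply: eq_esum => u Eu; rewrite ge.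
Qed.

Definition orthonormalK s (f : H -> 'I_d -> H) :=
  forall u v, u \in s -> v \in s -> ipK (f u) (f v) = (u == v)%:R.

(** The variational form of [\sum_j s_j(X)^p <= S], for the singular values
    [s_j(X)]: all the norm inequalities are proved in this form. *)
Definition schatten_le p X (S : R) := forall s (f : H -> 'I_d -> H), orthonormal ip s -> orthonormalK s f ->
  \sum_(u <- s) md (ipK (column X u) (f u)) `^ p <= S.

(** The condition is that the squares of the [L r] sum to at most the identity,
    as for the coefficients of a Schur multiplier with unit diagonal. *)
Definition subpartition N (L : nat -> H -> H) :=
  [/\ forall r, bounded_op (L r), forall r u v, ip (L r u) v = ip u (L r v)
    & forall u, \sum_(r < N) nm (L r u) ^+ 2 <= nm u ^+ 2].

Lemma subpartitionK N L x : subpartition N L ->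
  \sum_(r < N) sq ipK (L r \o x) <= sq ipK x.
Proof.
move=> [_ _ hL]; under eq_bigr do rewrite sqK.
by rewrite exchange_big /= sqK; apply: ler_sum => i _; apply: hL.
Qed.

Lemma nK_comp N L r x : subpartition N L -> (r < N)%N -> nK (L r \o x) <= nK x.
Proof.
move=> hL rN; rewrite -(@ler_pXn2r _ 2)// ?nnegrE ?nK_ge0// !sqr_nK.
apply: le_trans (subpartitionK x hL); rewrite (bigD1 (Ordinal rN)) //= lerDl.
by apply: sumr_ge0 => i _; apply: (sip_ge0 ipKP).
Qed.

(** Key estimate. If [X h_j = s_j w_j] is a singular value decomposition, then
    [\sum_r |<X R_r e_k, L_r f_k>| <= \sum_j D_kj s_j] for the kernel
    [D_kj = \sum_r (|<R_r e_k, h_j>|^2 + |<w_j, L_r f_k>|^2) / 2], which is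
    doubly substochastic by Bessel's inequality. *)
Lemma svd_lower X p E S N (Rr Lr : nat -> H -> H) s f :
  (forall i, bounded_op (X i)) -> 1 <= p -> is_onb ip E ->
  (forall u v, E u -> E v -> u != v -> ipK (column X u) (column X v) = 0) ->
  (\esum_(u in E) (nK (column X u) `^ p)%:E <= S%:E)%E ->
  subpartition N Rr -> subpartition N Lr -> orthonormal ip s -> orthonormalK s f ->
  \sum_(u <- s) (\sum_(r < N) md (ipK (column X (Rr r u)) (Lr r \o f u))) `^ p <= S.
Proof.
move=> XP p1 EP XE XS RP LP so fo.
have [Rb Rs Rn] := RP; have [Lb Ls Ln] := LP.
have S0 : 0 <= S.
  rewrite -lee_fin; apply: le_trans XS; apply: esum_ge0 => u _.
  by rewrite lee_fin powR_ge0.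
have [c c0 Xc] := ap_bound XP.
have fu u : u \in s -> sq ipK (f u) = 1.
  by move=> us; rewrite /sq fo// (eqxx u).
have su u : u \in s -> nm u = 1 by move=> us; apply: (onset_nm ip_norm so.2).
apply: powR_sum_closure => // [u us|e e0].
  by apply: sumr_ge0 => r _; apply: md_ge0.
pose K := N%:R * c + 1; have K0 : 0 < K by rewrite /K ltr_wpDl// mulr_ge0.
(* finite expansions of all the vectors involved, with error [e / K] *)
have [t [tons tE tx]] := onb_approx ip_norm
  [seq Rr r u | u <- s, r <- iota 0 N] EP (divr_gt0 e0 K0).
pose a h := nK (column X h).
pose w h : 'I_d -> H := (a h)^-1%:C *: column X h.
(* [w h] is [X h] normalized, or zero when [X h] is zero *)
have wE h z : md (ipK (column X h) z) = a h * md (ipK (w h) z).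
  have [a0|an] := eqVneq (a h) 0.
    apply/eqP; rewrite eq_le a0 mul0r md_ge0 andbT.
    by have := ipK_CS (column X h) z; rewrite -/(a h) a0 mul0r.
  rewrite /w (sipZl ipKP) mdM md_real ger0_norm ?invr_ge0 ?nK_ge0//.
  by rewrite mulrA divff// mul1r.
have w1 h : sq ipK (w h) <= 1.
  rewrite (sqZ ipKP) md_real real_normK ?num_real// -sqr_nK -/(a h) -exprMn.
  by have [->|an] := eqVneq (a h) 0; [rewrite mulr0 expr0n|rewrite mulVf// expr1n].
have wo h k : h \in t -> k \in t -> h != k -> ipK (w h) (w k) = 0.
  move=> ht kt hk; rewrite (sipZl ipKP) (sipZr ipKP) XE ?mulr0//; exact: tE.
pose al u r h := md (ip (Rr r u) h); pose be u r h := md (ipK (w h) (Lr r \o f u)).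
pose D u h := \sum_(r < N) (2^-1 * (al u r h ^+ 2 + be u r h ^+ 2)).
exists (fun u => \sum_(r < N) \sum_(h <- t) al u r h * (a h * be u r h)).
have y0 u : 0 <= \sum_(r < N) \sum_(h <- t) al u r h * (a h * be u r h).
  by apply: sumr_ge0 => r _; apply: sumr_ge0 => h _; rewrite !mulr_ge0 ?md_ge0 ?nK_ge0.
split=> // [u us|].
  apply: (@le_trans _ _ (\sum_(r < N) (c * (e / K) + \sum_(h <- t) al u r h * (a h * be u r h)))).
    apply: ler_sum => r _; set z := Rr r u.
    have zt : nm (z - prj ip t z) <= e / K.
      by apply: tx; apply/allpairsP; exists (u, (r : nat)); split=> //=; rewrite mem_iota /= add0n.
    rewrite -[z in column X z](subrK (prj ip t z)).
    have -> : ipK (column X (z - prj ip t z + prj ip t z)) (Lr r \o f u) =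
        ipK (column X (z - prj ip t z)) (Lr r \o f u) + ipK (column X (prj ip t z)) (Lr r \o f u).
      by rewrite -[X in column _ (X + _)]scale1r ap_lin// (sip_lin ipKP) mul1r.
    apply: le_trans (mdD _ _) _; rewrite lerD//.
      apply: le_trans (ipK_CS _ _) _; rewrite -[leRHS]mulr1.
      apply: ler_pM; rewrite ?nK_ge0//.
        by apply: le_trans (Xc _) _; rewrite ler_wpM2l.
      apply: le_trans (nK_comp _ LP (ltn_ord r)) _.
      by rewrite /nK fu// sqrtr1.
    rewrite ipK_ap_prj//; apply: le_trans (md_sum _ _) _.
    by apply: ler_sum => h _; rewrite mdM wE.
  rewrite big_split /= lerD2r sumr_const card_ord -mulr_natl mulrA.
  rewrite mulrCA ler_piMr ?(ltW e0)// ler_pdivrMr// mul1r.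
  by rewrite /K lerDl.
apply: (@le_trans _ _ (\sum_(h <- t) a h `^ p)); last first.
  rewrite -lee_fin; apply: le_trans XS; apply: esum_ge_seq => //; by case: tons.
apply: (@powR_substochastic _ _ _ _ s t D a) => //.
- by move=> u h _ _; apply: sumr_ge0 => r _; rewrite mulr_ge0 ?addr_ge0 ?sqr_ge0.
- by move=> h _; apply: nK_ge0.
- move=> u us; rewrite /D exchange_big /=.
  apply: (@le_trans _ _ (\sum_(r < N) 2^-1 * (nm (Rr r u) ^+ 2 + sq ipK (Lr r \o f u)))).
    apply: ler_sum => r _; rewrite -mulr_sumr ler_wpM2l// big_split /= lerD//.
      exact: bessel_ons.
    under eq_bigr do rewrite /be (md_sip_sym ipKP).
    by apply: (bessel ipKP) => //; case: tons.
  rewrite -mulr_sumr big_split /=.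
  have := Rn u; have := subpartitionK (f u) LP; rewrite fu// su// expr1n; lra.
- move=> h ht; rewrite /D exchange_big /=.
  apply: (@le_trans _ _ (\sum_(r < N) 2^-1 * (nm (Rr r h) ^+ 2 + sq ipK (Lr r \o w h)))).
    apply: ler_sum => r _; rewrite -mulr_sumr ler_wpM2l// big_split /= lerD//.
      under eq_bigr do rewrite /al Rs (md_sip_sym ipP).
      exact: bessel_ons.
    have bE u : be u r h = md (ipK (Lr r \o w h) (f u)).
      by congr md; rewrite /ipK; apply: eq_bigr => i _; rewrite /= Ls.
    under eq_bigr do rewrite bE.
    apply: (bessel ipKP); first by case: so.
      by move=> u v us vs uv; rewrite fo// (negbTE uv).
    by move=> u us; rewrite fu.
  rewrite -mulr_sumr big_split /=.
  have := Rn h; have := subpartitionK (w h) LP; have := w1 h.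
  rewrite (onset_nm ip_norm EP.1 (tE h ht)) expr1n; lra.
- move=> u us; rewrite y0 /=; rewrite exchange_big /=; apply: ler_sum => h _.
  rewrite /D mulr_suml; apply: ler_sum => r _.
  rewrite mulrCA mulrC ler_wpM2r ?nK_ge0//.
  have : 0 <= (al u r h - be u r h) ^+ 2 by apply: sqr_ge0.
  by rewrite sqrrB; lra.
Qed.

Lemma poweR_le_fin (S : \bar R) p (N : R) : 0 < p -> 0 <= N -> (0 <= S)%E ->
  (S `^ p^-1 <= N%:E)%E = (S <= (N `^ p)%:E)%E.
Proof.
move=> p0 N0; case: S => [r| |] //.
  rewrite lee_fin => r0; rewrite poweR_EFin !lee_fin.
  have -> : (r <= N `^ p) = (r <= N `^ (p^-1)^-1) by rewrite invrK.
  by rewrite powRV_le ?invr_gt0.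
by move=> _; rewrite poweRyr ?invr_eq0 ?gt_eqF// !leNgt !ltry.
Qed.

Lemma id_subpartition : subpartition 1 (fun=> id).
Proof. by split=> // [_|u]; [exact: bop_id|rewrite big_ord1]. Qed.

(** The families [Rr] and [Lr] act as a Schur multiplier, and the bound says that
    it does not increase the norm. *)
Lemma sch_family X p N0 N (Rr Lr : nat -> H -> H) s f :
  (forall i, bounded_op (X i)) -> (forall i, compact_op ip (X i)) -> 1 <= p -> 0 <= N0 ->
  (sph_norm ip p X <= N0%:E)%E ->
  subpartition N Rr -> subpartition N Lr -> orthonormal ip s -> orthonormalK s f ->
  \sum_(u <- s) (\sum_(r < N) md (ipK (column X (Rr r u)) (Lr r \o f u))) `^ p <= N0 `^ p.
Proof.
move=> XP Xc p1 N00 XN; have p0 : 0 < p by apply: lt_le_trans p1.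
have [E [EP XE nE]] := svd XP Xc (ltW p0).
apply: svd_lower XP p1 EP XE _.
rewrite -poweR_le_fin//; first by rewrite -nE.
by apply: esum_ge0 => u _; rewrite lee_fin powR_ge0.
Qed.

(** From right to left, test on the eigenbasis with [f u] the normalized value of
    [X] at [u]; the vectors killed by [X] are discarded first. *)
Lemma sph_normP X p N : (forall i, bounded_op (X i)) -> (forall i, compact_op ip (X i)) ->
  1 <= p -> 0 <= N -> ((sph_norm ip p X <= N%:E)%E <-> schatten_le p X (N `^ p)).
Proof.
move=> XP Xc p1 N0; have p0 : 0 < p by apply: lt_le_trans p1.
split=> [XN s f so fo|Xs].
  have := sch_family XP Xc p1 N0 XN id_subpartition id_subpartition so fo.
  by under eq_bigr do rewrite big_ord1.
have [E [EP XE ->]] := svd XP Xc (ltW p0).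
rewrite poweR_le_fin//; last by apply: esum_ge0 => u _; rewrite lee_fin powR_ge0.
apply: esum_le_seq => s us sE; rewrite lee_fin.
pose t := [seq u <- s | nK (column X u) != 0].
have -> : \sum_(u <- s) nK (column X u) `^ p = \sum_(u <- t) nK (column X u) `^ p.
  rewrite (bigID (fun u => nK (column X u) != 0)) /= [X in _ + X]big1 ?addr0 ?big_filter//.
  by move=> u /negPn/eqP ->; rewrite powR0 ?gt_eqF.
pose f u : 'I_d -> H := (nK (column X u))^-1%:C *: column X u.
have tE u : u \in t -> E u by rewrite mem_filter => /andP[_ /sE].
have tn u : u \in t -> nK (column X u) != 0 by rewrite mem_filter => /andP[].
have ut : uniq t by rewrite filter_uniq.
have fE u : u \in t -> ipK (column X u) (f u) = (nK (column X u))%:C.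
  move=> /tn un; rewrite (sipZr ipKP) conjc_real (sipxx ipKP) -sqr_nK -rmorphM /=.
  by rewrite expr2 mulrA mulVf// mul1r.
have fo : orthonormalK t f.
  move=> u v ut' vt; rewrite /f (sipZl ipKP) -/(f v); have [<-|uv] := eqVneq u v.
    by rewrite fE// -rmorphM /= mulVf ?tn.
  by rewrite (sipZr ipKP) XE ?mulr0//; apply: tE.
have := Xs t f (onset_ons EP.1 ut tE) fo; apply: le_trans.
apply: ler_sum_seq => u ut'; rewrite fE// md_real ger0_norm//; exact: nK_ge0.
Qed.

End ColumnOperators.

(** * The operator arithmetic-geometric mean inequality *)

Section ArithmeticGeometricMean.
Context {R : realType} {H : completeNormedModType R[i]}.
Variable ip : {dot H for @conjC R[i]}.
Hypothesis ip_norm : forall x : H, ip x x = `|x| ^+ 2.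
Variable d : nat.
Implicit Types (u v h : H) (e M c p : R) (s t : seq H) (E : set H).
Local Notation ipP := (ip_sip ip_norm).

(** With [a = tan (theta / 2)], these are the cosine and the sine of [theta];
    [cayley a] is also the Cayley transform of [a ^+ 2]. *)
Definition cayley (a : R) : R := (1 - a ^+ 2) / (1 + a ^+ 2).
Definition cayley_sin (a : R) : R := 2 * a / (1 + a ^+ 2).

Lemma one_sqr_gt0 (a : R) : 0 < 1 + a ^+ 2.
Proof. by rewrite ltr_pwDl ?sqr_ge0. Qed.

Lemma cayley_sin2 a : cayley_sin a ^+ 2 = 1 - cayley a ^+ 2.
Proof. by rewrite /cayley_sin /cayley; field; rewrite gt_eqF ?one_sqr_gt0. Qed.

Lemma cayley_le1 a : `|cayley a| <= 1.
Proof.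
rewrite -(@ler_pXn2r _ 2)// ?nnegrE// expr1n real_normK ?num_real//.
by rewrite -subr_ge0 -cayley_sin2 sqr_ge0.
Qed.

Lemma cayley_sin_le1 a : `|cayley_sin a| <= 1.
Proof.
rewrite -(@ler_pXn2r _ 2)// ?nnegrE// expr1n real_normK ?num_real//.
by rewrite cayley_sin2 gerBl sqr_ge0.
Qed.

Lemma cayley_lt1 a : a != 0 -> `|cayley a| < 1.
Proof.
move=> a0; rewrite -(@ltr_pXn2r _ 2)// ?nnegrE// expr1n real_normK ?num_real//.
rewrite -subr_gt0 -cayley_sin2 exprn_even_gt0//= /cayley_sin.
by rewrite !mulf_neq0 ?pnatr_eq0// invr_eq0 gt_eqF ?one_sqr_gt0.
Qed.

Lemma cayley_pow_cvg0 a e : 0 < e -> exists N, forall n, (N <= n)%N ->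
  `|a * cayley a ^+ n| <= e.
Proof.
move=> e0; have [->|a0] := eqVneq a 0.
  by exists 0%N => n _; rewrite mul0r normr0 ltW.
have an : 0 < `|a| by rewrite normr_gt0.
have := cvg_expr (cayley_lt1 a0).
move=> /(@pseudometric_normed_Zmodule.cvgr_dist_le _ _ _ _ _ _ _) /(_ _ (divr_gt0 e0 an)).
move=> [N _ hN]; exists N => n Nn; rewrite normrM mulrC -ler_pdivlMr//.
by have := hN n Nn; rewrite /= sub0r normrN.
Qed.

(** The Gram decomposition of the kernel [2 a b / (a^2 + b^2)]: a geometric
    series in the product of the two Cayley transforms. *)
Lemma cayley_series (a b : R) N :
  \sum_(r < N) (cayley_sin a * cayley a ^+ r) * (cayley_sin b * cayley b ^+ r)
      * ((a ^+ 2 + b ^+ 2) / 2)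
  = a * b - (a * cayley a ^+ N) * (b * cayley b ^+ N).
Proof.
elim: N => [|N IH]; first by rewrite big_ord0 !expr0 !mulr1 subrr.
rewrite big_ord_recr /= IH !exprSr.
set x := cayley a ^+ N; set y := cayley b ^+ N.
rewrite /cayley_sin /cayley; field.
by rewrite !gt_eqF ?one_sqr_gt0.
Qed.

Lemma cayley_sum (a : R) N :
  \sum_(r < N) (cayley_sin a * cayley a ^+ r) ^+ 2 = 1 - cayley a ^+ N ^+ 2.
Proof.
elim: N => [|N IH]; first by rewrite big_ord0 expr0 expr1n subrr.
by rewrite big_ord_recr /= IH [(cayley_sin a * _) ^+ 2]exprMn cayley_sin2 [cayley a ^+ N.+1]exprSr;
  set y := cayley a ^+ N; ring.
Qed.

(** The identity cos^2 + sin^2 = 1 makes the squares telescope. *)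
Lemma cayley_subpartition E (g : H -> R) : is_onb ip E ->
  exists L : nat -> H -> H, (forall r, diag E (fun u => cayley_sin (g u) * cayley (g u) ^+ r) (L r)) /\
    forall N, subpartition ip N L.
Proof.
move=> EP.
have ex r : exists L, bounded_op L /\ diag E (fun u => cayley_sin (g u) * cayley (g u) ^+ r) L.
  apply: (diag_exists ip_norm (M := 1) EP) => u _.
  by rewrite normrM normrX mulr_ile1 ?exprn_ile1 ?cayley_sin_le1 ?cayley_le1.
have [L LP] := choice ex.
exists L; split=> [r|N]; first by have [] := LP r.
split=> [r|r u v|x]; first by have [] := LP r.
  by have [Lb Ld] := LP r; apply: (diag_selfadj ip_norm u v EP Lb Ld).
rewrite -lee_fin -(parseval ip_norm x EP) -sumEFin.
have -> : (\sum_(r < N) (nm (L r x) ^+ 2)%:E =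
    \sum_(r < N) \esum_(u in E) (md (ip (L r x) u) ^+ 2)%:E)%E.
  by apply: eq_bigr => r _; rewrite (parseval ip_norm _ EP).
rewrite -esum_sum; last by move=> u r _ _; rewrite lee_fin sqr_ge0.
apply: le_esum => u Eu; rewrite sumEFin lee_fin.
have -> : \sum_(r < N) md (ip (L r x) u) ^+ 2 =
    (\sum_(r < N) (cayley_sin (g u) * cayley (g u) ^+ r) ^+ 2) * md (ip x u) ^+ 2.
  rewrite mulr_suml; apply: eq_bigr => r _; have [Lb Ld] := LP r.
  by rewrite (diag_coef ip_norm x EP Lb Ld Eu) mdM md_real exprMn real_normK ?num_real.
by rewrite cayley_sum ler_piMl ?sqr_ge0// gerBl sqr_ge0.
Qed.

(** The operator arithmetic-geometric mean inequality
    [|| A Y B ||_p <= || (A^2 Y + Y B^2) / 2 ||_p]. In the eigenbasis, the left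
    side is the Schur product of the right side with the kernel
    [2 a b / (a^2 + b^2)]. *)
Lemma operator_amgm E (a b : H -> R) (A B : H -> H) (Y Z : 'I_d -> H -> H) M p N0 :
  is_onb ip E -> bounded_op A -> bounded_op B -> diag E a A -> diag E b B ->
  (forall u, E u -> `|b u| <= M) ->
  (forall i, bounded_op (Y i)) -> (forall i, bounded_op (Z i)) -> (forall i, compact_op ip (Z i)) ->
  (forall i u, E u -> Z i u = (2^-1)%:C *: (A (A (Y i u)) + Y i (B (B u)))) ->
  1 <= p -> 0 <= N0 -> (sph_norm ip p Z <= N0%:E)%E ->
  schatten_le ip p (fun i => A \o Y i \o B) (N0 `^ p).
Proof.
move=> EP AP BP Ad Bd bM YP ZP Zc ZE p1 N00 ZN s f so fo.
have [Lr [Ld LP]] := cayley_subpartition a EP.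
have [Rr [Rd RP]] := cayley_subpartition b EP.
have exG r : exists G, bounded_op G /\ diag E (fun u => b u * cayley (b u) ^+ r) G.
  apply: (diag_exists ip_norm (M := M) EP) => u Eu.
  by rewrite normrM normrX (le_trans _ (bM u Eu))// ler_piMr// exprn_ile1 ?cayley_le1.
have [G GP] := choice exG.
have [MA MA0 AM] := bop_bd AP.
have exF r : exists F, bounded_op F /\ diag E (fun u => a u * cayley (a u) ^+ r) F.
  apply: (diag_exists ip_norm (M := MA) EP) => u Eu.
  have aM := diag_le ip_norm EP Ad AM Eu.
  by rewrite normrM normrX (le_trans _ aM)// ler_piMr// exprn_ile1 ?cayley_le1.
have [F FP] := choice exF.
have FM r x : nm (F r x) <= MA * nm x.
  have [Fb Fd] := FP r; apply: (diag_bound ip_norm EP Fb Fd MA0) => u Eu.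
  have aM := diag_le ip_norm EP Ad AM Eu.
  by rewrite normrM normrX (le_trans _ aM)// ler_piMr// exprn_ile1 ?cayley_le1.
pose W i := A \o Y i \o B.
(* matrix coefficients in the eigenbasis reduce this to [cayley_series] *)
have WE N i x : W i x = \sum_(r < N) Lr r (Z i (Rr r x)) + F N (Y i (G N x)).
  have [Gb Gd] := GP N; have [Fb Fd] := FP N.
  have Lb r : bounded_op (Lr r) by have [] := LP 0%N.
  have Rb r : bounded_op (Rr r) by have [] := RP 0%N.
  apply: (bop_ext ip_norm EP (B := fun x => \sum_(r < N) Lr r (Z i (Rr r x)) + F N (Y i (G N x)))).
  - exact: bop_comp (bop_comp AP (YP i)) BP.
  - apply: bop_add; last exact: bop_comp Fb (bop_comp (YP i) Gb).
    apply: (bop_bigsum _ (A := fun r : 'I_N => Lr r \o (Z i \o Rr r))) => r.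
    exact: bop_comp (Lb r) (bop_comp (ZP i) (Rb r)).
  move=> u Eu; apply: (coef_inj ip_norm EP) => v Ev; rewrite /W /=.
  rewrite (diag_coef ip_norm _ EP AP Ad Ev) (Bd u Eu) (bopZ (YP i)) (sipZl ipP).
  rewrite (sipDl ipP) (diag_coef ip_norm _ EP Fb Fd Ev) (Gd u Eu) (bopZ (YP i)) (sipZl ipP).
  set y := ip (Y i u) v.
  have -> : ip (\sum_(r < N) Lr r (Z i (Rr r u))) v =
     (\sum_(r < N) (cayley_sin (a v) * cayley (a v) ^+ r) * (cayley_sin (b u) * cayley (b u) ^+ r)
      * ((a v ^+ 2 + b u ^+ 2) / 2))%:C * y.
    rewrite (sip_suml ipP) rmorph_sum /= mulr_suml; apply: eq_bigr => r _.
    rewrite (diag_coef ip_norm _ EP (Lb r) (Ld r) Ev) (Rd r u Eu) (bopZ (ZP i)) ZE//.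
    rewrite !(sipZl ipP) (sipDl ipP) !(diag_coef ip_norm _ EP AP Ad Ev).
    rewrite (Bd u Eu) (bopZ BP) (Bd u Eu) !(bopZ (YP i)) !(sipZl ipP) -/y.
    by rewrite !rmorphM !rmorphD /= !rmorphXn /=; ring.
  by rewrite cayley_series rmorphB !rmorphM /=; ring.
apply: powR_sum_closure => //; first exact: powR_ge0.
  by move=> u _; apply: md_ge0.
move=> e e0.
have fn u : u \in s -> nK ip (f u) = 1.
  by move=> us; rewrite /nK /sq fo// (eqxx u) sqrtr1.
(* a common number of terms for which the remainder is small on [s] *)
have [c c0 Yc] := ap_bound ip_norm YP.
pose K := MA * c + 1; have K0 : 0 < K by rewrite /K ltr_wpDl// mulr_ge0.
have [N hN] : exists N, forall n, (N <= n)%N -> forall u, u \in s -> nm (G n u) <= e / K.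
  elim: (s) => [|u t [N1 h1]]; first by exists 0%N.
  have [v _|r v Ev|v _ r r0|N2 h2] := @diag_strong_cvg _ _ ip ip_norm E
    (fun r u => b u * cayley (b u) ^+ r) (fun=> 0) G (fun=> 0) M u EP
    (fun r => (GP r).1) (fun r => (GP r).2) bop_cst0 _ _ _ (e / K) (divr_gt0 e0 K0).
  - by rewrite scale0r.
  - rewrite subr0 normrM normrX (le_trans _ (bM v Ev))// ler_piMr//.
    by rewrite exprn_ile1 ?cayley_le1.
  - have [N2 h2] := cayley_pow_cvg0 (b v) r0; exists N2 => n Nn; rewrite subr0; exact: h2.
  exists (maxn N1 N2) => n; rewrite geq_max => /andP[n1 n2] v; rewrite inE => /predU1P[->|].
    by have := h2 n n2; rewrite subr0.
  exact: h1.
exists (fun u => \sum_(r < N) md (ipK ip (column Z (Rr r u)) (Lr r \o f u))); split.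
- by move=> u _; apply: sumr_ge0 => r _; apply: md_ge0.
- move=> u us.
  have -> : ipK ip (column W u) (f u) = \sum_(r < N) ipK ip (column Z (Rr r u)) (Lr r \o f u)
      + ipK ip (fun i => F N (Y i (G N u))) (f u).
    rewrite /ipK exchange_big -big_split /=; apply: eq_bigr => i _.
    rewrite /column (WE N) (sipDl ipP) (sip_suml ipP); congr (_ + _).
    by apply: eq_bigr => r _; have [_ -> _] := LP 0%N.
  apply: le_trans (mdD _ _) _; rewrite addrC lerD//; last exact: md_sum.
  apply: le_trans (ipK_CS ip_norm _ _) _; rewrite fn// mulr1.
  have FK x : nK ip (F N \o x) <= MA * nK ip (x : 'I_d -> H).
    rewrite -(@ler_pXn2r _ 2)// ?nnegrE ?nK_ge0 ?mulr_ge0 ?nK_ge0//.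
    rewrite exprMn !(sqr_nK ip_norm) !(sqK ip_norm) mulr_sumr; apply: ler_sum => i _.
    by rewrite -exprMn ler_pXn2r ?nnegrE ?nm_ge0 ?mulr_ge0 ?nm_ge0 ?FM.
  apply: le_trans (FK (column Y (G N u))) _.
  apply: (@le_trans _ _ (MA * (c * (e / K)))).
    rewrite ler_wpM2l//; apply: le_trans (Yc _) _; rewrite ler_wpM2l//.
    exact: hN.
  rewrite mulrA mulrCA ler_piMr ?(ltW e0)// ler_pdivrMr// mul1r /K lerDl//.
- exact: (sch_family ip_norm ZP Zc p1 N00 ZN (RP N) (LP N) so fo).
Qed.

End ArithmeticGeometricMean.

(** * The triangle inequality, and powers of a compact positive operator *)

Section SphericalTransforms.
Context {R : realType} {H : completeNormedModType R[i]}.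
Variable ip : {dot H for @conjC R[i]}.
Hypothesis ip_norm : forall x : H, ip x x = `|x| ^+ 2.
Implicit Types (u v h x y z : H) (e M c : R) (E : set H).
Local Notation ipP := (ip_sip ip_norm).

(** Coefficientwise, [B x] is bounded by [e x + c P x]. *)
Lemma cpt_dominated E (g lam : H -> R) (B P : H -> H) : is_onb ip E -> bounded_op B -> bounded_op P ->
  diag E g B -> diag E lam P -> (forall u, E u -> 0 <= lam u) -> compact_op ip P ->
  (forall e, 0 < e -> exists2 c, 0 <= c & forall u, E u -> `|g u| <= e + c * lam u) ->
  compact_op ip B.
Proof.
move=> EP BP PP Bd Pd lam0 Pc h e e0; have e2 : 0 < e / 2 by rewrite divr_gt0.
have [c c0 gc] := h _ e2; have c1 : 0 < c + 1 by rewrite ltr_wpDl.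
have [s sP] := Pc _ (divr_gt0 e2 c1).
exists [seq c%:C *: u | u <- s] => x; rewrite big_map.
pose z := (e / 2)%:C *: x + c%:C *: P x.
have Bz : nm (B x) <= 1 * nm z.
  apply: (coef_bound ip_norm EP) => // u Eu; rewrite mul1r.
  rewrite (diag_coef ip_norm x EP BP Bd Eu) (sipDl ipP) !(sipZl ipP).
  rewrite (diag_coef ip_norm x EP PP Pd Eu) mulrA -mulrDl -rmorphM -rmorphD /=.
  rewrite !mdM !md_real ler_wpM2r ?md_ge0//.
  rewrite [leRHS]ger0_norm ?gc// addr_ge0 ?(ltW e2)// mulr_ge0// lam0//.
rewrite mul1r in Bz; apply: le_trans Bz _; apply: le_trans (nmD _ _) _.
rewrite !nmZ !md_real !ger0_norm ?(ltW e2)//.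
have -> : \sum_(u <- s) md (ip x (c%:C *: u)) = c * \sum_(u <- s) md (ip x u).
  rewrite mulr_sumr; apply: eq_bigr => u _.
  by rewrite (sipZr ipP) mdM conjc_real md_real ger0_norm.
apply: le_trans (lerD (lexx _) (ler_wpM2l c0 (sP x))) _.
have : c * (e / 2 / (c + 1) * nm x) <= e / 2 * nm x.
  rewrite mulrA ler_wpM2r ?nm_ge0// mulrCA ler_piMr ?(ltW e2)//.
  by rewrite ler_pdivrMr// mul1r lerDl.
rewrite mulrDr; lra.
Qed.

Variable d : nat.

(** Minkowski's inequality applied to each finite sum of matrix coefficients. *)
Lemma sph_norm_triangle (X Y : 'I_d -> H -> H) (a b c1 c2 p : R) :
  (forall i, bounded_op (X i)) -> (forall i, bounded_op (Y i)) ->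
  (forall i, compact_op ip (X i)) -> (forall i, compact_op ip (Y i)) ->
  1 <= p -> 0 <= a -> 0 <= b -> 0 <= c1 -> 0 <= c2 ->
  (sph_norm ip p X <= a%:E)%E -> (sph_norm ip p Y <= b%:E)%E ->
  [/\ forall i, bounded_op (fun x => 2^-1 *: (c1%:C *: X i x + c2%:C *: Y i x)),
      forall i, compact_op ip (fun x => 2^-1 *: (c1%:C *: X i x + c2%:C *: Y i x)) &
      (sph_norm ip p (fun i x => 2^-1 *: (c1%:C *: X i x + c2%:C *: Y i x))
        <= ((c1 * a + c2 * b) / 2)%:E)%E].
Proof.
move=> Xb Yb Xc Yc p1 a0 b0 c10 c20 Xa Yb'.
have Zb i : bounded_op (fun x => 2^-1 *: (c1%:C *: X i x + c2%:C *: Y i x)).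
  by apply: bop_scale; apply: bop_add; apply: bop_scale.
have Zc i : compact_op ip (fun x => 2^-1 *: (c1%:C *: X i x + c2%:C *: Y i x)).
  by do ?[apply: (cpt_scale ip_norm)|apply: cpt_add].
split=> //.
have N0 : 0 <= (c1 * a + c2 * b) / 2 by rewrite divr_ge0// addr_ge0// mulr_ge0.
apply/(sph_normP ip_norm Zb Zc p1 N0) => s f so fo.
have hX := (sph_normP ip_norm Xb Xc p1 a0).1 Xa s f so fo.
have hY := (sph_normP ip_norm Yb Yc p1 b0).1 Yb' s f so fo.
have scale (c q : R) (F : H -> R) : 0 <= c -> 0 <= q -> (forall u, 0 <= F u) ->
    \sum_(u <- s) F u `^ p <= q `^ p -> \sum_(u <- s) (c * F u) `^ p <= (c * q) `^ p.
  move=> c0 q0 F0 h; rewrite powRM//.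
  under eq_bigr do rewrite powRM//.
  by rewrite -mulr_sumr ler_wpM2l ?powR_ge0.
have h1 : 0 <= c1 / 2 by rewrite divr_ge0.
have h2 : 0 <= c2 / 2 by rewrite divr_ge0.
have {}hX := scale (c1 / 2) a _ h1 a0 (fun u => md_ge0 _) hX.
have {}hY := scale (c2 / 2) b _ h2 b0 (fun u => md_ge0 _) hY.
have -> : (c1 * a + c2 * b) / 2 = c1 / 2 * a + c2 / 2 * b by ring.
apply: le_trans (powR_minkowski p1 _ _ _ _ hX hY); rewrite ?mulr_ge0//.
- apply: ler_sum => u _; rewrite ge0_ler_powR ?nnegrE ?md_ge0 ?addr_ge0 ?mulr_ge0 ?md_ge0 ?(le_trans ler01 p1)//.
  have -> : ipK ip (column (fun i x => 2^-1 *: (c1%:C *: X i x + c2%:C *: Y i x)) u) (f u)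
    = (c1 / 2)%:C * ipK ip (column X u) (f u) + (c2 / 2)%:C * ipK ip (column Y u) (f u).
    rewrite /ipK !mulr_sumr -big_split /=; apply: eq_bigr => i _.
    rewrite /column (sipZl ipP) (sipDl ipP) !(sipZl ipP) !rmorphM /= fmorphV rmorph_nat; ring.
  by apply: le_trans (mdD _ _) _; rewrite !mdM !md_real !ger0_norm.
- by move=> u _; rewrite mulr_ge0 ?md_ge0.
- by move=> u _; rewrite mulr_ge0 ?md_ge0.
Qed.

Section Powers.
Variables (E : set H) (lam : H -> R) (P : H -> H).
Hypotheses (EP : is_onb ip E) (PP : bounded_op P) (Pd : diag E lam P).
Hypotheses (lam0 : forall u, E u -> 0 <= lam u) (Pc : compact_op ip P).
Implicit Types (s t : R).

Lemma pow_bop t : 0 <= t -> bounded_op (op_pow P t).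
Proof. by move=> t0; have [] := op_pow_diag ip_norm EP PP Pd lam0 t0. Qed.
Lemma pow_diag t : 0 <= t -> diag E (fun u => lam u `^ t) (op_pow P t).
Proof. by move=> t0; have [] := op_pow_diag ip_norm EP PP Pd lam0 t0. Qed.

Lemma pow1 x : op_pow P 1 x = P x.
Proof.
apply: (bop_ext ip_norm EP (pow_bop ler01) PP) => u Eu.
by rewrite (pow_diag ler01 Eu) Pd// powRr1 ?lam0.
Qed.

Lemma pow0 x : op_pow P 0 x = x.
Proof.
apply: (bop_ext ip_norm EP (pow_bop (lexx 0)) bop_id) => u Eu.
by rewrite (pow_diag (lexx 0) Eu) powRr0 scale1r.
Qed.

Lemma powD s t x : 0 <= s -> 0 <= t -> op_pow P (s + t) x = op_pow P s (op_pow P t x).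
Proof.
move=> s0 t0.
apply: (bop_ext ip_norm EP (pow_bop (addr_ge0 s0 t0)) (bop_comp (pow_bop s0) (pow_bop t0))) => u Eu.
rewrite /= (pow_diag (addr_ge0 s0 t0) Eu) (pow_diag t0 Eu) (bopZ (pow_bop s0)).
by rewrite (pow_diag s0 Eu) scalerA -rmorphM /= mulrC -powRD_ge0.
Qed.

Lemma lam_bound : exists2 M, 0 <= M & forall u, E u -> lam u <= M.
Proof.
have [M M0 PM] := bop_bd PP; exists M => // u Eu.
exact: le_trans (ler_norm _) (diag_le ip_norm EP Pd PM Eu).
Qed.

Lemma pow_cpt t : 0 < t -> compact_op ip (op_pow P t).
Proof.
move=> t0; have [M M0 lM] := lam_bound.
apply: (cpt_dominated EP (pow_bop (ltW t0)) PP (pow_diag (ltW t0)) Pd lam0 Pc) => e e0.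
have q0 : 0 < e `^ t^-1 by rewrite powR_gt0.
exists (M `^ t / e `^ t^-1) => [|u Eu]; first by rewrite divr_ge0 ?powR_ge0.
have l0 := lam0 Eu; rewrite ger0_norm ?powR_ge0//.
have [le|lt] := leP (lam u) (e `^ t^-1).
  apply: (@le_trans _ _ e); last by rewrite lerDl mulr_ge0// divr_ge0 ?powR_ge0.
  by rewrite -powRV_le// ltW.
apply: (@le_trans _ _ (M `^ t)).
  by rewrite ge0_ler_powR ?nnegrE ?lM ?(ltW t0).
rewrite ler_wpDl ?(ltW e0)// mulrAC ler_pdivlMr// ler_wpM2l ?powR_ge0//.
exact: ltW.
Qed.

(** The condition [0 < t] excludes the exponent at which the power of the
    eigenvalue zero jumps from one to zero. *)
Lemma pow_strong_cvg (tn : nat -> R) t x : (forall n, 0 <= tn n <= 1) -> 0 < t <= 1 ->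
  (forall e, 0 < e -> exists N, forall n, (N <= n)%N -> `|tn n - t| <= e) ->
  forall e, 0 < e -> exists N, forall n, (N <= n)%N ->
    nm (op_pow P (tn n) x - op_pow P t x) <= e.
Proof.
move=> tn01 /andP[t0 t1] tnt; have [M M0 lM] := lam_bound.
have le1 (l s : R) : 0 <= l -> 0 <= s <= 1 -> 0 <= l `^ s <= 1 + l.
  move=> l0 /andP[s0 s1]; rewrite powR_ge0 /=.
  have [l1|/ltW l1] := leP l 1.
    apply: (@le_trans _ _ (1 `^ s)); last by rewrite powR1 lerDl.
    by rewrite ge0_ler_powR ?nnegrE.
  by rewrite (le_trans (ler1_powR l1 s1))// lerDr.
have tn0 n : 0 <= tn n by have /andP[] := tn01 n.
apply: (diag_strong_cvg ip_norm (M := 1 + M) x EP (fun n => pow_bop (tn0 n))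
  (fun n => pow_diag (tn0 n)) (pow_bop (ltW t0)) (pow_diag (ltW t0))) => [n u Eu|u Eu e e0].
  have := le1 _ _ (lam0 Eu) (tn01 n); have := le1 (lam u) t (lam0 Eu).
  rewrite (ltW t0) t1 => /(_ isT); have := lM u Eu; rewrite ler_norml; lra.
have [l0|lneq] := eqVneq (lam u) 0.
  have [N hN] := tnt (t / 2) (divr_gt0 t0 (ltr0n _ 2)).
  exists N => n Nn; have := hN n Nn; rewrite ler_norml => /andP[h _].
  have tnn : tn n != 0 by apply: lt0r_neq0; lra.
  by rewrite l0 !powR0 ?(lt0r_neq0 t0)// subrr normr0 ltW.
have lp : 0 < lam u by rewrite lt_neqAle eq_sym lneq lam0.
have ct : {for t, continuous (fun r : R => lam u `^ r)}.
  have -> : (fun r : R => lam u `^ r) = expR \o (fun r : R => r * ln (lam u)).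
    by apply/funext => r; rewrite /powR gt_eqF.
  apply: continuous_comp; last exact: continuous_expR.
  exact: mulrr_continuous.
have : \forall x \near t, `|lam u `^ t - lam u `^ x| <= e.
  exact: (pseudometric_normed_Zmodule.cvgr_dist_le _ _ ct _ e0).
move=> /nbhs_ballP[r /= r0 hr].
have [N hN] := tnt (r / 2) (divr_gt0 r0 (ltr0n _ 2)).
exists N => n Nn; rewrite distrC; apply: hr; rewrite /ball /= distrC.
by apply: le_lt_trans (hN n Nn) _; rewrite ltr_pdivrMr// ltr_pMr// ltr1n.
Qed.

End Powers.
End SphericalTransforms.

(** * Log-convexity along the Aluthge family *)

Section AluthgeFamily.
Context {R : realType} {H : completeNormedModType R[i]}.
Variable ip : {dot H for @conjC R[i]}.
Hypothesis ip_norm : forall x : H, ip x x = `|x| ^+ 2.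
Local Notation ipP := (ip_sip ip_norm).
Variables (E : set H) (lam : H -> R) (P : H -> H).
Hypotheses (EP : is_onb ip E) (PP : bounded_op P) (Pd : diag E lam P).
Hypotheses (lam0 : forall u, E u -> 0 <= lam u) (Pc : compact_op ip P).
Variables (d : nat) (V : 'I_d -> H -> H) (p : R).
Hypotheses (VP : forall i, bounded_op (V i)) (p1 : 1 <= p).
Hypothesis Vn : forall x, \sum_(i < d) nm (V i x) ^+ 2 <= nm x ^+ 2.
Implicit Types (u v h x y z : H) (e M c s t : R).

Let powb t := pow_bop ip_norm EP PP Pd lam0 (t := t).
Let powd t := pow_diag ip_norm EP PP Pd lam0 (t := t).
Let powadd s t x := powD ip_norm EP PP Pd lam0 x (s := s) (t := t).

Definition aluthge_family t : 'I_d -> H -> H :=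
  fun i => op_pow P t \o V i \o op_pow P (1 - t).
Local Notation X := aluthge_family.

Lemma family_bop t i : 0 <= t <= 1 -> bounded_op (X t i).
Proof.
case/andP=> t0 t1; apply: bop_comp; first exact: bop_comp (powb t0) (VP i).
by apply: powb; rewrite subr_ge0.
Qed.

(** One of the two exponents is positive, so one factor is compact. *)
Lemma family_cpt t i : 0 <= t <= 1 -> compact_op ip (X t i).
Proof.
case/andP=> t0 t1; have t1' : 0 <= 1 - t by rewrite subr_ge0.
have pc r : 0 < r -> compact_op ip (op_pow P r) := pow_cpt ip_norm EP PP Pd lam0 Pc (t := r).
have [tz|tn] := eqVneq t 0.
  apply: (@cpt_compl _ _ ip ip_norm (op_pow P (1 - t)) (op_pow P t \o V i)).
    exact: bop_comp (powb t0) (VP i).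
  by apply: pc; rewrite tz subr0.
apply: (@cpt_compr _ _ ip ip_norm (op_pow P t) (V i \o op_pow P (1 - t))).
  by apply: pc; rewrite lt_neqAle eq_sym tn.
exact: bop_comp (VP i) (powb t1').
Qed.

(** The weighted arithmetic-geometric mean inequality along the family. Weights
    one give the Heinz inequality; optimizing them gives log-convexity. *)
Lemma family_amgm s t r N0 : 0 <= s -> s <= t -> t <= 1 -> 0 < r -> 0 <= N0 ->
  (sph_norm ip p (fun i x => 2^-1 *: (r%:C *: X t i x + (r^-1)%:C *: X s i x)) <= N0%:E)%E ->
  (sph_norm ip p (X ((s + t) / 2)) <= N0%:E)%E.
Proof.
move=> s0 st t1 r0 N00 ZN.
have t0 := le_trans s0 st; have s1 := le_trans st t1.
pose dl := (t - s) / 2; have d0 : 0 <= dl by rewrite divr_ge0// subr_ge0.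
have t1' : 0 <= 1 - t by rewrite subr_ge0.
have s1' : 0 <= 1 - s by rewrite subr_ge0.
have sd0 : 0 <= dl + s by rewrite addr_ge0.
have td0 : 0 <= 1 - t + dl by rewrite addr_ge0.
set m := (s + t) / 2.
have mE : m = dl + s by rewrite /m /dl; field.
have m1E : 1 - m = 1 - t + dl by rewrite /m /dl; field.
have m01 : 0 <= m <= 1 by apply/andP; split; rewrite /m; lra.
have Xb := fun i => family_bop i m01; have Xc := fun i => family_cpt i m01.
(* [X m = A Y B], with the weight [r] shared between the two factors *)
pose q := Num.sqrt r; have q0 : 0 < q by rewrite sqrtr_gt0.
have qq : q * q = r by rewrite -expr2 sqr_sqrtr// ltW.
pose A x := q%:C *: op_pow P dl x; pose B x := (q^-1)%:C *: op_pow P dl x.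
have AP : bounded_op A by apply/bop_scale/powb.
have BP : bounded_op B by apply/bop_scale/powb.
pose a u := q * lam u `^ dl; pose b u := q^-1 * lam u `^ dl.
have Ad : diag E a A by move=> u Eu; rewrite /A (powd d0 Eu) scalerA -rmorphM.
have Bd : diag E b B by move=> u Eu; rewrite /B (powd d0 Eu) scalerA -rmorphM.
have [MB MB0 BM] := bop_bd BP.
pose Y i := op_pow P s \o V i \o op_pow P (1 - t).
have YP i : bounded_op (Y i) by apply: bop_comp (powb t1'); apply: bop_comp (powb s0) (VP i).
have t01 : 0 <= t <= 1 by rewrite t0 t1.
have s01 : 0 <= s <= 1 by rewrite s0 s1.
have Zb i : bounded_op (fun x => 2^-1 *: (r%:C *: X t i x + (r^-1)%:C *: X s i x)).
  by apply/bop_scale/bop_add; apply: bop_scale; apply: family_bop.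
have Zc i : compact_op ip (fun x => 2^-1 *: (r%:C *: X t i x + (r^-1)%:C *: X s i x)).
  by do ?[apply: (cpt_scale ip_norm)|apply: cpt_add]; apply: family_cpt.
have ZE i u : E u -> 2^-1 *: (r%:C *: X t i u + (r^-1)%:C *: X s i u)
    = (2^-1)%:C *: (A (A (Y i u)) + Y i (B (B u))).
  have -> : (2^-1)%:C = 2^-1 :> R[i] by rewrite fmorphV rmorph_nat.
  move=> _; congr (_ *: (_ + _)).
    rewrite /A (bopZ (powb d0)) scalerA -rmorphM /= qq; congr (_ *: _).
    rewrite /X /Y /=; have {1}-> : t = dl + (dl + s) by rewrite /dl; field.
    by rewrite (powadd _ d0 sd0) (powadd _ d0 s0).
  rewrite /B (bopZ (powb d0)) scalerA -rmorphM /= -invfM qq (bopZ (YP i)).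
  congr (_ *: _); rewrite /X /Y /=; have -> : 1 - s = 1 - t + dl + dl by rewrite /dl; field.
  by rewrite (powadd _ td0 d0) (powadd _ t1' d0).
have := operator_amgm ip_norm EP AP BP Ad Bd (fun u Eu => diag_le ip_norm EP Bd BM Eu)
   YP Zb Zc ZE p1 N00 ZN.
have -> : (fun i => A \o Y i \o B) = X m.
  apply/funext => i; apply/funext => x; rewrite /A /B /X /Y /= !(bopZ (powb _))//.
  rewrite (bopZ (VP i)) (bopZ (powb s0)) (bopZ (powb d0)) scalerA -rmorphM /=.
  by rewrite mulfV ?gt_eqF// scale1r m1E mE (powadd _ d0 s0) (powadd _ t1' d0).
by move=> h; apply/(sph_normP ip_norm Xb Xc p1 N00).
Qed.

(** The weight [al / be] equalizes the two terms of the arithmetic mean. *)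
Lemma family_midpoint s t (al be : R) : 0 <= s -> s <= t -> t <= 1 -> 0 < al -> 0 < be ->
  (sph_norm ip p (X s) <= (al ^+ 2)%:E)%E -> (sph_norm ip p (X t) <= (be ^+ 2)%:E)%E ->
  (sph_norm ip p (X ((s + t) / 2)) <= (al * be)%:E)%E.
Proof.
move=> s0 st t1 al0 be0 hs ht.
have t01 : 0 <= t <= 1 by rewrite (le_trans s0 st) t1.
have s01 : 0 <= s <= 1 by rewrite s0 (le_trans st t1).
have r0 : 0 < al / be by rewrite divr_gt0.
have ri0 : 0 < (al / be)^-1 by rewrite invr_gt0.
apply: (family_amgm s0 st t1 r0); first by rewrite mulr_ge0 ?ltW.
have [_ _] := sph_norm_triangle ip_norm (fun i => family_bop i t01) (fun i => family_bop i s01)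
  (fun i => family_cpt i t01) (fun i => family_cpt i s01) p1 (sqr_ge0 be) (sqr_ge0 al)
  (ltW r0) (ltW ri0) ht hs.
suff -> : (al / be * be ^+ 2 + (al / be)^-1 * al ^+ 2) / 2 = al * be by [].
by field; rewrite !gt_eqF.
Qed.

Lemma family_dyadic (a b : R) n k : 0 < a -> 0 < b ->
  (sph_norm ip p (X 0) <= a%:E)%E -> (sph_norm ip p (X 1) <= b%:E)%E ->
  (k <= 2 ^ n)%N -> let t := k%:R / 2 ^+ n in
  (sph_norm ip p (X t) <= (a `^ (1 - t) * b `^ t)%:E)%E.
Proof.
move=> a0 b0 h0 h1; elim: n k => [|n IH] k.
  rewrite expn0 expr0 divr1; case: k => [|[|//]] _ /=.
    by rewrite mulr0n subr0 powRr0 mulr1 (powRr1 (ltW a0)).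
  by rewrite mulr1n subrr powRr0 mul1r (powRr1 (ltW b0)).
have n2 : (0 : R) < 2 ^+ n by rewrite exprn_gt0.
move=> kn /=; rewrite -[k]odd_double_half; case ko: (odd k); last first.
  have -> : (false + k./2.*2)%:R / 2 ^+ n.+1 = k./2%:R / 2 ^+ n :> R.
    by rewrite add0n -muln2 natrM exprS; field; rewrite gt_eqF.
  apply: IH; rewrite -leq_double -[X in (_ <= X)%N]mul2n -expnS.
  by apply: leq_trans kn; rewrite -[leqRHS]odd_double_half leq_addl.
pose j := k./2; rewrite -/j.
have kE : k = j.*2.+1 by rewrite -[LHS]odd_double_half ko.
have jn : (j.+1 <= 2 ^ n)%N.
  rewrite -leq_double -[X in (_ <= X)%N]mul2n -expnS doubleS.
  have : k != (2 ^ n.+1)%N by apply/eqP => kk; move: ko; rewrite kk oddX.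
  by move=> kk; rewrite -kE ltn_neqAle kk.
pose s : R := j%:R / 2 ^+ n; pose t : R := j.+1%:R / 2 ^+ n.
have s0 : 0 <= s by rewrite divr_ge0 ?ler0n ?ltW.
have st : s <= t by rewrite ler_pM2r ?invr_gt0// ler_nat.
have t1 : t <= 1 by rewrite ler_pdivrMr// mul1r -natrX ler_nat.
have mE : (true + j.*2)%:R / 2 ^+ n.+1 = (s + t) / 2 :> R.
  by rewrite add1n -addn1 -muln2 natrD natrM exprS /s /t -natr1; field; rewrite gt_eqF.
rewrite mE.
have an : a != 0 by rewrite gt_eqF.
have bn : b != 0 by rewrite gt_eqF.
have psi_sqr (r : R) : a `^ (1 - r) * b `^ r = (a `^ ((1 - r) / 2) * b `^ (r / 2)) ^+ 2.
  rewrite exprMn !expr2 -!powRD ?an ?bn ?implybT//.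
  by congr (_ `^ _ * _ `^ _); field.
have ps : 0 < a `^ ((1 - s) / 2) * b `^ (s / 2) by rewrite mulr_gt0 ?powR_gt0.
have pt : 0 < a `^ ((1 - t) / 2) * b `^ (t / 2) by rewrite mulr_gt0 ?powR_gt0.
have := @family_midpoint s t _ _ s0 st t1 ps pt; rewrite -!psi_sqr => /(_ (IH j (ltnW jn)) (IH j.+1 jn)).
suff -> : a `^ ((1 - s) / 2) * b `^ (s / 2) * (a `^ ((1 - t) / 2) * b `^ (t / 2))
  = a `^ (1 - (s + t) / 2) * b `^ ((s + t) / 2) by [].
rewrite mulrACA -!powRD ?an ?bn ?implybT//.
by congr (_ `^ _ * _ `^ _); field.
Qed.

Lemma dyadic_approx t e : 0 < t < 1 -> 0 < e ->
  exists N, forall n, (N <= n)%N -> exists2 k, (k <= 2 ^ n)%N & `|k%:R / 2 ^+ n - t| <= e.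
Proof.
case/andP=> t0 t1 e0.
have [N hN] : exists N : nat, e^-1 < N%:R.
  have ei : 0 <= e^-1 by rewrite invr_ge0 ltW.
  by exists (Num.truncn (e^-1)).+1; have /andP[] := truncn_itv ei.
exists N => n Nn; have n2 : (0 : R) < 2 ^+ n by rewrite exprn_gt0.
have tn0 : 0 <= t * 2 ^+ n by rewrite mulr_ge0 ?ltW.
have /andP[k1 k2] := truncn_itv tn0; set k := Num.truncn _ in k1 k2.
exists k.
  rewrite -(ler_nat R) natrX; apply: le_trans k1 _.
  by rewrite ler_piMl ?(ltW n2) ?(ltW t1).
rewrite distrC ger0_norm; last by rewrite subr_ge0 ler_pdivrMr.
have ne : (2 ^+ n)^-1 <= e.
  rewrite -[leRHS]invrK lef_pV2 ?posrE ?invr_gt0//; apply: le_trans (ltW hN) _.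
  rewrite -natrX ler_nat; apply: leq_trans Nn _; exact/ltnW/ltn_expl.
apply: le_trans ne; rewrite lerBlDr.
have -> : (2 ^+ n)^-1 + k%:R / 2 ^+ n = k.+1%:R / 2 ^+ n :> R.
  by rewrite -[k.+1%:R]natr1 mulrDl mul1r addrC.
by rewrite ler_pdivlMr// ltW.
Qed.

(** Each matrix coefficient is continuous in [t], by strong continuity of the
    powers of [P] on both sides of [V]. *)
Lemma family_lsc (tn : nat -> R) t x (z : 'I_d -> H) : (forall n, 0 <= tn n <= 1) -> 0 < t < 1 ->
  (forall e, 0 < e -> exists N, forall n, (N <= n)%N -> `|tn n - t| <= e) ->
  forall e, 0 < e -> exists N, forall n, (N <= n)%N ->
    md (ipK ip (column (X t) x) z) <= e + md (ipK ip (column (X (tn n)) x) z).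
Proof.
move=> tn01 /andP[t0 t1] tnt.
have powE (r : R) i : 0 <= r <= 1 -> ip (X r i x) (z i) = ip (V i (op_pow P (1 - r) x)) (op_pow P r (z i)).
  by case/andP=> r0 _; rewrite /X /= (diag_selfadj ip_norm _ _ EP (powb r0) (powd r0)).
have tn01' n : 0 <= 1 - tn n <= 1.
  by have := tn01 n; case/andP=> ? ?; rewrite subr_ge0 gerBl; apply/andP.
have tnt' e : 0 < e -> exists N, forall n, (N <= n)%N -> `|(1 - tn n) - (1 - t)| <= e.
  move=> e0; have [N hN] := tnt e e0; exists N => n Nn.
  have -> : 1 - tn n - (1 - t) = t - tn n by ring.
  by rewrite distrC hN.
have Vle i y : nm (V i y) <= nm y.
  rewrite -(@ler_pXn2r _ 2)// ?nnegrE ?nm_ge0//; apply: le_trans (Vn y).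
  by rewrite (bigD1 i)//= lerDl sumr_ge0// => j _; rewrite sqr_ge0.
have t01 : 0 < t <= 1 by rewrite t0 ltW.
have t01' : 0 < 1 - t <= 1 by rewrite subr_gt0 t1 gerBl ltW.
have t01b : 0 <= t <= 1 by rewrite !ltW.
pose pt := op_pow P (1 - t) x.
(* coordinatewise convergence, then a finite sum over the coordinates *)
have one i e : 0 < e -> exists N, forall n, (N <= n)%N ->
    md (ip (X t i x) (z i) - ip (X (tn n) i x) (z i)) <= e.
  move=> e0; pose qt := op_pow P t (z i).
  have K0 : 0 < nm qt + 1 + nm pt by rewrite ltr_pwDl ?nm_ge0// ltr_wpDl ?nm_ge0.
  pose r := Num.min 1 (e / (nm qt + 1 + nm pt)).
  have r0 : 0 < r by rewrite lt_min ltr01 divr_gt0.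
  have [N1 h1] := pow_strong_cvg ip_norm EP PP Pd lam0 x tn01' t01' tnt' r0.
  have [N2 h2] := pow_strong_cvg ip_norm EP PP Pd lam0 (z i) tn01 t01 tnt r0.
  exists (maxn N1 N2) => n; rewrite geq_max => /andP[/h1 {}h1 /h2 {}h2].
  rewrite !powE//; rewrite -/pt -/qt in h1 h2 *.
  set pn := op_pow P (1 - tn n) x in h1 *; set qn := op_pow P (tn n) (z i) in h2 *.
  have -> : ip (V i pt) qt - ip (V i pn) qn = ip (V i pt) (qt - qn) + ip (V i (pt - pn)) qn.
    by rewrite (bopB (VP i)) (sipBr ipP) (sipBl ipP); ring.
  apply: le_trans (mdD _ _) _.
  have qnn : nm qn <= nm qt + 1.
    have := nmD qt (qn - qt); rewrite addrC subrK => /le_trans; apply.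
    by rewrite lerD2l (le_trans h2)// ge_min lexx.
  apply: (@le_trans _ _ (nm pt * r + r * (nm qt + 1))).
    apply: lerD; apply: le_trans (ip_CS ip_norm _ _) _; apply: ler_pM; rewrite ?nm_ge0//.
    - by rewrite nmC.
    - by apply: le_trans (Vle _ _) _; rewrite nmC.
  have -> : nm pt * r + r * (nm qt + 1) = r * (nm qt + 1 + nm pt) by ring.
  by rewrite -ler_pdivlMr// /r ge_min lexx orbT.
move=> e e0.
have d1 : 0 < d%:R + 1 :> R by rewrite ltr_wpDl.
have [N hN] := choice (fun i => one i _ (divr_gt0 e0 d1)).
exists (\max_i N i)%N => n Nn.
rewrite -lerBlDr; apply: (@le_trans _ _ (md (ipK ip (column (X t) x) z - ipK ip (column (X (tn n)) x) z))).
  rewrite lerBlDr; apply: le_trans (mdD _ _).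
  by rewrite subrK.
rewrite /ipK -sumrB; apply: le_trans (md_sum _ _) _.
apply: (@le_trans _ _ (\sum_(i < d) e / (d%:R + 1))).
  by apply: ler_sum => i _; apply: hN; apply: leq_trans Nn; apply: leq_bigmax.
rewrite sumr_const card_ord -[leLHS]mulr_natl mulrCA ler_piMr ?(ltW e0)//.
by rewrite ler_pdivrMr// mul1r lerDl.
Qed.

(** Log-convexity of the norm along the family passes from dyadic points to the
    limit, because every finite sum of matrix coefficients is continuous in [t].
    The bounds [a] and [b] are positive so that their powers are continuous. *)
Lemma family_interpolation_pos (a b : R) t : 0 < a -> 0 < b -> 0 <= t <= 1 ->
  (sph_norm ip p (X 0) <= a%:E)%E -> (sph_norm ip p (X 1) <= b%:E)%E ->
  (sph_norm ip p (X t) <= (a `^ (1 - t) * b `^ t)%:E)%E.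
Proof.
move=> a0 b0 t01 h0 h1; have p0 : 0 < p by apply: lt_le_trans p1.
have [->|tn0] := eqVneq t 0.
  by rewrite subr0 powRr0 mulr1 (powRr1 (ltW a0)).
have [->|tn1] := eqVneq t 1.
  by rewrite subrr powRr0 mul1r (powRr1 (ltW b0)).
have t01' : 0 < t < 1 by case/andP: t01 => ? ?; rewrite !lt_neqAle eq_sym tn0 tn1; apply/andP.
have psi0 (r : R) : 0 < a `^ (1 - r) * b `^ r by rewrite mulr_gt0 ?powR_gt0.
apply/(sph_normP ip_norm (fun i => family_bop i t01) (fun i => family_cpt i t01) p1 (ltW (psi0 t))).
move=> s f so fo.
(* dyadic approximations of t *)
have [tn [tnd tnt]] : exists tn : nat -> R,
    (forall n, exists k m, (k <= 2 ^ m)%N /\ tn n = k%:R / 2 ^+ m) /\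
    forall e, 0 < e -> exists N, forall n, (N <= n)%N -> `|tn n - t| <= e.
  have hd (n : nat) : exists r : R, (exists k m, (k <= 2 ^ m)%N /\ r = k%:R / 2 ^+ m) /\
      `|r - t| <= n.+1%:R^-1.
    have [|N hN] := @dyadic_approx t n.+1%:R^-1 t01'; first by rewrite invr_gt0.
    by have [k kN hk] := hN N (leqnn N); exists (k%:R / 2 ^+ N); split=> //; exists k, N.
  have [tn tnP] := choice hd; exists tn; split=> [n|e e0]; first by have [] := tnP n.
  have [N hN] := harmonic_le e0; exists N => n Nn.
  by have [_ /le_trans] := tnP n; apply; apply: hN.
have tn01 n : 0 <= tn n <= 1.
  have [k [m [km ->]]] := tnd n; rewrite divr_ge0 ?ler0n ?exprn_ge0//=.
  by rewrite ler_pdivrMr ?exprn_gt0// mul1r -natrX ler_nat.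
have psic e : 0 < e -> exists N, forall n, (N <= n)%N ->
    (a `^ (1 - tn n) * b `^ tn n) `^ p <= (a `^ (1 - t) * b `^ t) `^ p + e.
  move=> e0.
  have ct : {for t, continuous (fun r : R => (a `^ (1 - r) * b `^ r) `^ p)}.
    have -> : (fun r : R => (a `^ (1 - r) * b `^ r) `^ p)
        = expR \o (fun r => r * (p * (ln b - ln a)) + p * ln a).
      apply/funext => r /=; rewrite /powR [a == 0]gt_eqF// [b == 0]gt_eqF// -expRD.
      by rewrite gt_eqF ?expR_gt0// expRK; congr expR; ring.
    apply: continuous_comp; last exact: continuous_expR.
    by apply: cvgD; [exact: mulrr_continuous|exact: cvg_cst].
  have : \forall r \near t, `|(a `^ (1 - t) * b `^ t) `^ p - (a `^ (1 - r) * b `^ r) `^ p| <= e.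
    exact: (pseudometric_normed_Zmodule.cvgr_dist_le _ _ ct _ e0).
  move=> /nbhs_ballP[r /= r0 hr].
  have [N hN] := tnt (r / 2) (divr_gt0 r0 (ltr0n _ 2)).
  exists N => n Nn; rewrite -lerBlDl.
  apply: (@le_trans _ _ `|(a `^ (1 - t) * b `^ t) `^ p - (a `^ (1 - tn n) * b `^ tn n) `^ p|).
    by rewrite distrC ler_norm.
  apply: hr; rewrite /ball /= distrC.
  by apply: le_lt_trans (hN n Nn) _; rewrite ltr_pdivrMr// ltr_pMr// ltr1n.
apply/ler_addgt0Pr => e1 e10.
apply: powR_sum_closure => //.
- by rewrite addr_ge0 ?powR_ge0 ?ltW.
- by move=> u _; apply: md_ge0.
move=> e e0.
have [N1 hN1] := psic e1 e10.
have [N hN] : exists N, forall n, (N <= n)%N -> forall u, u \in s ->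
    md (ipK ip (column (X t) u) (f u)) <= e + md (ipK ip (column (X (tn n)) u) (f u)).
  elim: (s) => [|u r [M1 m1]]; first by exists 0%N.
  have [M2 m2] := family_lsc u (f u) tn01 t01' tnt e0.
  exists (maxn M1 M2) => n; rewrite geq_max => /andP[n1 n2] v; rewrite inE => /predU1P[->|].
    exact: m2.
  exact: m1.
pose n := maxn N N1; exists (fun u => md (ipK ip (column (X (tn n)) u) (f u))); split.
- by move=> u _; apply: md_ge0.
- by move=> u us; apply: hN => //; apply: leq_maxl.
apply: le_trans (hN1 n (leq_maxr _ _)).
have [k [m [km tE]]] := tnd n.
have := family_dyadic a0 b0 h0 h1 km; rewrite /= -tE => hn.
exact: ((sph_normP ip_norm (fun i => family_bop i (tn01 n)) (fun i => family_cpt i (tn01 n))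
  p1 (ltW (psi0 _))).1 hn s f so fo).
Qed.

End AluthgeFamily.

(** * The Duggal bound and the main inequalities *)

Section DuggalBound.
Context {R : realType} {H : completeNormedModType R[i]}.
Variable ip : {dot H for @conjC R[i]}.
Hypothesis ip_norm : forall x : H, ip x x = `|x| ^+ 2.
Local Notation ipP := (ip_sip ip_norm).
Variables (E : set H) (lam : H -> R) (P : H -> H).
Hypotheses (EP : is_onb ip E) (PP : bounded_op P) (Pd : diag E lam P).
Hypotheses (lam0 : forall u, E u -> 0 <= lam u) (Pc : compact_op ip P).
Variables (d : nat) (V : 'I_d -> H -> H) (p : R).
Hypotheses (VP : forall i, bounded_op (V i)) (p1 : 1 <= p).
Hypothesis Vn : forall x, \sum_(i < d) nm (V i x) ^+ 2 <= nm x ^+ 2.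
Implicit Types (u v h x y z : H) (e M c s t n : R).

(** [P] acts on [d] copies of the space, so its singular values are counted [d]
    times; [V] is a contraction, and the kernel built from it is doubly
    substochastic. *)
Lemma duggal_bound n : 0 <= n -> (\esum_(u in E) (lam u `^ p)%:E <= (n `^ p)%:E)%E ->
  (sph_norm ip p (fun i => P \o V i) <= (d%:R `^ p^-1 * n)%:E)%E.
Proof.
move=> n0 Sn; have p0 : 0 < p by apply: lt_le_trans p1.
have Db i : bounded_op (P \o V i) by apply: bop_comp PP (VP i).
have Dc i : compact_op ip (P \o V i) by apply: (@cpt_compr _ _ ip ip_norm P (V i)).
have N0 : 0 <= d%:R `^ p^-1 * n by rewrite mulr_ge0 ?powR_ge0.
apply/(sph_normP ip_norm Db Dc p1 N0) => s f so fo.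
rewrite powRM ?powR_ge0// -powRrM mulVf ?gt_eqF// powRr1//.
have [M M0 PM] := bop_bd PP.
have fn u : u \in s -> sq (@ipK _ _ ip d) (f u) = 1 by move=> us; rewrite /sq fo// (eqxx u).
have su u : u \in s -> nm u = 1 by move=> us; apply: (onset_nm ip_norm so.2).
have fle u i : u \in s -> nm (f u i) <= 1.
  move=> us; rewrite -(@ler_pXn2r _ 2)// ?nnegrE ?nm_ge0// expr1n -(fn u us) (sqK ip_norm).
  by rewrite (bigD1 i)//= lerDl sumr_ge0// => j _; rewrite sqr_ge0.
have Vadj i y : nm (adjoint ip (V i) y) <= nm y.
  have [->|y0] := eqVneq (nm (adjoint ip (V i) y)) 0; first exact: nm_ge0.
  have yp : 0 < nm (adjoint ip (V i) y) by rewrite lt_neqAle eq_sym y0 nm_ge0.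
  rewrite -(ler_pM2l yp) -expr2 -(sq_nm ip_norm) /sq -(adjointE ip_norm _ _ (VP i)).
  apply: le_trans (Re_md _) _; apply: le_trans (ip_CS ip_norm _ _) _.
  rewrite ler_wpM2r ?nm_ge0// -(@ler_pXn2r _ 2)// ?nnegrE ?nm_ge0//; apply: le_trans (Vn _).
  by rewrite (bigD1 i)//= lerDl sumr_ge0// => j _; rewrite sqr_ge0.
apply: powR_sum_closure => //.
- by rewrite mulr_ge0 ?powR_ge0.
- by move=> u _; apply: md_ge0.
move=> e e0.
pose K := d%:R * M + 1; have K0 : 0 < K by rewrite /K ltr_wpDl// mulr_ge0.
have [t [tons tE tx]] := onb_approx ip_norm [seq V i u | u <- s, i <- enum 'I_d] EP (divr_gt0 e0 K0).
pose J := [seq (i, h) | i <- enum 'I_d, h <- t].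
have [ut to] := tons.
have sumJ (F : 'I_d * H -> R) : \sum_(j <- J) F j = \sum_(i < d) \sum_(h <- t) F (i, h).
  by rewrite /J big_allpairs big_enum.
pose al u (j : 'I_d * H) := md (ip (V j.1 u) j.2).
pose be u (j : 'I_d * H) := md (ip j.2 (f u j.1)).
pose D u j := 2^-1 * (al u j ^+ 2 + be u j ^+ 2).
have lamJ j : j \in J -> 0 <= lam j.2.
  by case/allpairsP=> -[i h] /= [_ ht ->]; apply/lam0/tE.
exists (fun u => \sum_(j <- J) al u j * (lam j.2 * be u j)).
have y0 u : 0 <= \sum_(j <- J) al u j * (lam j.2 * be u j).
  by apply: sumr_ge0_seq => j jJ; rewrite !mulr_ge0 ?md_ge0 ?lamJ.
split=> // [u us|].
  rewrite sumJ /ipK /column; apply: le_trans (md_sum _ _) _.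
  apply: (@le_trans _ _ (\sum_(i < d) (M * (e / K) + \sum_(h <- t) al u (i, h) * (lam h * be u (i, h))))).
    apply: ler_sum => i _ /=; set z := V i u.
    have zt : nm (z - prj ip t z) <= e / K.
      by apply: tx; apply/allpairsP; exists (u, i); split=> //=; rewrite mem_enum.
    rewrite -[z in P z](subrK (prj ip t z)) (bopD PP) (sipDl ipP).
    apply: le_trans (mdD _ _) _; rewrite lerD//.
      apply: le_trans (ip_CS ip_norm _ _) _; rewrite -[leRHS]mulr1.
      apply: ler_pM; rewrite ?nm_ge0 ?fle//.
      by apply: le_trans (PM _) _; rewrite ler_wpM2l.
    rewrite (prj_bop ip t z PP) (sip_suml ipP); apply: le_trans (md_sum _ _) _.
    apply: ler_sum_seq => h ht; rewrite (sipZl ipP) mdM (Pd (tE h ht)) (sipZl ipP) mdM md_real.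
    by rewrite ger0_norm// lam0//; apply: tE.
  rewrite big_split /= lerD2r sumr_const card_ord -[leLHS]mulr_natl mulrA.
  rewrite mulrCA ler_piMr ?(ltW e0)// ler_pdivrMr// mul1r.
  by rewrite /K lerDl.
apply: (@le_trans _ _ (\sum_(j <- J) lam j.2 `^ p)); last first.
  rewrite sumJ /= sumr_const card_ord -[leLHS]mulr_natl ler_wpM2l//= -lee_fin.
  by apply: le_trans Sn; apply: esum_ge_seq.
apply: (@powR_substochastic _ _ _ _ s J D (fun j => lam j.2)) => //.
- by move=> u j _ _; rewrite mulr_ge0 ?addr_ge0 ?sqr_ge0.
- move=> u us; rewrite sumJ /D.
  apply: (@le_trans _ _ (\sum_(i < d) 2^-1 * (nm (V i u) ^+ 2 + nm (f u i) ^+ 2))).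
    apply: ler_sum => i _; rewrite -mulr_sumr ler_wpM2l// big_split /= lerD//.
      by rewrite /al /=; apply: bessel_ons.
    rewrite /be /=; under eq_bigr do rewrite (md_sip_sym ipP).
    exact: bessel_ons.
  rewrite -mulr_sumr big_split /= -(sqK ip_norm (f u)) fn//.
  have := Vn u; rewrite su// expr1n; lra.
- case=> i h /allpairsP[[i' h'] /= [_ ht [-> ->]]]; rewrite /D -mulr_sumr big_split /=.
  have hn := onset_nm ip_norm EP.1 (tE h' ht).
  have h1 : \sum_(u <- s) al u (i', h') ^+ 2 <= 1.
    apply: (@le_trans _ _ (nm (adjoint ip (V i') h') ^+ 2)).
      rewrite /al /=; under eq_bigr do rewrite (adjointE ip_norm _ _ (VP i')) (md_sip_sym ipP).
      exact: bessel_ons.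
    by rewrite -[leRHS](expr1n _ 2) ler_pXn2r ?nnegrE ?nm_ge0// -hn Vadj.
  have h2 : \sum_(u <- s) be u (i', h') ^+ 2 <= 1.
    pose w : 'I_d -> H := fun k => if k == i' then h' else 0.
    have wE (x : 'I_d -> H) : ipK ip w x = ip h' (x i').
      rewrite /ipK (bigD1 i')//= /w eqxx big1 ?addr0// => k /negbTE ki.
      by rewrite ki (sip0l ipP).
    rewrite /be /=; under eq_bigr do rewrite -wE.
    apply: (@le_trans _ _ (sq (@ipK _ _ ip d) w)).
      apply: (bessel (@ipK_sip _ _ ip ip_norm d)); first by case: so.
        by move=> u v us vs uv; rewrite fo// (negbTE uv).
      by move=> u us; rewrite fn.
    by rewrite /sq wE /w eqxx -/(sq ip h') (sq_nm ip_norm) hn expr1n.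
  move: h1 h2; lra.
- move=> u us; rewrite y0 /=; apply: ler_sum_seq => j jJ.
  rewrite /D mulrCA [leRHS]mulrC ler_wpM2l ?lamJ//.
  have : 0 <= (al u j - be u j) ^+ 2 by apply: sqr_ge0.
  by rewrite sqrrB; lra.
Qed.

End DuggalBound.

Section Interpolation.
Context {R : realType}.
Implicit Types (m n t p : R).

Lemma powR_weighted_amgm m n t : 0 <= m -> 0 <= n -> 0 <= t <= 1 ->
  m `^ t * n `^ (1 - t) <= t * m + (1 - t) * n.
Proof.
move=> m0 n0 /andP[t0 t1].
have [->|tn0] := eqVneq t 0; first by rewrite powRr0 subr0 powRr1// mul0r !mul1r add0r.
have [->|tn1] := eqVneq t 1; first by rewrite powRr1// subrr powRr0 mul0r mulr1 mul1r addr0.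
have tp : 0 < t by rewrite lt_neqAle eq_sym tn0.
have tp1 : 0 < 1 - t by rewrite subr_gt0 lt_neqAle tn1.
have := @conjugate_powR R (m `^ t) (n `^ (1 - t)) t^-1 (1 - t)^-1 (powR_ge0 _ _) (powR_ge0 _ _).
rewrite !invr_gt0 !invrK => /(_ tp tp1); rewrite addrC subrK => /(_ erefl).
by rewrite -!powRrM !mulfV ?gt_eqF// !powRr1// mulrC [m * t]mulrC [n * _]mulrC mulrC.
Qed.

(** Removes the positivity of the endpoints by continuity of the powers at zero. *)
Lemma powR_prod_limit (x : \bar R) m n t : 0 <= m -> 0 <= n -> 0 <= t <= 1 ->
  (forall a b : R, n < a -> m < b -> (x <= (a `^ (1 - t) * b `^ t)%:E)%E) ->
  (x <= (n `^ (1 - t) * m `^ t)%:E)%E.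
Proof.
move=> m0 n0 /andP[t0 t1] h; have t1' : 0 <= 1 - t by rewrite subr_ge0.
apply/lee_addgt0Pr => e e0.
set u := n `^ (1 - t); set v := m `^ t.
have u0 : 0 <= u := powR_ge0 _ _; have v0 : 0 <= v := powR_ge0 _ _.
have K0 : 0 < u + v + 1 by rewrite ltr_wpDl// addr_ge0.
pose r := Num.min 1 (e / (u + v + 1)).
have r0 : 0 < r by rewrite lt_min ltr01 divr_gt0.
have [d1 d10 h1] := powR_cont t1' n0 r0; have [d2 d20 h2] := powR_cont t0 m0 r0.
have {}h1 := h1 (n + d1); have {}h2 := h2 (m + d2).
rewrite opprD addNKr normrN gtr0_norm// lexx addr_ge0 ?(ltW d10)// in h1.
rewrite opprD addNKr normrN gtr0_norm// lexx addr_ge0 ?(ltW d20)// in h2.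
have /h : n < n + d1 by rewrite ltrDl.
have mm : m < m + d2 by rewrite ltrDl.
move=> /(_ _ mm) /le_trans; apply; rewrite -EFinD lee_fin -/u -/v.
have /andP[a1 a2] : - r <= u - (n + d1) `^ (1 - t) <= r by rewrite -ler_norml h1.
have /andP[b1 b2] : - r <= v - (m + d2) `^ t <= r by rewrite -ler_norml h2.
apply: (@le_trans _ _ ((u + r) * (v + r))).
  by apply: ler_pM; rewrite ?powR_ge0//; lra.
have re : r * (u + v + 1) <= e by rewrite -ler_pdivlMr// /r ge_min lexx orbT.
have r1 : r <= 1 by rewrite /r ge_min lexx.
nra.
Qed.

End Interpolation.

Theorem theorem3p5 (R : realType) (H : completeNormedModType R[i])
    (ip : {dot H for @conjC R[i]}) (ip_norm : forall x : H, ip x x = `|x| ^+ 2)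
    (H_separable : separable H) (d : nat) (T V : 'I_d -> {linear H -> H})
    (T_bounded : forall i, continuous (T i))
    (V_bounded : forall i, continuous (V i))
    (polar : is_polar_part ip T V)
    (p : R) (p_ge1 : 1 <= p) (T_class : schatten_class ip p T)
    (t : R) (t_ge0 : 0 <= t) (t_le1 : t <= 1) :
  let nT := sph_norm ip p T in
  let nA := sph_norm ip p (aluthge ip T V) in
  let nH := sph_norm ip p (heinz ip T V t) in
  let nD := sph_norm ip p (duggal ip T V) in
  ([/\ nA <= nH,
       nH <= 2^-1%:E * (nD `^ t * nT `^ (1 - t) + nD `^ (1 - t) * nT `^ t) &
       2^-1%:E * (nD `^ t * nT `^ (1 - t) + nD `^ (1 - t) * nT `^ t)
         <= ((d%:R `^ (t / p) + d%:R `^ ((1 - t) / p)) / 2)%:E * nT] /\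
   [/\ nA <= nH,
       nH <= 2^-1%:E * (nD + nT) &
       2^-1%:E * (nD + nT) <= ((1 + d%:R `^ p^-1) / 2)%:E * nT])%E.
Proof.
move=> nT nA nH nD.
have p0 : 0 < p by apply: lt_le_trans p_ge1.
have TP i : bounded_op (T i) := continuous_bop (T_bounded i).
have VP i : bounded_op (V i) := continuous_bop (V_bounded i).
pose P := sph_abs ip T.
have h2 : 0 <= 2^-1 :> R by rewrite invr_ge0.
have PP : bounded_op P := op_pow_bop ip_norm (adj_self_bop ip_norm TP) (adj_self_positive ip_norm TP) h2.
have Pp : positive_op ip P :=
  op_pow_positive ip_norm (adj_self_bop ip_norm TP) (adj_self_positive ip_norm TP) h2.
have Pc : compact_op ip P := finite_trace_cpt ip_norm PP Pp p0 T_class.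
have [E [lam [EP Pd lam0]]] := spectral_theorem ip_norm PP Pc Pp.
have [TV Vproj] := polar.
(* [V^* V] is an orthogonal projection *)
have Vn x : \sum_(i < d) nm (V i x) ^+ 2 <= nm x ^+ 2.
  have -> : \sum_(i < d) nm (V i x) ^+ 2 = complex.Re (ip (sum_adj_self ip V x) x).
    by rewrite (adj_self_ip ip_norm _ _ VP) -(sqK ip_norm).
  set y := sum_adj_self ip V x; have [Sy oy] := Vproj x.
  have yy : complex.Re (ip y x) = nm y ^+ 2.
    rewrite -[x](subrK y) addrC (sipDr (ip_sip ip_norm)) ReD.
    have -> : ip y (x - y) = 0.
      by rewrite (sip_sym (ip_sip ip_norm) (x - y)) oy// conjc0.
    by rewrite addr0 -(sq_nm ip_norm).
  rewrite yy ler_pXn2r ?nnegrE ?nm_ge0//.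
  have [->|y0] := eqVneq (nm y) 0; first exact: nm_ge0.
  have yp : 0 < nm y by rewrite lt_neqAle eq_sym y0 nm_ge0.
  rewrite -(ler_pM2l yp) -expr2 -yy; apply: le_trans (Re_md _) _.
  exact: (ip_CS ip_norm).
pose X := aluthge_family P (fun i => V i : H -> H).
have X0 : X 0 = (fun i => T i : H -> H).
  apply/funext => i; apply/funext => x; rewrite /X /aluthge_family /=.
  by rewrite subr0 (pow0 ip_norm EP PP Pd lam0) (pow1 ip_norm EP PP Pd lam0) TV.
have X1 : X 1 = duggal ip T V.
  apply/funext => i; apply/funext => x; rewrite /X /aluthge_family /=.
  by rewrite subrr (pow0 ip_norm EP PP Pd lam0) (pow1 ip_norm EP PP Pd lam0).
have XA : aluthge ip T V = X 2^-1 by [].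
have Xb r i : 0 <= r <= 1 -> bounded_op (X r i) := family_bop ip_norm EP PP Pd lam0 VP (t := r) i.
have Xc r i : 0 <= r <= 1 -> compact_op ip (X r i) := family_cpt ip_norm EP PP Pd lam0 Pc VP (t := r) i.
have t01 : 0 <= t <= 1 by rewrite t_ge0 t_le1.
have t01' : 0 <= 1 - t <= 1 by rewrite subr_ge0 gerBl t_le1.
(* the norm of T is computed on the eigenbasis of P *)
have tr : (op_trace ip (op_pow P p) = \esum_(u in E) (lam u `^ p)%:E)%E.
  have [Bb Bd] := op_pow_diag ip_norm EP PP Pd lam0 (ltW p0).
  by apply: (trace_diag ip_norm EP Bb Bd) => u _; apply: powR_ge0.
have tr0 : (0 <= op_trace ip (op_pow P p))%E.
  by rewrite tr; apply: esum_ge0 => u _; rewrite lee_fin powR_ge0.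
have [n [n0 nTE]] : exists n, 0 <= n /\ nT = n%:E.
  move: T_class tr0; rewrite /nT /sph_norm /schatten_class -/P.
  case: (op_trace _ _) => [r| |]// _ r0; exists (r `^ p^-1); rewrite powR_ge0.
  by rewrite poweR_EFin.
have Sn : (\esum_(u in E) (lam u `^ p)%:E <= (n `^ p)%:E)%E.
  by rewrite -tr -poweR_le_fin// -nTE.
have nge0 (Y : 'I_d -> H -> H) : (0 <= sph_norm ip p Y)%E := poweR_ge0 _ _.
have fin (Y : 'I_d -> H -> H) (b : R) : (sph_norm ip p Y <= b%:E)%E ->
    exists c, 0 <= c /\ sph_norm ip p Y = c%:E.
  move: (nge0 Y); case: (sph_norm ip p Y) => [c| |]// c0 _.
  by exists c.
have Db := duggal_bound ip_norm EP PP Pd lam0 Pc VP p_ge1 Vn n0 Sn.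
have [m [m0 nDE]] := fin (duggal ip T V) _ Db.
rewrite -/nD in nDE.
have mn : m <= d%:R `^ p^-1 * n by rewrite -lee_fin -nDE.
have Xt r : 0 <= r <= 1 -> (sph_norm ip p (X r) <= (n `^ (1 - r) * m `^ r)%:E)%E.
  move=> r01; apply: powR_prod_limit => // a b na mb.
  apply: (family_interpolation_pos ip_norm EP PP Pd lam0 Pc VP p_ge1 Vn) => //.
  - exact: le_lt_trans na.
  - exact: le_lt_trans mb.
  - by rewrite -/X X0 -/nT nTE lee_fin ltW.
  - by rewrite -/X X1 -/nD nDE lee_fin ltW.
have XtC : (sph_norm ip p (X (1 - t)%R) <= (n `^ t * m `^ (1 - t))%:E)%E.
  by have := Xt _ t01'; rewrite opprB addrCA subrr addr0.
have HzE : heinz ip T V t = (fun i x => 2^-1 *: (1%:C *: X t i x + 1%:C *: X (1 - t) i x)).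
  by apply/funext => i; apply/funext => x; rewrite !scale1r.
have HzE' : heinz ip T V t = (fun i x => 2^-1 *: (1%:C *: X (1 - t) i x + (1^-1)%:C *: X t i x)).
  by apply/funext => i; apply/funext => x; rewrite invr1 !scale1r addrC.
have HzE'' : heinz ip T V t =
    (fun i x => 2^-1 *: (1%:C *: X (1 - (1 - t)) i x + (1^-1)%:C *: X (1 - t) i x)).
  by apply/funext => i; apply/funext => x; rewrite invr1 !scale1r opprB addrCA subrr addr0.
have ub1 : (nH <= ((n `^ (1 - t) * m `^ t + n `^ t * m `^ (1 - t)) / 2)%:E)%E.
  have [_ _] := sph_norm_triangle ip_norm (fun i => Xb t i t01) (fun i => Xb (1 - t) i t01')
    (fun i => Xc t i t01) (fun i => Xc (1 - t) i t01') p_ge1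
    (mulr_ge0 (powR_ge0 _ _) (powR_ge0 _ _)) (mulr_ge0 (powR_ge0 _ _) (powR_ge0 _ _))
    (@ler01 R) (@ler01 R) (Xt t t01) XtC.
  by rewrite !mul1r -HzE.
have AH : (nA <= nH)%E.
  have [h [h0 hE]] := fin _ _ ub1; rewrite -/nH in hE; rewrite hE /nA XA.
  have [tle|/ltW tle] := leP t (1 - t).
    have := @family_amgm _ _ ip ip_norm E lam P EP PP Pd lam0 Pc d (fun i => V i : H -> H) p VP p_ge1
      t (1 - t) 1 h t_ge0 tle; rewrite -/X -HzE' -/nH hE => /(_ _ ltr01 h0 (lexx _)).
    by rewrite [t + (1 - t)]addrC subrK mul1r; apply; rewrite gerBl.
  have := @family_amgm _ _ ip ip_norm E lam P EP PP Pd lam0 Pc d (fun i => V i : H -> H) p VP p_ge1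
      (1 - t) t 1 h _ tle t_le1 ltr01 h0; rewrite -/X.
  have -> : (fun i x => 2^-1 *: (1%:C *: X t i x + (1^-1)%:C *: X (1 - t) i x)) = heinz ip T V t.
    by rewrite HzE invr1.
  rewrite -/nH hE subrK mul1r; apply=> //; by rewrite subr_ge0.
have ntt (r : R) : 0 <= r <= 1 -> n `^ r * n `^ (1 - r) = n.
  case/andP=> r0 r1; rewrite -powRD_ge0 ?subr_ge0//.
  by rewrite addrCA subrr addr0 powRr1.
(* the Duggal bound raised to the power [r] *)
have md_ub (r : R) : 0 <= r <= 1 -> m `^ r * n `^ (1 - r) <= d%:R `^ (r / p) * n.
  move=> r01; have /andP[r0 _] := r01; rewrite -[n in leRHS](ntt r)// mulrA ler_wpM2r ?powR_ge0//.
  rewrite [r / p]mulrC powRrM -powRM ?powR_ge0//.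
  by rewrite ge0_ler_powR ?nnegrE ?mulr_ge0 ?powR_ge0.
rewrite nDE nTE !poweR_EFin -!EFinM !lee_fin.
have ub1' : (nH <= (2^-1 * (m `^ t * n `^ (1 - t) + m `^ (1 - t) * n `^ t))%:E)%E.
  by apply: le_trans ub1 _; rewrite lee_fin le_eqVlt; apply/orP; left; apply/eqP; ring.
have C1 := md_ub t t01; have C2 := md_ub (1 - t) t01'.
rewrite opprB addrCA subrr addr0 in C2.
split; split=> //.
- by move: C1 C2; lra.
- apply: le_trans ub1' _; rewrite lee_fin ler_wpM2l//.
  have := powR_weighted_amgm m0 n0 t01; have := powR_weighted_amgm m0 n0 t01'.
  by rewrite opprB addrCA subrr addr0; lra.
- by move: mn; lra.
Qed.
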